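(* Let $A,S$ be non-negative random variables with $\mathbb{E}[A]=\mathbb{E}[S]=1$. Suppose that $\mathbb{E}[A^2]<\infty$, that $\mathbb{E}[S^{1+\epsilon}]<\infty$ for some $\epsilon\in(0,1]$ (higher moments may or may not exist), and that for some $B>0$, $Q^n_{A,S,B,2}(\infty)$ exists for all sufficiently large $n$. Then the family of random variables $\big\{n^{-\frac12}L^n_{A,S,B,2}(\infty)\big\}$, indexed by the integers $n>4B^2$ for which $Q^n_{A,S,B,2}(\infty)$ exists, is tight.
   Context: For $B>0$, $\alpha>1$ and an integer $n>B^{\frac{\alpha}{\alpha-1}}$, let $\lambda_{n,B,\alpha}=n-Bn^{1/\alpha}$, and let $\mathcal{Q}^n_{A,S,B,\alpha}$ be the first-come-first-served (FCFS) $GI/GI/n$ queue ($n$ identical parallel servers, infinite waiting room) with i.i.d. inter-arrival times distributed as $A/\lambda_{n,B,\alpha}$ and i.i.d. processing times distributed as $S$, independent of the arrivals. If, for any given initial condition, the total number of jobs in the system (in service plus waiting) converges in distribution as time goes to infinity to a (finite) random variable $Q^n_{A,S,B,\alpha}(\infty)$ whose law does not depend on the initial condition, we say that $Q^n_{A,S,B,\alpha}(\infty)$ exists. In that case $L^n_{A,S,B,\alpha}(\infty)=\big(Q^n_{A,S,B,\alpha}(\infty)-n\big)^+$ is the steady-state number of jobs waiting in queue. Here $\alpha=2$. *)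

(* Defs.v *)
From mathcomp Require Import all_boot all_order all_algebra finmap.
From mathcomp Require Import all_classical all_reals all_analysis.

Set Implicit Arguments.
Unset Strict Implicit.
Unset Printing Implicit Defensive.

Import Order.TTheory GRing.Theory Num.Theory.
Import numFieldNormedType.Exports.

Local Open Scope classical_set_scope.
Local Open Scope ring_scope.

Definition same_law (R : realType) (d d' : measure_display)
    (T : measurableType d) (T' : measurableType d')
    (P : probability T R) (P' : probability T' R)
    (X : {RV P >-> R}) (Y : {RV P' >-> R}) : Prop :=
  forall B : set R, measurable B -> distribution P X B = distribution P' Y B.

Definition mutually_independent (R : realType) (I : choiceType)
    (d : measure_display) (T : measurableType d) (P : probability T R)
    (X : I -> {RV P >-> R}) : Prop :=
  forall (J : {fset I}) (B : I -> set R),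
    (forall i, measurable (B i)) ->
    P (\bigcap_(i in [set` J]) (X i @^-1` B i)) =
    (\prod_(i <- J) P (X i @^-1` B i))%E.

(* The sequences of a GI/GI/n queue, before the inter-arrival times are
   rescaled by the arrival rate: the family of all [arr i] and [srv j] together
   is mutually independent. *)
Definition iid_primitives (R : realType)
    (dA dS d : measure_display) (TA : measurableType dA)
    (TS : measurableType dS) (T : measurableType d)
    (PA : probability TA R) (PS : probability TS R) (P : probability T R)
    (A : {RV PA >-> R}) (S : {RV PS >-> R})
    (arr srv : nat -> {RV P >-> R}) : Prop :=
  [/\ forall i, same_law (arr i) A,
      forall i, same_law (srv i) S &
      mutually_independent (fun k : nat + nat =>
        match k with inl i => arr i | inr j => srv j end)].

(* State of an n-server queue at time 0. Jobs in service are described by their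
   residual processing times; a job can be waiting only if all n servers are
   busy. Waiting jobs have not started, so their processing times are drawn
   from the i.i.d. service sequence, as for the jobs arriving later. *)
Record initial_condition (R : realType) (n : nat) := InitialCondition {
  residual_arrival : R;
  residual_services : seq R;
  initially_waiting : nat;
  residual_arrival_ge0 : 0 <= residual_arrival;
  residual_services_ge0 : all (fun r => 0 <= r) residual_services;
  residual_services_size : (size residual_services <= n)%N;
  no_idling : (0 < initially_waiting)%N -> size residual_services = n }.

(* Jobs are numbered in order of arrival, starting with those present at time 0
   (in service, then waiting), which count as arriving at time 0. Here [a] and
   [s] are realizations of the inter-arrival times and of the processing
   times. *)
Definition arrival_time (R : realType) (n : nat) (c : initial_condition R n)
    (a : nat -> R) (j : nat) : R :=
  let m := (size (residual_services c) + initially_waiting c)%N in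
  if (j < m)%N then 0 else residual_arrival c + \sum_(i < j - m) a i.

Definition processing_time (R : realType) (n : nat) (c : initial_condition R n)
    (s : nat -> R) (j : nat) : R :=
  let m := size (residual_services c) in
  if (j < m)%N then (residual_services c)`_j else s (j - m)%N.

(* [server_free_times n at_ pt j] is the increasing list of the epochs at which
   the n servers complete the jobs 0, ..., j-1 assigned to them, where job k
   arrives at [at_ k] and has processing time [pt k]. Under FCFS, job j goes to
   the server that becomes free first (Kiefer-Wolfowitz recursion, in absolute
   time). *)
Fixpoint server_free_times (R : realType) (n : nat) (at_ pt : nat -> R)
    (j : nat) : seq R :=
  if j is k.+1 then
    let f := server_free_times n at_ pt k in
    sort <=%R (Num.max (at_ k) (head 0 f) + pt k :: behead f)
  else nseq n 0.

Definition start_time (R : realType) (n : nat) (at_ pt : nat -> R) (j : nat) : R :=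
  Num.max (at_ j) (head 0 (server_free_times n at_ pt j)).

Definition departure_time (R : realType) (n : nat) (at_ pt : nat -> R)
    (j : nat) : R :=
  start_time n at_ pt j + pt j.

(* Number of jobs in system at time t, an extended real: it is +oo if
   infinitely many jobs are present. *)
Definition number_in_system (R : realType) (n : nat) (c : initial_condition R n)
    (a s : nat -> R) (t : R) : \bar R :=
  let at_ := arrival_time c a in
  let pt := processing_time c s in
  counting [set j : nat | at_ j <= t < departure_time n at_ pt j].

Definition arrival_rate (R : realType) (n : nat) (B alpha : R) : R :=
  n%:R - B * n%:R `^ alpha^-1.

Definition queue_process (R : realType) (d : measure_display)
    (T : measurableType d) (P : probability T R) (arr srv : nat -> {RV P >-> R})
    (B alpha : R) (n : nat) (c : initial_condition R n) (t : R) (w : T) : \bar R :=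
  number_in_system c (fun i => arr i w / arrival_rate n B alpha)
                     (fun i => srv i w) t.

(* Convergence in distribution, as t tends to +oo, to a finite random variable
   of law mu: convergence of the distribution functions at every continuity
   point of the limit. *)
Definition cvg_in_distribution (R : realType) (d : measure_display)
    (T : measurableType d) (P : probability T R) (X : R -> T -> \bar R)
    (mu : probability R R) : Prop :=
  forall x : R,
    {for x, continuous (fun y : R => mu `]-oo, y]%classic)} ->
    P [set w | (X t w <= x%:E)%E] @[t --> +oo] --> mu `]-oo, x]%classic.

Definition is_steady_state (R : realType) (d : measure_display)
    (T : measurableType d) (P : probability T R) (arr srv : nat -> {RV P >-> R})
    (B alpha : R) (n : nat) (mu : probability R R) : Prop :=
  forall c : initial_condition R n,
    cvg_in_distribution P (queue_process arr srv B alpha c) mu.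

Definition steady_state_exists (R : realType) (d : measure_display)
    (T : measurableType d) (P : probability T R) (arr srv : nat -> {RV P >-> R})
    (B alpha : R) (n : nat) : Prop :=
  exists mu : probability R R, is_steady_state arr srv B alpha n mu.

(* Tightness of the real random variables X i, i in D, each defined on its own
   probability space. *)
Definition tight (R : realType) (I : Type) (D : set I)
    (d : I -> measure_display) (T : forall i, measurableType (d i))
    (P : forall i, probability (T i) R) (X : forall i, T i -> R) : Prop :=
  forall eps : R, 0 < eps ->
    exists K : set R, compact K /\
      forall i, D i -> (P i (X i @^-1` (~` K)) <= eps%:E)%E.

(* Main.v *)
Require Import Defs.
From mathcomp Require Import all_boot all_order all_algebra finmap.
From mathcomp Require Import all_classical all_reals all_analysis.
From mathcomp Require Import measurable_realfun ring lra zify.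

Set Implicit Arguments.
Unset Strict Implicit.
Unset Printing Implicit Defensive.

Import Order.TTheory GRing.Theory Num.Theory.
Import numFieldNormedType.Exports.

Local Open Scope classical_set_scope.
Local Open Scope ring_scope.

(* Compare the queue with n servers that never idle: with all servers busy at
   time 0, a job can be late only if, over some window ending at the current
   epoch, the arrivals exceed the departures of n independent renewal processes
   by a multiple of sqrt n. Time is cut into slots of length of order 1/sqrt n
   and all variables are rounded to truncated integers, so that this becomes a
   statement on finite weighted lists. Residual times are drawn from the
   stationary law of the truncated renewal process. The drift B * sqrt n
   absorbs fluctuations of order sqrt n: a dyadic chaining over the windows needs
   only a fourth-moment type tail on short windows, a variance bound growing
   slower than the square of the length (from E[S^(1+eps)] < oo) on long ones, and
   E[A^2] < oo for the arrivals, whose lower tail is sub-Gaussian because A >= 0.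
   The bound is uniform in n and in time. It holds on average over the initial
   residual times, which suffices because the limit law does not depend on them. *)

(** * Finitely supported distributions *)

(** Letting time tend to infinity requires an initial law that does not depend on the time t,
    whereas truncating processing times harmlessly up to slot t requires a level H > t. So the
    initial residual times follow the residual law of one fixed level H0, chosen so that it is at
    most 1 + 1/n times the residual law of every larger level; over n servers this change of law
    costs at most (1 + 1/n)^n <= e. Short windows need more than a variance: at scale 2^-u there are
    2^u times as many increments while the variance falls only like 2^-u, so Chebyshev's inequality
    gives no decay in u. The exponential tail of nonnegative counts supplies the missing power. With
    s = sqrt n and slots of length 1/M, the drift is B s / M per slot. Half of it is left to the
    discretization of the arrivals, an eighth to rounding processing times up, and an eighth to each
    of the two fluctuation barriers. *)

Section FiniteDistributions.
Variable R : realType.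

(* A list of (outcome, weight) pairs; outcomes may be repeated. *)
Definition fdist (T : Type) := seq (T * R).

Definition fexp T (L : fdist T) (f : T -> R) : R := \sum_(x <- L) x.2 * f x.1.

Definition fpos T (L : fdist T) := all (fun x => 0 <= x.2) L.

Definition fprob T (L : fdist T) := fpos L /\ fexp L (fun=> 1) = 1.

Definition fret T (x : T) : fdist T := [:: (x, 1)].

Definition fbind T U (L : fdist T) (k : T -> fdist U) : fdist U :=
  flatten [seq [seq (y.1, x.2 * y.2) | y <- k x.1] | x <- L].

Definition fmap T U (g : T -> U) (L : fdist T) : fdist U :=
  [seq (g x.1, x.2) | x <- L].

Fixpoint fprod T (Ls : seq (fdist T)) : fdist (seq T) :=
  if Ls is L :: Ls' then fbind L (fun x => fmap (cons x) (fprod Ls'))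
  else fret [::].

Definition iid T (L : fdist T) (n : nat) := fprod (nseq n L).

Lemma fexp_ret T (x : T) f : fexp (fret x) f = f x.
Proof. by rewrite /fexp big_seq1 mul1r. Qed.

Lemma fexp_map T U (g : T -> U) L f : fexp (fmap g L) f = fexp L (f \o g).
Proof. by rewrite /fexp big_map. Qed.

Lemma eq_fexp T (L : fdist T) f g : f =1 g -> fexp L f = fexp L g.
Proof. by move=> fg; apply: eq_bigr => x _; rewrite fg. Qed.

Lemma fexpZ T (L : fdist T) a f : fexp L (fun x => a * f x) = a * fexp L f.
Proof. by rewrite /fexp mulr_sumr; apply: eq_bigr => x _; rewrite mulrCA. Qed.

Lemma fexpD T (L : fdist T) f g :
  fexp L (fun x => f x + g x) = fexp L f + fexp L g.
Proof. by rewrite -big_split; apply: eq_bigr => x _; rewrite mulrDr. Qed.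

Lemma fexpN T (L : fdist T) f : fexp L (fun x => - f x) = - fexp L f.
Proof. by rewrite /fexp -sumrN; apply: eq_bigr => x _; rewrite mulrN. Qed.

Lemma fexpB T (L : fdist T) f g :
  fexp L (fun x => f x - g x) = fexp L f - fexp L g.
Proof. by rewrite fexpD fexpN. Qed.

Lemma fexp_bind T U (L : fdist T) (k : T -> fdist U) f :
  fexp (fbind L k) f = fexp L (fun x => fexp (k x) f).
Proof.
rewrite /fexp big_flatten big_map; apply: eq_bigr => x _.
by rewrite big_map mulr_sumr; apply: eq_bigr => y _; rewrite mulrA.
Qed.

Lemma fexp_swap T U (L : fdist T) (M : fdist U) f :
  fexp L (fun x => fexp M (f x)) = fexp M (fun y => fexp L (f^~ y)).
Proof.
rewrite /fexp; under eq_bigr do rewrite mulr_sumr.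
rewrite exchange_big; apply: eq_bigr => y _.
by rewrite mulr_sumr; apply: eq_bigr => x _; rewrite mulrCA.
Qed.

Lemma fexp_sum T (L : fdist T) I (r : seq I) (P : pred I) (F : I -> T -> R) :
  fexp L (fun x => \sum_(i <- r | P i) F i x) =
  \sum_(i <- r | P i) fexp L (F i).
Proof.
rewrite /fexp exchange_big /=; apply: eq_bigr => x _.
by rewrite mulr_sumr.
Qed.

Lemma fexp_cst T (L : fdist T) a : fprob L -> fexp L (fun=> a) = a.
Proof.
by case=> _ L1; rewrite -[RHS]mulr1 -L1 -fexpZ; apply: eq_fexp => x; rewrite mulr1.
Qed.

Lemma fexp_le T (L : fdist T) f g :
  fpos L -> (forall x, f x <= g x) -> fexp L f <= fexp L g.
Proof.
rewrite /fexp /fpos => + fg; elim: L => [|x L IH] /=.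
  by rewrite !big_nil.
by move=> /andP[x0 L0]; rewrite !big_cons lerD ?IH ?ler_wpM2l.
Qed.

Lemma fexp_ge0 T (L : fdist T) f :
  fpos L -> (forall x, 0 <= f x) -> 0 <= fexp L f.
Proof.
move=> L0 f0; apply: le_trans (fexp_le L0 f0).
by rewrite /fexp big1 // => x _; rewrite mulr0.
Qed.

Lemma fprob_ret T (x : T) : fprob (fret x).
Proof. by split; rewrite ?fexp_ret //= /fpos /= ler01. Qed.

Lemma fprob_map T U (g : T -> U) (L : fdist T) : fprob L -> fprob (fmap g L).
Proof. by case=> L0 L1; split; rewrite ?fexp_map // /fpos all_map. Qed.

Lemma fprob_bind T U (L : fdist T) (k : T -> fdist U) :
  fprob L -> (forall x, fprob (k x)) -> fprob (fbind L k).
Proof.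
move=> pL pk; split; last first.
  rewrite fexp_bind (_ : (fun x => _) = fun=> 1) ?fexp_cst //.
  by apply/funext => x; case: (pk x).
case: pL => L0 _; rewrite /fpos /fbind; elim: L L0 => //= x L IH /andP[x0 L0].
rewrite all_cat IH // andbT all_map /=; case: (pk x.1) => + _.
by rewrite /fpos; apply: sub_all => y /= y0; rewrite mulr_ge0.
Qed.

Lemma fexp_prod_cons T (L : fdist T) Ls f :
  fexp (fprod (L :: Ls)) f =
  fexp L (fun x => fexp (fprod Ls) (fun l => f (x :: l))).
Proof. by rewrite /= fexp_bind; apply: eq_fexp => x; rewrite fexp_map. Qed.

Lemma fexp_iidS T (L : fdist T) n f :
  fexp (iid L n.+1) f =
  fexp L (fun x => fexp (iid L n) (fun l => f (x :: l))).
Proof. exact: fexp_prod_cons. Qed.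

Lemma fprob_prod T (Ls : seq (fdist T)) :
  (forall i, (i < size Ls)%N -> fprob (nth [::] Ls i)) -> fprob (fprod Ls).
Proof.
elim: Ls => [|L Ls IH] h; first exact: fprob_ret.
apply: fprob_bind; first exact: (h 0%N).
by move=> x; apply: fprob_map; apply: IH => i; exact: (h i.+1).
Qed.

Lemma fprob_iid T (L : fdist T) n : fprob L -> fprob (iid L n).
Proof.
move=> pL; apply: fprob_prod => i; rewrite size_nseq => ni.
by rewrite nth_nseq ni.
Qed.

(** The second draws of different entries do not interact, so all the first draws can be made
    beforehand. With [k] the renewal chain, this separates the initial residual times from the paths
    that start there. *)
Lemma fexp_iid_bind T U (L : fdist T) (k : T -> fdist U) n f :
  fexp (iid (fbind L k) n) f =
  fexp (iid L n) (fun l => fexp (fprod (map k l)) f).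
Proof.
elim: n f => [|n IH] f; first by rewrite !fexp_ret.
rewrite !fexp_iidS fexp_bind; apply: eq_fexp => x.
under eq_fexp do rewrite IH.
rewrite fexp_swap; apply: eq_fexp => l.
by rewrite -fexp_prod_cons.
Qed.

Lemma fexp_prod_bigM T (Ls : seq (fdist T)) (f : T -> R) :
  fexp (fprod Ls) (fun l => \prod_(x <- l) f x) = \prod_(L <- Ls) fexp L f.
Proof.
elim: Ls => [|L Ls IH]; first by rewrite fexp_ret !big_nil.
rewrite fexp_prod_cons big_cons -IH mulrC -fexpZ; apply: eq_fexp => x.
by under eq_fexp do rewrite big_cons; rewrite fexpZ mulrC.
Qed.

Lemma fexp_iid_bigM T (L : fdist T) n (f : T -> R) :
  fexp (iid L n) (fun l => \prod_(x <- l) f x) = fexp L f ^+ n.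
Proof. by rewrite fexp_prod_bigM big_nseq iter_mulr_1. Qed.

Lemma fexp_iid_sum T (L : fdist T) n (f : T -> R) : fprob L ->
  fexp (iid L n) (fun l => \sum_(x <- l) f x) = n%:R * fexp L f.
Proof.
move=> pL; elim: n => [|n IH]; first by rewrite fexp_ret big_nil mul0r.
rewrite fexp_iidS.
under eq_fexp => x do
  (under eq_fexp do rewrite big_cons; rewrite fexpD IH (fexp_cst _ (fprob_iid n pL))).
by rewrite fexpD fexp_cst // -natr1 mulrDl mul1r addrC.
Qed.

Lemma fexp_iid_sqr T (L : fdist T) n (f : T -> R) : fprob L ->
  fexp L f = 0 ->
  fexp (iid L n) (fun l => (\sum_(x <- l) f x) ^+ 2) =
  n%:R * fexp L (fun x => f x ^+ 2).
Proof.
move=> pL f0; elim: n => [|n IH].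
  by rewrite fexp_ret big_nil mul0r expr0n.
rewrite fexp_iidS.
transitivity (fexp L (fun x => f x ^+ 2 + n%:R * fexp L (fun x => f x ^+ 2))).
  apply: eq_fexp => x.
  transitivity (fexp (iid L n) (fun l => f x ^+ 2 +
      ((2 * f x) * (\sum_(y <- l) f y) + (\sum_(y <- l) f y) ^+ 2))).
    by apply: eq_fexp => l; rewrite big_cons; ring.
  rewrite fexpD (fexp_cst _ (fprob_iid n pL)) fexpD fexpZ fexp_iid_sum //.
  by rewrite f0 !mulr0 add0r IH.
by rewrite fexpD fexp_cst // -natr1 mulrDl mul1r addrC.
Qed.

(** Comparing laws through nonnegative test functions avoids densities, which are awkward for lists
    with repeated outcomes; the comparison tensorizes. *)
Lemma fexp_iid_le T (L L' : fdist T) (c : R) n F : fprob L -> fprob L' ->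
  0 <= c -> (forall f, (forall x, 0 <= f x) -> fexp L f <= c * fexp L' f) ->
  (forall l, 0 <= F l) -> fexp (iid L n) F <= c ^+ n * fexp (iid L' n) F.
Proof.
move=> pL pL' c0 LL'; elim: n F => [|n IH] F F0.
  by rewrite !fexp_ret expr0 mul1r.
rewrite !fexp_iidS.
apply: le_trans (LL' _ _) _ => [x|].
  by apply: fexp_ge0 => //; case: (fprob_iid n pL).
rewrite exprS -mulrA ler_wpM2l // -fexpZ; apply: fexp_le; first by case: pL'.
by move=> x; apply: IH.
Qed.

Definition ind (b : bool) : R := b%:R.

Lemma ind_ge0 b : 0 <= ind b. Proof. exact: ler0n. Qed.
Lemma ind_le1 b : ind b <= 1. Proof. by case: b; rewrite /ind ?ler01. Qed.

Lemma le_ind (b c : bool) : (b -> c) -> ind b <= ind c.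
Proof. by rewrite /ind; case: b c => [] [] h //; rewrite ?ler01 //; move: (h isT). Qed.

(** Common step of the Markov, Chebyshev and Chernoff bounds. *)
Lemma le_ind_ge0 (b : bool) (x : R) : 0 <= x -> (b -> 1 <= x) -> ind b <= x.
Proof. by rewrite /ind; case: b => // ? ->. Qed.

End FiniteDistributions.

(** * A single always-busy server *)

Section SingleServer.
Variables (R : realType) (p : fdist R nat).

(* Slotted renewal process: [r] is the number of slots before the next renewal,
   which takes place in a slot where [r = 0]; a draw [y] stands for a processing
   time of [y.+1] slots. *)
Definition trans (r : nat) : fdist R nat := if r is r'.+1 then fret R r' else p.

Fixpoint chain (b r : nat) : fdist R (seq nat) :=
  if b is b'.+1 then fmap (cons r) (fbind (trans r) (chain b'))
  else fret R [::].

Definition renewals (l : seq nat) : R := (count (pred1 0%N) l)%:R.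

Definition mean_service : R := fexp p (fun y => y.+1%:R).

(** The equilibrium law of renewal theory, with mass P(y >= r) / E[y + 1] at r. Listing only r < H
    loses no mass when [p] lives below H. *)
Definition residual_law (H : nat) : fdist R nat :=
  [seq (r, fexp p (fun y => ind R (r <= y)%N) / mean_service) | r <- iota 0 H].

Hypothesis pp : fprob p.

Lemma fprob_trans r : fprob (trans r).
Proof. by case: r => [|r] //=; apply: fprob_ret. Qed.

Lemma fprob_chain b r : fprob (chain b r).
Proof.
elim: b r => [|b IH] r /=; first exact: fprob_ret.
by apply: fprob_map; apply: fprob_bind => //; apply: fprob_trans.
Qed.

Lemma fexp_chainS b r F :
  fexp (chain b.+1 r) F =
  fexp (trans r) (fun r' => fexp (chain b r') (fun l => F (r :: l))).
Proof. by rewrite /= fexp_map fexp_bind. Qed.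

Lemma fexp_chain_le b r F G : (forall l, size l = b -> F l <= G l) ->
  fexp (chain b r) F <= fexp (chain b r) G.
Proof.
elim: b r F G => [|b IH] r F G FG; first by rewrite !fexp_ret FG.
rewrite !fexp_chainS; apply: fexp_le; first by case: (fprob_trans r).
by move=> r'; apply: IH => l sl; rewrite FG //= sl.
Qed.

Lemma fexp_chain_take b k r F :
  fexp (chain (b + k) r) (fun l => F (take b l)) = fexp (chain b r) F.
Proof.
elim: b r F => [|b IH] r F.
  under eq_fexp do rewrite take0.
  by rewrite fexp_ret fexp_cst //; apply: fprob_chain.
by rewrite addSn !fexp_chainS; apply: eq_fexp => r'; rewrite -IH.
Qed.

(** Of a path r, r_1, ..., r_m only the first m states are kept. The form on the left also shows the
    final state r_m, which the martingale below needs. *)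
Lemma fexp_chain_belast m r F :
  fexp (fbind (trans r) (chain m)) (fun l => F (belast r l)) =
  fexp (chain m r) F.
Proof.
rewrite fexp_bind; elim: m r F => [|m IH] r F.
  under eq_fexp do rewrite fexp_ret.
  by rewrite fexp_ret fexp_cst //; apply: fprob_trans.
rewrite fexp_chainS; apply: eq_fexp => r'.
by rewrite fexp_chainS -IH.
Qed.

(** * The renewal martingale for processing times cut at level c *)

Section Truncation.
Variable c : nat.

Definition trunc_mean : R := fexp p (fun y => (minn y c).+1%:R).
Definition excess_mean : R := fexp p (fun y => (y - c)%:R).
Definition trunc_sqr : R := fexp p (fun y => (minn y c).+1%:R ^+ 2).

(** The increment vanishes while the residual counts down and equals [trunc_mean - (minn y c).+1] at
    a renewal that draws [y]: a martingale. Telescoped, it expresses the renewal count through times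
    cut at c, hence without a second moment of the full processing time. *)
Fixpoint mart (r : nat) (l : seq nat) : R :=
  if l is r' :: l' then
    trunc_mean * (r == 0%N)%:R - (r <= c)%N%:R - (minn r' c)%:R + (minn r c)%:R
    + mart r' l'
  else 0.

Lemma mart_telescope r l :
  mart r l = trunc_mean * renewals (belast r l)
    - (count (fun s => s <= c)%N (belast r l))%:R
    - (minn (last r l) c)%:R + (minn r c)%:R.
Proof.
elim: l r => [|r' l IH] r /=; rewrite /renewals /=; first by ring.
by rewrite IH /renewals !natrD; ring.
Qed.

Lemma mart_cons r r' l : mart r (r' :: l) =
  trunc_mean * (r == 0%N)%:R - (r <= c)%N%:R - (minn r' c)%:R + (minn r c)%:R
  + mart r' l.
Proof. by []. Qed.

Lemma mart_incr r r' l : mart r.+1 (r :: l) = mart r l /\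
  mart 0 (r' :: l) = trunc_mean - (minn r' c).+1%:R + mart r' l.
Proof.
have n0 : ((r.+1 == 0%N)%:R : R) = 0 by [].
rewrite !mart_cons; split; last first.
  by rewrite eqxx leq0n min0n -[(minn r' c).+1%:R]natr1 !mulr1n; ring.
rewrite n0; case: (boolP (r.+1 <= c)%N) => rc.
  have -> : minn r.+1 c = r.+1 by apply/minn_idPl.
  have -> : minn r c = r by apply/minn_idPl/ltnW.
  by rewrite -[r.+1%:R]natr1 mulr1n; ring.
rewrite -leqNgt in rc.
have -> : minn r.+1 c = c by apply/minn_idPr/leqW.
have -> : minn r c = c by apply/minn_idPr.
by rewrite mulr0n; ring.
Qed.

Lemma fexp_mart m r :
  fexp (fbind (trans r) (chain m)) (mart r) = 0.
Proof.
rewrite fexp_bind; elim: m r => [|m IH] [|r].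
- under eq_fexp do rewrite fexp_ret.
  by rewrite /= fexp_cst.
- by rewrite !fexp_ret.
- under eq_fexp => y do (rewrite fexp_chainS; under eq_fexp => z do
    (under eq_fexp do rewrite (mart_incr 0 y _).2; rewrite fexpD
     (fexp_cst _ (fprob_chain _ _)))).
  under eq_fexp do rewrite fexpD (fexp_cst _ (fprob_trans _)) IH addr0.
  by rewrite /= fexpB (fexp_cst _ pp) subrr.
- rewrite /= fexp_ret fexp_chainS -[RHS](IH r); apply: eq_fexp => y.
  by apply: eq_fexp => l; case: (mart_incr r r l).
Qed.

(** Martingale increments are orthogonal, so the second moment is the variance of one draw times the
    expected number of renewals. The offset [x] lets the induction absorb the increments already
    made. *)
Lemma fexp_mart_sqr m r x :
  fexp (fbind (trans r) (chain m)) (fun l => (x + mart r l) ^+ 2) =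
  x ^+ 2 + fexp p (fun y => (trunc_mean - (minn y c).+1%:R) ^+ 2) *
    fexp (chain m r) renewals.
Proof.
set V := fexp p _.
rewrite fexp_bind; elim: m r x => [|m IH] [|r] x.
- under eq_fexp do rewrite fexp_ret.
  by rewrite /= fexp_cst // fexp_ret /renewals /= mulr0 !addr0.
- by rewrite !fexp_ret /renewals /= mulr0 !addr0.
- under eq_fexp => y do (rewrite fexp_chainS; under eq_fexp => z do
    (under eq_fexp do rewrite (mart_incr 0 y _).2 addrA)).
  under eq_fexp do rewrite IH.
  rewrite fexpD fexpZ fexp_chainS.
  rewrite (_ : fexp p (fun y => fexp (chain m y) (fun l => renewals (0%N :: l)))
    = 1 + fexp p (fun y => fexp (chain m y) renewals)); last first.
    under eq_fexp => y do (under eq_fexp do rewrite /renewals /= natrD;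
       rewrite fexpD (fexp_cst _ (fprob_chain _ _))).
    by rewrite fexpD fexp_cst.
  rewrite mulrDr mulr1 addrA; congr (_ + _).
  transitivity (fexp p (fun y => x ^+ 2 + (2 * x * (trunc_mean - (minn y c).+1%:R)
     + (trunc_mean - (minn y c).+1%:R) ^+ 2))).
    by apply: eq_fexp => y; ring.
  rewrite fexpD fexp_cst // fexpD fexpZ fexpB fexp_cst //.
  by rewrite /trunc_mean subrr mulr0 add0r.
- rewrite /= fexp_ret fexp_chainS.
  transitivity (fexp (trans r) (fun r' => fexp (chain m r')
     (fun l => (x + mart r l) ^+ 2))).
    apply: eq_fexp => y; apply: eq_fexp => l; congr ((_ + _) ^+ 2).
    by case: (mart_incr r r l).
  rewrite IH; congr (_ + _ * _).
  have /= -> := fexp_chainS m r.+1 renewals; rewrite fexp_ret.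
  exact: eq_fexp.
Qed.

(* Wald's identity for the truncated processing times. *)
Lemma renewals_le m r :
  trunc_mean * fexp (chain m r) renewals <= m%:R + c%:R.
Proof.
rewrite -subr_le0 -(fexp_mart m r).
rewrite -(fexp_chain_belast m r renewals) -fexpZ.
rewrite -[X in _ - X](@fexp_cst _ _ (fbind (trans r) (chain m))); last first.
  by apply: fprob_bind (fprob_trans _) (fprob_chain _).
rewrite -fexpB !fexp_bind; apply: fexp_le; first by case: (fprob_trans r).
move=> r'; apply: fexp_chain_le => l sl.
rewrite mart_telescope.
have h1 : ((count (fun s => s <= c)%N (belast r l))%:R : R) <= m%:R.
  by rewrite ler_nat -sl -(size_belast r) count_size.
have h2 : ((minn (last r l) c)%:R : R) <= c%:R by rewrite ler_nat geq_minr.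
have h3 : (0 : R) <= (minn r c)%:R by rewrite ler0n.
by lra.
Qed.

End Truncation.

(** * The stationary renewal process and the variance of its counts *)

Section Stationarity.
Variable H : nat.
Hypothesis p_lt : all (fun x => x.1 < H)%N p.

Let mu := mean_service.
Let pi := residual_law H.

Lemma mean_service_ge1 : 1 <= mu.
Proof.
rewrite -[leLHS](fexp_cst 1 pp); apply: fexp_le; first by case: pp.
by move=> y; rewrite -natr1 lerDr ler0n.
Qed.

Lemma mean_service_gt0 : 0 < mu.
Proof. exact: lt_le_trans ltr01 mean_service_ge1. Qed.

Lemma fexp_residual_law f :
  fexp pi f = mu^-1 * fexp p (fun y => \sum_(r < y.+1) f r).
Proof.
rewrite /fexp big_map mulr_sumr.
transitivity (\sum_(r <- iota 0 H) mu^-1 *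
    fexp p (fun y => ind R (r <= y)%N * f r)).
  apply: eq_bigr => r _ /=; rewrite /fexp mulr_sumr -mulrA mulr_suml.
  by apply: eq_bigr => x _; rewrite /mu; ring.
rewrite -mulr_sumr -fexp_sum /fexp mulr_sumr; apply: eq_big_seq => x xp.
congr (_ * (_ * _)); move/allP: p_lt => /(_ _ xp) xH.
rewrite -[RHS](big_mkord xpredT) (big_nat_widen _ _ _ _ _ xH) /=.
rewrite /index_iota subn0 [RHS]big_mkcond; apply: eq_bigr => i _.
by rewrite ltnS /ind; case: (i <= x.1)%N; rewrite ?mul1r ?mul0r.
Qed.

Lemma fprob_residual_law : fprob pi.
Proof.
split.
  rewrite /fpos all_map; apply/allP => r _ /=; apply: divr_ge0.
    by apply: fexp_ge0 => [|y]; [case: pp|exact: ind_ge0].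
  exact: ltW mean_service_gt0.
rewrite fexp_residual_law.
under eq_fexp do rewrite sumr_const card_ord.
by rewrite mulVf // gt_eqF // mean_service_gt0.
Qed.

(** Moving down by one slot loses the top value [y] from the sum over [r <= y], and the renewal at
    [r = 0] adds a fresh draw; both contribute [fexp p f]. *)
Lemma residual_law_stationary f :
  fexp pi (fun r => fexp (trans r) f) = fexp pi f.
Proof.
rewrite !fexp_residual_law; congr (_ * _).
under eq_fexp => y do (rewrite big_ord_recl /=; under eq_bigr do rewrite /= fexp_ret).
rewrite fexpD fexp_cst //.
under [RHS]eq_fexp do rewrite big_ord_recr /=.
by rewrite fexpD addrC.
Qed.

Definition busy_path b := fbind pi (chain b).

Lemma fprob_busy_path b : fprob (busy_path b).
Proof. by apply: fprob_bind fprob_residual_law (fprob_chain _). Qed.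

Lemma fexp_busy_pathS b F :
  fexp (busy_path b.+1) (fun l => F (behead l)) = fexp (busy_path b) F.
Proof.
rewrite !fexp_bind -[RHS]residual_law_stationary; apply: eq_fexp => r.
by rewrite fexp_chainS.
Qed.

Lemma fexp_busy_path_window k w j F :
  fexp (busy_path (k + (w + j))) (fun l => F (take w (drop k l))) =
  fexp (busy_path w) F.
Proof.
elim: k => [|k IH].
  rewrite add0n; under eq_fexp do rewrite drop0.
  by rewrite /busy_path !fexp_bind; apply: eq_fexp => r; rewrite fexp_chain_take.
rewrite -IH addSn -[RHS]fexp_busy_pathS; apply: eq_fexp => l.
by rewrite -drop1 drop_drop addn1.
Qed.

Lemma fexp_busy_path_count m (a : pred nat) :
  fexp (busy_path m) (fun l => (count a l)%:R) =
  m%:R * fexp pi (fun r => ind R (a r)).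
Proof.
elim: m => [|m IH].
  rewrite fexp_bind.
  under eq_fexp do rewrite fexp_ret /=.
  by rewrite mul0r fexp_cst //; apply: fprob_residual_law.
rewrite fexp_bind; under eq_fexp => r do (rewrite fexp_chainS;
  under eq_fexp => r' do
    (under eq_fexp do rewrite /= natrD; rewrite fexpD (fexp_cst _ (fprob_chain _ _)))).
under eq_fexp => r do rewrite fexpD (fexp_cst _ (fprob_trans _)).
rewrite fexpD residual_law_stationary -fexp_bind IH.
by rewrite -natr1; ring.
Qed.

Lemma residual_law0 g :
  fexp pi (fun r => (r == 0%N)%:R * g r) = g 0%N / mu.
Proof.
rewrite fexp_residual_law [RHS]mulrC; congr (_ * _).
rewrite -[RHS](fexp_cst _ pp); apply: eq_fexp => y.
by rewrite big_ord_recl /= mul1r big1 ?addr0 // => i _; rewrite mul0r.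
Qed.

Lemma residual_law_gt c :
  fexp pi (fun r => ind R (c < r)%N) = excess_mean c / mu.
Proof.
rewrite fexp_residual_law [RHS]mulrC; congr (_ * _); apply: eq_fexp => y.
rewrite /ind -natr_sum; congr (_%:R).
elim: y => [|y IH]; first by rewrite big_ord_recl big_ord0 sub0n.
by rewrite big_ord_recr IH /=; case: (ltnP c y.+1) => h; lia.
Qed.

Lemma sum_minn_sqr c y :
  (\sum_(r < y.+1) minn r c ^ 2 <= c * minn y c ^ 2 + c ^ 2 * (y - c))%N.
Proof.
elim: y => [|y IH].
  by rewrite big_ord_recl big_ord0 min0n addn0 exp0n.
rewrite big_ord_recr /=; apply: leq_trans (leq_add IH (leqnn _)) _.
case: (boolP (y.+1 <= c)%N) => yc.
  have -> : minn y c = y by apply/minn_idPl/ltnW.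
  have -> : minn y.+1 c = y.+1 by apply/minn_idPl.
  have -> : (y - c = 0)%N by lia.
  have -> : (y.+1 - c = 0)%N by lia.
  by rewrite !muln0 !addn0; nia.
rewrite -leqNgt in yc.
have -> : minn y.+1 c = c by apply/minn_idPr/leqW.
have -> : minn y c = c by apply/minn_idPr.
rewrite subSn //; nia.
Qed.

Lemma residual_law_trunc_sqr c :
  fexp pi (fun r => (minn r c)%:R ^+ 2) <=
  (c%:R * trunc_sqr c + c%:R ^+ 2 * excess_mean c) / mu.
Proof.
rewrite fexp_residual_law mulrC ler_pM2r ?invr_gt0 ?mean_service_gt0 //.
rewrite -!fexpZ -fexpD; apply: fexp_le; first by case: pp.
move=> y.
have h : (\sum_(r < y.+1) (minn r c)%:R ^+ 2 : R) =
    (\sum_(r < y.+1) minn r c ^ 2)%N%:R.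
  by rewrite natr_sum; apply: eq_bigr => i _; rewrite natrX.
rewrite h -!natrX -!natrM -natrD ler_nat.
apply: leq_trans (sum_minn_sqr c y) _; rewrite leq_add2r leq_mul2l leq_sqr.
by rewrite leqnSn orbT.
Qed.

Lemma trunc_mean_excess c : trunc_mean c + excess_mean c = mu.
Proof.
rewrite /trunc_mean /excess_mean -fexpD; apply: eq_fexp => y.
by rewrite -natrD; congr (_%:R); lia.
Qed.

Lemma fexp_renewals m : fexp (busy_path m) renewals = m%:R / mu.
Proof.
rewrite fexp_busy_path_count; congr (_ * _).
rewrite -[RHS]mul1r -(residual_law0 (fun=> 1)).
by apply: eq_fexp => r; rewrite mulr1.
Qed.

(** A further slot in front turns N^2 into N^2 + 1{r = 0} (1 + 2 N). By stationarity a renewal there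
    has probability 1 / mu, and after it the count has mean at most U, so the bound grows linearly
    in m. *)
Lemma fexp_renewals_sqr M U m :
  (forall m' y, (m' <= M)%N -> fexp (chain m' y) renewals <= U) -> (m <= M)%N ->
  fexp (busy_path m) (fun l => renewals l ^+ 2) <= m%:R * ((1 + 2 * U) / mu).
Proof.
move=> hU; elim: m => [|m IH] mM.
  rewrite fexp_bind; under eq_fexp do rewrite fexp_ret /renewals /= expr0n.
  by rewrite fexp_cst ?mul0r //; apply: fprob_residual_law.
rewrite fexp_bind; under eq_fexp => r do (rewrite fexp_chainS).
apply: le_trans (_ : fexp pi (fun r => (r == 0%N)%:R *
     fexp (trans r) (fun r' => fexp (chain m r') (fun l => 1 + 2 * renewals l))
    + fexp (trans r) (fun r' => fexp (chain m r') (fun l => renewals l ^+ 2))) <= _).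
  apply: fexp_le; first by case: fprob_residual_law.
  move=> r; rewrite -fexpZ -fexpD; apply: fexp_le; first by case: (fprob_trans r).
  move=> r'; rewrite -fexpZ -fexpD; apply: fexp_le; first by case: (fprob_chain m r').
  move=> l; rewrite {1}/renewals /= natrD /renewals.
  by case: (r == 0%N) => /=; rewrite ?(mul0r, mul1r, add0r) // sqrrD expr1n mulr2n; lra.
rewrite fexpD residual_law0 residual_law_stationary.
move: (IH (ltnW mM)); rewrite fexp_bind => IHm.
rewrite -[m.+1%:R]natr1 [leRHS]mulrDl mul1r [leLHS]addrC.
apply: lerD IHm _.
rewrite ler_pM2r ?invr_gt0 ?mean_service_gt0 //.
rewrite -[leRHS](fexp_cst _ pp); apply: fexp_le; first by case: pp.
move=> y; rewrite fexpD (fexp_cst _ (fprob_chain _ _)) fexpZ.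
by rewrite lerD2l ler_pM2l // hU // ltnW.
Qed.

Lemma fexp_last m f :
  fexp pi (fun r => fexp (fbind (trans r) (chain m)) (fun l => f (last r l))) =
  fexp pi f.
Proof.
elim: m => [|m IH].
  apply: eq_fexp => r; rewrite fexp_bind.
  under eq_fexp do rewrite fexp_ret /=.
  by rewrite fexp_cst //; apply: fprob_trans.
rewrite -[RHS]IH -[RHS]residual_law_stationary; apply: eq_fexp => r.
rewrite fexp_bind; apply: eq_fexp => r'.
by rewrite fexp_chainS fexp_bind.
Qed.

(** The martingale writes [trunc_mean c] times the centred count as d - K, two boundary terms and
    the martingale itself, where K counts the slots with residual above c and d is its mean. Both
    lie in [0, m], so (d - K)^2 <= m (d + K): long processing times enter only through their mean
    excess. *)
Lemma fexp_renewals_var c m :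
  trunc_mean c ^+ 2 *
    fexp (busy_path m) (fun l => (renewals l - m%:R / mu) ^+ 2) <=
  4 * (2 * m%:R ^+ 2 * excess_mean c
       + 2 * (c%:R * trunc_sqr c + c%:R ^+ 2 * excess_mean c)
       + m%:R * trunc_sqr c) / mu.
Proof.
set g := trunc_mean c; set D := excess_mean c.
have mu0 := mean_service_gt0.
pose d := m%:R * (D / mu).
have dE : d = m%:R - g * (m%:R / mu).
  rewrite /d (_ : D = mu - g) /g /D ?mulrBl ?mulfV ?gt_eqF //; first by ring.
  by rewrite -(trunc_mean_excess c); ring.
have D0 : 0 <= D by apply: fexp_ge0 => [|y]; [case: pp|exact: ler0n].
have d0 : 0 <= d by rewrite !mulr_ge0 ?invr_ge0 ?(ltW mu0).
have dm : d <= m%:R.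
  rewrite dE lerBlDr lerDl !mulr_ge0 ?invr_ge0 ?(ltW mu0) //.
  by apply: fexp_ge0 => [|y]; [case: pp|exact: ler0n].
have pi0 : fpos pi by case: fprob_residual_law.
have key r : fexp (chain m r) (fun l => (g * (renewals l - m%:R / mu)) ^+ 2) <=
    4 * (m%:R * (d + fexp (chain m r) (fun l => (count (fun s => c < s)%N l)%:R))
    + fexp (fbind (trans r) (chain m)) (fun l => (minn (last r l) c)%:R ^+ 2)
    + (minn r c)%:R ^+ 2
    + trunc_sqr c * fexp (chain m r) renewals).
  pose K l : R := (count (fun s => c < s)%N (belast r l))%:R.
  apply: le_trans (_ : fexp (fbind (trans r) (chain m)) (fun l => 4 * (m%:R * (d + K l)
     + (minn (last r l) c)%:R ^+ 2 + (minn r c)%:R ^+ 2 + (0 + mart c r l) ^+ 2)) <= _).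
    rewrite -fexp_chain_belast !fexp_bind; apply: fexp_le.
      by case: (fprob_trans r).
    move=> r'; apply: fexp_chain_le => l sl.
    have sK : m%:R = (count (fun s => s <= c)%N (belast r l))%:R + K l.
      rewrite -natrD -sl -(size_belast r) -(count_predC (fun s => s <= c)%N).
      by congr ((_ + _)%:R); apply: eq_count => s /=; rewrite ltnNge.
    have K0 : 0 <= K l by exact: ler0n.
    have Km : K l <= m%:R.
      by rewrite ler_nat -sl -(size_belast r) count_size.
    have -> : g * (renewals (belast r l) - m%:R / mu) =
       (d - K l) + (minn (last r l) c)%:R - (minn r c)%:R + mart c r l.
      by rewrite mart_telescope dE sK /g; ring.
    have dK : (d - K l) ^+ 2 <= m%:R * (d + K l).
      have -> : (d - K l) ^+ 2 = d * d + K l * K l - 2 * (d * K l) by ring.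
      have : d * d <= m%:R * d by rewrite ler_wpM2r.
      have : K l * K l <= m%:R * K l by rewrite ler_wpM2r.
      have : 0 <= d * K l by rewrite mulr_ge0.
      by rewrite mulrDr; lra.
    rewrite add0r; move: (mart c r l) (minn _ c)%:R (minn r c)%:R dK.
    move: (d - K l) (m%:R * (d + K l)) => u W x y z dK.
    (* Four times the sum of four squares minus the square of the sum equals this sum over the six
       pairs. *)
    have : 0 <= (u - y) ^+ 2 + (u + z) ^+ 2 + (u - x) ^+ 2 + (y + z) ^+ 2
       + (y - x) ^+ 2 + (z + x) ^+ 2 by rewrite !addr_ge0 ?sqr_ge0.
    by nra.
  have pq : fprob (fbind (trans r) (chain m)).
    by apply: fprob_bind (fprob_trans _) (fprob_chain _).
  rewrite fexpZ !fexpD (fexp_cst _ pq) fexpZ fexpD (fexp_cst _ pq).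
  rewrite (fexp_chain_belast m r (fun l => (count (fun s => c < s)%N l)%:R)).
  rewrite ler_pM2l // lerD2l fexp_mart_sqr expr0n add0r.
  apply: ler_wpM2r; first by apply: fexp_ge0 => [|y]; [case: (fprob_chain m r)|exact: ler0n].
  rewrite /trunc_sqr -subr_ge0.
  rewrite (_ : _ - _ = g ^+ 2) ?sqr_ge0 // -fexpB.
  transitivity (fexp p (fun y => 2 * g * (minn y c).+1%:R - g ^+ 2)).
    by apply: eq_fexp => y; rewrite -/g; ring.
  by rewrite fexpB fexpZ fexp_cst // -/g /g /trunc_mean; ring.
rewrite -fexpZ.
under eq_fexp do rewrite -exprMn.
rewrite fexp_bind; apply: le_trans (fexp_le pi0 key) _.
rewrite fexpZ !fexpD !fexpZ fexpD (fexp_cst _ fprob_residual_law).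
rewrite -!fexp_bind fexp_renewals.
have -> : fexp (fbind pi (chain m)) (fun l => (count (fun s => c < s)%N l)%:R) = d.
  by rewrite fexp_busy_path_count residual_law_gt.
rewrite (fexp_last m (fun r => (minn r c)%:R ^+ 2)).
have := residual_law_trunc_sqr c; set Q := fexp pi _; rewrite -/D => hQ.
have -> : 4 * (2 * m%:R ^+ 2 * D + 2 * (c%:R * trunc_sqr c + c%:R ^+ 2 * D) +
   m%:R * trunc_sqr c) / mu = 4 * (m%:R * (d + d) + 2 *
    ((c%:R * trunc_sqr c + c%:R ^+ 2 * D) / mu) + trunc_sqr c * (m%:R / mu)).
  by rewrite /d; field; rewrite gt_eqF.
by rewrite ler_pM2l // lerD2r -addrA lerD2l; lra.
Qed.

End Stationarity.
End SingleServer.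

(** * Departures of n stationary servers over a window *)

Section Exponential.
Variable R : realType.
Implicit Types x : R.

Lemma expRN_le_quadratic x : 0 <= x -> expR (- x) <= 1 - x + x ^+ 2.
Proof.
move=> x0; have x1 : 0 < 1 + x by lra.
rewrite expRN; apply: le_trans (_ : (1 + x)^-1 <= _).
  by rewrite lef_pV2 ?posrE ?expR_gt0 // expR_ge1Dx.
rewrite -[leLHS]mul1r ler_pdivrMr //.
have : 0 <= x ^+ 3 by rewrite exprn_ge0.
have -> : (1 - x + x ^+ 2) * (1 + x) = 1 + x ^+ 3 by ring.
by lra.
Qed.

Lemma expRN_le_inv_sqr x : 0 < x -> expR (- x) <= 4 / x ^+ 2.
Proof.
move=> x0; rewrite expRN -[leRHS]invrK lef_pV2 ?posrE ?expR_gt0 //; last first.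
  by rewrite invr_gt0 divr_gt0 // exprn_gt0.
have -> : expR x = expR (x / 2) ^+ 2.
  by rewrite -expRM_natl; congr expR; lra.
have h := expR_ge1Dx (x / 2).
rewrite invf_div (_ : x ^+ 2 / 4 = (x / 2) ^+ 2); last by field.
have x2 : 0 <= x / 2 by lra.
have h2 : x / 2 <= expR (x / 2) by lra.
by rewrite lerXn2r // nnegrE expR_ge0.
Qed.

Lemma ind_le_expR (y : R) : ind R (0 < y) <= expR y.
Proof.
apply: le_ind_ge0 (expR_ge0 _) _ => y0.
by apply: le_trans (expR_ge1Dx y); lra.
Qed.

End Exponential.

(** * Tails of the departure deficit over one window *)

Section Departures.
Variables (R : realType) (p : fdist R nat) (H : nat).
Hypotheses (pp : fprob p) (p_lt : all (fun x => x.1 < H)%N p).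

Let mu : R := mean_service p.

Definition deficit b (ps : seq (seq nat)) (m : nat) : R :=
  \sum_(l <- ps) (m%:R / mu - renewals R (drop (b - m) l)).

Lemma deficit_window b ps lo w : (lo + w <= b)%N ->
  deficit b ps (lo + w) - deficit b ps lo =
  \sum_(l <- ps) (w%:R / mu - renewals R (take w (drop (b - (lo + w)) l))).
Proof.
move=> wb; rewrite /deficit -sumrB; apply: eq_bigr => l _.
rewrite -{1}(cat_take_drop w (drop (b - (lo + w)) l)) drop_drop.
rewrite (_ : (w + (b - (lo + w)))%N = (b - lo)%N); last by lia.
by rewrite /renewals count_cat !natrD mulrDl; ring.
Qed.

Lemma fexp_window b lo w (f : seq nat -> R) : (lo + w <= b)%N ->
  fexp (busy_path p H b) (fun l => f (take w (drop (b - (lo + w)) l))) =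
  fexp (busy_path p H w) f.
Proof.
move=> wb; rewrite -[RHS](fexp_busy_path_window pp p_lt (b - (lo + w)) w lo).
by congr (fexp (busy_path _ _ _)); lia.
Qed.

Lemma deficit_tail_var n b lo w (V s : R) : (lo + w <= b)%N -> 0 < s ->
  fexp (busy_path p H w) (fun l => (renewals R l - w%:R / mu) ^+ 2) <= V ->
  fexp (iid (busy_path p H b) n)
    (fun ps => ind R (s < deficit b ps (lo + w) - deficit b ps lo)) <=
  n%:R * V / s ^+ 2.
Proof.
move=> wb s0 hV.
pose X l := w%:R / mu - renewals R (take w (drop (b - (lo + w)) l)).
have pb := fprob_busy_path pp p_lt b.
have s20 : 0 < s ^+ 2 by rewrite exprn_gt0.
apply: le_trans (_ : fexp (iid (busy_path p H b) n)
   (fun ps => (s ^+ 2)^-1 * (\sum_(l <- ps) X l) ^+ 2) <= _).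
  apply: fexp_le; first by case: (fprob_iid n pb).
  move=> ps; rewrite deficit_window //; apply: le_ind_ge0.
    by rewrite mulr_ge0 ?sqr_ge0 // invr_ge0 ltW.
  move=> h; rewrite mulrC ler_pdivlMr // mul1r ler_sqr ?nnegrE ?(ltW s0) ?ltW //.
  exact: lt_trans h.
rewrite fexpZ fexp_iid_sqr //; last first.
  rewrite (fexp_window (fun l => w%:R / mu - renewals R l) wb) fexpB.
  by rewrite (fexp_renewals pp p_lt) fexp_cst ?subrr //; exact: fprob_busy_path.
rewrite (fexp_window (fun l => (w%:R / mu - renewals R l) ^+ 2) wb).
rewrite mulrC ler_pM2r ?invr_gt0 // ler_wpM2l //.
by apply: le_trans hV; apply: fexp_le => [|l]; [case: (fprob_busy_path pp p_lt w)|rewrite -sqrrN opprB].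
Qed.

(** Chernoff's bound. Renewal counts are nonnegative, so exp(-x) <= 1 - x + x^2 controls the lower
    tail from second moments only. The resulting exp(-s^2 / (4 n V)) is weakened to an inverse
    fourth power of s, the form used in the chaining. *)
Lemma deficit_tail_exp n b lo w (V s : R) : (lo + w <= b)%N -> 0 < s ->
  (0 < n)%N -> 0 < V ->
  fexp (busy_path p H w) (fun l => renewals R l ^+ 2) <= V ->
  fexp (iid (busy_path p H b) n)
    (fun ps => ind R (s < deficit b ps (lo + w) - deficit b ps lo)) <=
  64 * (n%:R * V / s ^+ 2) ^+ 2.
Proof.
move=> wb s0 n0 V0 hV.
have nr0 : 0 < n%:R :> R by rewrite ltr0n.
(* Minimizes -th s + n th^2 V. *)
pose th := s / (2 * n%:R * V).
have th0 : 0 < th by rewrite divr_gt0 ?mulr_gt0.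
pose X l := w%:R / mu - renewals R (take w (drop (b - (lo + w)) l)).
have pb := fprob_busy_path pp p_lt b.
have hX : fexp (busy_path p H b) (fun l => expR (th * X l)) <=
    expR (th ^+ 2 * V).
  rewrite (fexp_window (fun l => expR (th * (w%:R / mu - renewals R l))) wb).
  apply: le_trans (_ : fexp (busy_path p H w) (fun l => expR (th * (w%:R / mu)) *
     (1 - th * renewals R l + th ^+ 2 * renewals R l ^+ 2)) <= _).
    apply: fexp_le => [|l]; first by case: (fprob_busy_path pp p_lt w).
    rewrite mulrBr expRD ler_wpM2l ?expR_ge0 // -exprMn expRN_le_quadratic //.
    by rewrite mulr_ge0 ?ler0n // ltW.
  rewrite fexpZ fexpD fexpB (fexp_cst _ (fprob_busy_path pp p_lt w)) !fexpZ.
  rewrite (fexp_renewals pp p_lt).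
  apply: le_trans (_ : expR (th * (w%:R / mu)) * expR (- (th * (w%:R / mu)) + th ^+ 2 * V) <= _).
    rewrite ler_wpM2l ?expR_ge0 //; apply: le_trans (expR_ge1Dx _).
    by rewrite addrA lerD2l ler_wpM2l ?sqr_ge0.
  by rewrite -expRD addrA subrr add0r.
apply: le_trans (_ : fexp (iid (busy_path p H b) n)
   (fun ps => expR (- (th * s)) * \prod_(l <- ps) expR (th * X l)) <= _).
  apply: fexp_le; first by case: (fprob_iid n pb).
  move=> ps; rewrite deficit_window // -/(X _) -expR_sum -expRD.
  rewrite -mulr_sumr addrC -mulrBr.
  apply: le_trans (ind_le_expR _).
  by apply: le_ind => h; rewrite mulr_gt0 // subr_gt0.
rewrite fexpZ fexp_iid_bigM.
apply: le_trans (_ : expR (- (th * s)) * expR (th ^+ 2 * V) ^+ n <= _).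
  rewrite ler_wpM2l ?expR_ge0 // lerXn2r ?nnegrE ?expR_ge0 //.
  by apply: fexp_ge0 => [|l]; [case: pb|exact: expR_ge0].
rewrite -expRM_natl -expRD.
have -> : - (th * s) + n%:R * (th ^+ 2 * V) = - (s ^+ 2 / (4 * n%:R * V)).
  by rewrite /th; field; rewrite !gt_eqF.
apply: le_trans (expRN_le_inv_sqr _) _.
  by rewrite divr_gt0 ?exprn_gt0 ?mulr_gt0.
rewrite le_eqVlt; apply/orP; left; apply/eqP.
by field; rewrite !gt_eqF.
Qed.

(** * Renewal counts on short and on long windows *)

Section Moments.
Variables (M L : nat) (C beta : R).
Hypotheses (M0 : (0 < M)%N) (C0 : 0 <= C) (b0 : 0 < beta).
Hypothesis excess_le : forall k,
  excess_mean p (L * 2 ^ k * M) <= C * beta ^+ k * M%:R.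
Hypothesis trunc_sqr_le : forall k,
  trunc_sqr p (L * 2 ^ k * M) <= C * (2 * beta) ^+ k * M%:R ^+ 2.
Hypothesis trunc_mean_ge : forall k, M%:R / 2 <= trunc_mean p (L * 2 ^ k * M).

Let Mr0 : 0 < M%:R :> R. Proof. by rewrite ltr0n. Qed.

Lemma mean_service_ge_half : M%:R / 2 <= mu.
Proof.
apply: le_trans (trunc_mean_ge 0) _; rewrite /mu -(trunc_mean_excess p_lt (L * 2 ^ 0 * M)).
by rewrite lerDl; apply: fexp_ge0 => [|y]; [case: pp|exact: ler0n].
Qed.

(** Wald's identity at truncation level L M bounds the mean number of renewals in at most M slots by
    2 (1 + L), from any state. This makes the second moment linear in m down to single slots. *)
Lemma renewals_sqr_small m : (m <= M)%N ->
  fexp (busy_path p H m) (fun l => renewals R l ^+ 2) <=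
  (10 + 8 * L%:R) * (m%:R / M%:R).
Proof.
move=> mM.
have hU m' y : (m' <= M)%N -> fexp (chain p m' y) (renewals R) <= 2 * (1 + L%:R).
  move=> m'M; have := renewals_le pp (L * 2 ^ 0 * M) m' y.
  have := trunc_mean_ge 0; rewrite expn0 muln1 => h1 h2.
  have h3 : M%:R / 2 * fexp (chain p m' y) (renewals R) <= m'%:R + (L * M)%:R.
    apply: le_trans h2; apply: ler_wpM2r h1.
    by apply: fexp_ge0 => [|l]; [case: (fprob_chain pp m' y)|exact: ler0n].
  have h4 : (m'%:R : R) <= M%:R by rewrite ler_nat.
  rewrite -(ler_pM2l (divr_gt0 Mr0 (ltr0n R 2))); apply: le_trans h3 _.
  by rewrite natrM; lra.
apply: le_trans (fexp_renewals_sqr pp p_lt hU mM) _.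
have -> : (10 + 8 * L%:R) * (m%:R / M%:R) = m%:R * ((1 + 2 * (2 * (1 + L%:R))) * (2 / M%:R)) :> R.
  by field; rewrite gt_eqF.
have hc : 0 <= 1 + 2 * (2 * (1 + L%:R)) :> R.
  by have : 0 <= L%:R :> R by []; lra.
apply: ler_wpM2l => //; apply: ler_wpM2l hc _ _ _.
by rewrite -[2 / _]invf_div lef_pV2 ?posrE ?divr_gt0 ?(mean_service_gt0 pp) ?mean_service_ge_half.
Qed.

(** The factor 32 is the 4 of [fexp_renewals_var] times 8 from three lower bounds M / 2; the bracket
    is (2 + 2 L^2) + (2 L + 1). *)
Definition var_const : R := 32 * (3 + 2 * L%:R + 2 * L%:R ^+ 2) * C.

(** The truncation level grows with the window. The excess term, of order m^2 [excess_mean], and the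
    variance term, of order m [trunc_sqr], then both scale as (4 beta)^k, of smaller order than the
    squared length 4^k when beta < 1. *)
Lemma renewals_var_large k :
  fexp (busy_path p H (2 ^ k * M)) (fun l => (renewals R l - (2 ^ k * M)%:R / mu) ^+ 2)
  <= var_const * (4 * beta) ^+ k.
Proof.
set m := (2 ^ k * M)%N; set Var := fexp _ _.
have := fexp_renewals_var pp p_lt (L * 2 ^ k * M) m.
rewrite -/mu -/Var.
have := excess_le k; have := trunc_sqr_le k; have := trunc_mean_ge k.
set g := trunc_mean _ _; set tq := trunc_sqr _ _; set D := excess_mean _ _.
have -> : (L * 2 ^ k * M)%:R = L%:R * (2 ^+ k * M%:R) :> R.
  by rewrite !natrM natrX mulrA.
have -> : m%:R = 2 ^+ k * M%:R :> R by rewrite natrM natrX.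
have -> : (4 * beta) ^+ k = 2 ^+ k * 2 ^+ k * beta ^+ k.
  by rewrite -!exprMn; congr (_ ^+ _); ring.
rewrite exprMn /var_const.
have D0 : 0 <= D by apply: fexp_ge0 => [|y]; [case: pp|exact: ler0n].
have tq0 : 0 <= tq by apply: fexp_ge0 => [|y]; [case: pp|exact: sqr_ge0].
have L0 : 0 <= L%:R :> R by exact: ler0n.
have := mean_service_ge_half.
have V0 : 0 <= Var by apply: fexp_ge0 => [|y]; [case: (fprob_busy_path pp p_lt m)|exact: sqr_ge0].
move: (exprn_gt0 k (ltr0n R 2)) (exprn_gt0 k b0) Mr0.
move: (2 ^+ k) (beta ^+ k) (M%:R) (L%:R) L0 => t u N l l0 t0 u0 N0 hmu hg htq hD hVar.
have P0 : 0 < t * t * u * N ^+ 3 by rewrite !mulr_gt0 ?exprn_gt0.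
have e1 : (t * N) ^+ 2 * D <= C * (t * t * u * N ^+ 3).
  by apply: le_trans (ler_wpM2l (sqr_ge0 _) hD) _; rewrite le_eqVlt; apply/orP; left; apply/eqP; ring.
have e2 : t * N * tq <= C * (t * t * u * N ^+ 3).
  by apply: le_trans (ler_wpM2l (mulr_ge0 (ltW t0) (ltW N0)) htq) _;
     rewrite le_eqVlt; apply/orP; left; apply/eqP; ring.
have e3 : g ^+ 2 * Var <= 4 * (C * (t * t * u * N ^+ 3) * (3 + 2 * l + 2 * l ^+ 2)) / (N / 2).
  apply: le_trans hVar _; rewrite -mulrA -[leRHS]mulrA ler_pM2l //.
  apply: ler_pM; rewrite ?invr_ge0 ?(ltW (mean_service_gt0 pp)) //.
  - by rewrite !addr_ge0 ?mulr_ge0 ?addr_ge0 ?mulr_ge0 ?sqr_ge0 ?(ltW t0) ?(ltW N0).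
  - rewrite (_ : 2 * (t * N) ^+ 2 * D + _ + _ = (2 + 2 * l ^+ 2) * ((t * N) ^+ 2 * D)
      + (2 * l + 1) * (t * N * tq)); last by ring.
    rewrite (_ : C * _ * _ = (2 + 2 * l ^+ 2) * (C * (t * t * u * N ^+ 3))
      + (2 * l + 1) * (C * (t * t * u * N ^+ 3))); last by ring.
    by apply: lerD; rewrite ler_wpM2l ?addr_ge0 ?mulr_ge0 ?sqr_ge0.
  - by rewrite lef_pV2 ?posrE ?divr_gt0 ?(mean_service_gt0 pp).
have e4 : (N / 2) ^+ 2 * Var <= g ^+ 2 * Var.
  by rewrite ler_wpM2r // lerXn2r ?nnegrE ?divr_ge0 ?(ltW N0) // (le_trans _ hg) ?divr_ge0 ?ltW.
have N20 : 0 < (N / 2) ^+ 2 by rewrite exprn_gt0 ?divr_gt0.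
rewrite -(ler_pM2l N20); apply: le_trans (le_trans e4 e3) _.
rewrite le_eqVlt; apply/orP; left; apply/eqP; field.
by rewrite gt_eqF.
Qed.

End Moments.
End Departures.

(** * Dyadic chaining *)

Section Chaining.
Variable R : realType.

Lemma level_index (q i j : nat) : (q <= j)%N -> (j <= q + i)%N ->
  (j - q + (q + i - j) = i)%N.
Proof. by lia. Qed.

Lemma sum_geometric_le (x B : R) n : 0 <= x -> 0 <= B -> x * B + 1 <= B ->
  \sum_(j < n) x ^+ (n.-1 - j) <= B.
Proof.
move=> x0 B0 xB; elim: n => [|n IH]; first by rewrite big_ord0.
rewrite big_ord_recr /= subnn expr0; apply: le_trans xB; rewrite lerD2r.
apply: le_trans (ler_wpM2l x0 IH); rewrite mulr_sumr le_eqVlt; apply/orP; left.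
apply/eqP; apply: eq_bigr => j _; rewrite -exprS; congr (_ ^+ _).
by have := ltn_ord j; lia.
Qed.

(** Reading the binary digits of m from the top cuts [0, m] into one block for each digit 1; a block
    of length 2^j starts at an even multiple of 2^j. Only upper bounds on increments are needed, so
    the estimate is one-sided. *)
Lemma dyadic_bound (G a : nat -> R) J b : G 0%N = 0 -> (forall j, 0 <= a j) ->
  (forall j k, (j <= J)%N -> (k < 2 ^ (J - j))%N -> (2 * k * 2 ^ j + 2 ^ j <= b)%N ->
     G (2 * k * 2 ^ j + 2 ^ j)%N - G (2 * k * 2 ^ j)%N <= a j) ->
  forall m, (m < 2 ^ J.+1)%N -> (m <= b)%N -> G m <= \sum_(j < J.+1) a (J - j)%N.
Proof.
move=> G0 a0 hG.
suff key d k : (d <= J.+1)%N -> (k < 2 ^ d)%N -> (k * 2 ^ (J.+1 - d) <= b)%N ->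
    G (k * 2 ^ (J.+1 - d))%N <= \sum_(j < d) a (J - j)%N.
  move=> m mJ mb; have := key J.+1 m; rewrite subnn expn0 muln1.
  exact.
elim: d k => [|d IH] k dJ.
  rewrite expn0 ltnS leqn0 => /eqP -> _.
  by rewrite mul0n G0 big_ord0.
rewrite subSS big_ord_recr /=.
have e1 : (J.+1 - d = (J - d).+1)%N by lia.
rewrite e1 in IH.
move=> kd kb; have kE := divn_eq k 2.
have k2 : (k %/ 2 < 2 ^ d)%N by rewrite ltn_divLR // -expnSr.
have e2 : (2 ^ (J - d).+1 = 2 * 2 ^ (J - d))%N by rewrite expnS.
have k2b : (k %/ 2 * 2 ^ (J - d).+1 <= b)%N.
  by apply: leq_trans kb; rewrite e2 mulnA leq_mul2r leq_trunc_div orbT.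
have IHk := IH _ (ltnW dJ) k2 k2b.
have [k0|k1] : (k %% 2 = 0)%N \/ (k %% 2 = 1)%N by have := ltn_pmod k (ltn0Sn 1); lia.
  rewrite {1}kE k0 addn0 -mulnA -e2.
  by apply: le_trans IHk _; rewrite lerDl.
have := hG (J - d)%N (k %/ 2)%N (leq_subr _ _).
have -> : (J - (J - d) = d)%N by lia.
move=> /(_ k2).
have e3 : (2 * (k %/ 2) * 2 ^ (J - d) = k %/ 2 * 2 ^ (J - d).+1)%N.
  by rewrite e2; ring.
have e4 : (k * 2 ^ (J - d) = 2 * (k %/ 2) * 2 ^ (J - d) + 2 ^ (J - d))%N.
  by rewrite {1}kE k1; ring.
rewrite -e4 e3 => /(_ kb) h.
have := lerD h IHk; rewrite subrK => h2; apply: le_trans h2 _.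
by rewrite addrC.
Qed.

(** * A maximal inequality over all window lengths *)

Section Tails.
Variables (C beta c0 : R).
Hypotheses (C0 : 0 < C) (beta_ge : 4 / 5 <= beta) (beta_lt1 : beta < 1)
  (c0_gt0 : 0 < c0).

(** The ratio 9 / 10 has geometric sum 10, so the shares of all levels add up to at most [y]. *)
Definition level_bound (y : R) (e : nat) : R := y / 10 * (9 / 10) ^+ e.

Lemma level_bound_gt0 y e : 0 < y -> 0 < level_bound y e.
Proof. by move=> y0; rewrite mulr_gt0 ?divr_gt0 ?exprn_gt0 ?divr_gt0. Qed.

(** The inverse ratio of the thresholds. From x^4 <= 8 / 5 and beta >= 4 / 5 follow both 2 x^4 <= 4
    beta and x^4 / 2 <= 4 / 5, which explains the constant 4 / 5. *)
Let x : R := 10 / 9.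

Let x2_le : x ^+ 2 <= 5 / 4.
Proof. by rewrite /x expr2; lra. Qed.

Let x4_le : x ^+ 4 <= 8 / 5.
Proof.
have -> : x ^+ 4 = (10 / 9 * (10 / 9)) * (10 / 9 * (10 / 9)) by rewrite /x; ring.
by lra.
Qed.

Lemma level_boundV y e : (level_bound y e)^-1 = 10 / y * x ^+ e.
Proof. by rewrite invfM invf_div -exprVn invf_div. Qed.

(** Union bound at a level u steps below the unit scale, in block i. The decay 4^-u beats both the
    2^u increments and the growth x^(4 u) of the inverse thresholds, leaving (4 / 5)^u. *)
Lemma small_level u i y : 1 <= y ->
  2 ^+ (u + i) * (C * 4 ^- u / level_bound y (u + i) ^+ 4) <=
  10 ^+ 4 * C * ((4 * beta) ^+ i / y ^+ 2) * (4 / 5) ^+ u.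
Proof.
move=> y1; have y0 : 0 < y by exact: lt_le_trans y1.
have -> : 2 ^+ (u + i) * (C * 4 ^- u / level_bound y (u + i) ^+ 4) =
    10 ^+ 4 * C * (2 * x ^+ 4) ^+ i * (x ^+ 4 / 2) ^+ u / y ^+ 4.
  rewrite -[(level_bound _ _ ^+ 4)^-1]exprVn level_boundV [(10 / y * _) ^+ _]exprMn.
  rewrite [(x ^+ _) ^+ 4]exprAC; move: (x ^+ 4) => z.
  have -> : z / 2 = 2 * z * 4^-1 by field.
  rewrite !exprMn !exprVn !exprD.
  by move: (2 ^+ u) (2 ^+ i) (z ^+ u) (z ^+ i) (4 ^- u) => ? ? ? ? ?; ring.
have a1 : (2 * x ^+ 4) ^+ i <= (4 * beta) ^+ i.
  have h : 2 * x ^+ 4 <= 4 * beta.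
    by have h1 := x4_le; have h2 := beta_ge; lra.
  by apply: lerXn2r => //; rewrite nnegrE; [rewrite mulr_ge0 ?exprn_ge0 ?divr_ge0|have h2 := beta_ge; lra].
have a2 : (x ^+ 4 / 2) ^+ u <= (4 / 5) ^+ u.
  have h : x ^+ 4 / 2 <= 4 / 5 by move: x4_le; lra.
  by apply: lerXn2r; rewrite ?nnegrE ?divr_ge0 ?exprn_ge0 ?divr_ge0.
have a3 : (y ^+ 4)^-1 <= (y ^+ 2)^-1.
  rewrite lef_pV2 ?posrE ?exprn_gt0 //.
  by rewrite (_ : 4 = 2 + 2)%N // exprD ler_peMr ?exprn_ge0 ?(ltW y0) // exprn_ege1.
have i1 : 0 <= (2 * x ^+ 4) ^+ i by rewrite exprn_ge0 ?mulr_ge0 ?exprn_ge0 ?divr_ge0.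
have i2 : 0 <= (x ^+ 4 / 2) ^+ u by rewrite exprn_ge0 ?divr_ge0 ?exprn_ge0 ?divr_ge0.
have i3 : 0 <= (y ^+ 4)^-1 by rewrite invr_ge0 exprn_ge0 // ltW.
have h6 (k A B Y A' B' Y' : R) : 0 <= k -> 0 <= A -> 0 <= B -> 0 <= Y ->
    A <= A' -> B <= B' -> Y <= Y' -> k * A * B * Y <= k * (A' * Y') * B'.
  move=> k0 A0 B0 Y0 AA BB YY.
  have -> : k * (A' * Y') * B' = k * A' * B' * Y' by ring.
  apply: ler_pM => //; first by rewrite !mulr_ge0.
  by apply: ler_pM; rewrite ?mulr_ge0 // ler_wpM2l.
apply: h6 => //; apply: mulr_ge0; last exact: ltW.
by rewrite exprn_ge0.
Qed.

(** Union bound at a level k steps above the unit scale. There are only 2^e increments, e being the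
    distance to the top level of the block, so an inverse square of the threshold is enough. *)
Lemma large_level k e y : 0 < y ->
  2 ^+ e * (C * (4 * beta) ^+ k / level_bound y e ^+ 2) <=
  10 ^+ 4 * C * ((4 * beta) ^+ (k + e) / y ^+ 2) * (4 / 5) ^+ e.
Proof.
move=> y0.
have -> : 2 ^+ e * (C * (4 * beta) ^+ k / level_bound y e ^+ 2) =
    10 ^+ 2 * C * ((4 * beta) ^+ k / y ^+ 2) * (2 * x ^+ 2) ^+ e.
  rewrite -[(level_bound _ _ ^+ 2)^-1]exprVn level_boundV [(10 / y * _) ^+ _]exprMn.
  rewrite [(x ^+ _) ^+ 2]exprAC; move: (x ^+ 2) => z.
  rewrite !exprMn !exprVn.
  by move: (2 ^+ e) (z ^+ e) (4 ^+ k) (beta ^+ k) => ? ? ? ?; ring.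
have -> : 10 ^+ 4 * C * ((4 * beta) ^+ (k + e) / y ^+ 2) * (4 / 5) ^+ e =
  10 ^+ 4 * C * ((4 * beta) ^+ k / y ^+ 2) * (4 * beta * (4 / 5)) ^+ e.
  by rewrite exprD !exprMn; ring.
have b0 : 0 <= (4 * beta) ^+ k / y ^+ 2.
  by rewrite divr_ge0 ?exprn_ge0 ?(ltW y0) // mulr_ge0 //; have h2 := beta_ge; lra.
apply: ler_pM.
- by rewrite mulr_ge0 // mulr_ge0 ?exprn_ge0 // ltW.
- by rewrite exprn_ge0 ?mulr_ge0 ?exprn_ge0 ?divr_ge0.
- apply: ler_wpM2r => //; apply: ler_wpM2r; first exact: ltW.
  by rewrite ler_weXn2l // ler1n.
- have h : 2 * x ^+ 2 <= 4 * beta * (4 / 5).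
    by have h1 := x2_le; have h2 := beta_ge; lra.
  by apply: lerXn2r => //; rewrite nnegrE; [rewrite mulr_ge0 ?exprn_ge0 ?divr_ge0|have h2 := beta_ge; lra].
Qed.

(** Blocks with i < I are made small by taking [K] large, the others by the tail of the geometric
    series in beta, since the barrier dominates c0 2^i. *)
Lemma block_sum_small (g eps : R) : 0 < g -> 0 < eps ->
  exists K, 1 <= K /\ forall n,
   \sum_(i < n) g * ((4 * beta) ^+ i / (K + c0 * 2 ^+ i) ^+ 2) <= eps.
Proof.
move=> g0 eps0.
have b0 : 0 < beta by apply: lt_le_trans beta_ge.
pose A := g / (c0 ^+ 2 * (1 - beta)).
have A0 : 0 < A.
  have h1 : 0 < c0 ^+ 2 by exact: exprn_gt0.
  have h2 : 0 < 1 - beta by rewrite subr_gt0.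
  exact: divr_gt0 g0 (mulr_gt0 h1 h2).
have [I hI] : exists I, A * beta ^+ I <= eps / 2.
  have := @cvg_expr R beta; rewrite ger0_norm ?(ltW b0) // => /(_ beta_lt1).
  have e0 : 0 < eps / 2 / A by exact: divr_gt0 (divr_gt0 eps0 (ltr0n R 2)) A0.
  move=> /cvgr0_norm_lt /(_ _ e0) [I _ /(_ I (leqnn I))] /=.
  rewrite ger0_norm ?exprn_ge0 ?(ltW b0) // ltr_pdivlMr // mulrC => h.
  by exists I; exact: ltW.
pose W := I%:R * g * 4 ^+ I.
have W0 : 0 <= W by rewrite !mulr_ge0 ?exprn_ge0 // ltW.
exists (1 + W / (eps / 2)); set K := 1 + _.
have K1 : 1 <= K by rewrite lerDl !mulr_ge0 ?invr_ge0 // ltW ?divr_gt0.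
have KW : W / (eps / 2) <= K by rewrite /K lerDr.
clearbody K.
have K0 : 0 < K by exact: lt_le_trans K1.
split=> // n.
have hterm i : g * ((4 * beta) ^+ i / (K + c0 * 2 ^+ i) ^+ 2) <=
    (i < I)%N%:R * (g * 4 ^+ I / K) + (I <= i)%N%:R * (g / c0 ^+ 2 * beta ^+ i).
  have p2 : 0 < 2 ^+ i :> R by rewrite exprn_gt0.
  have q0 : 0 < c0 * 2 ^+ i by rewrite mulr_gt0.
  case: (ltnP i I) => iI; rewrite ?mul0r ?mul1r ?addr0 ?add0r.
    rewrite -mulrA ler_pM2l //; apply: ler_pM.
    - by rewrite exprn_ge0 ?mulr_ge0 // ltW.
    - by rewrite invr_ge0 exprn_ge0 // addr_ge0 // ltW.
    - apply: le_trans (_ : 4 ^+ i <= _).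
        by apply: lerXn2r; rewrite ?nnegrE ?mulr_ge0 ?(ltW b0) //; have h2 := beta_lt1; lra.
      by rewrite ler_weXn2l ?ler1n // ltnW.
    - rewrite lef_pV2 ?posrE ?exprn_gt0 ?addr_gt0 //.
      apply: le_trans (_ : K ^+ 2 <= _).
        by rewrite expr2 ler_peMr // ltW.
      by apply: lerXn2r; rewrite ?nnegrE; [exact: ltW|apply: ltW; exact: addr_gt0|rewrite lerDl ltW].
  have -> : g / c0 ^+ 2 * beta ^+ i = g * ((4 * beta) ^+ i / (c0 * 2 ^+ i) ^+ 2).
    have -> : (4 * beta) ^+ i = (2 ^+ i) ^+ 2 * beta ^+ i.
      by rewrite -exprM mulnC exprM -exprMn; congr (_ ^+ _); ring.
    by field; rewrite !gt_eqF.
  apply: ler_wpM2l; first exact: ltW.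
  apply: ler_wpM2l; first by rewrite exprn_ge0 ?mulr_ge0 // ltW.
  rewrite lef_pV2 ?posrE ?exprn_gt0 ?addr_gt0 //.
  by apply: lerXn2r; rewrite ?nnegrE; [exact: ltW|apply: ltW; exact: addr_gt0|rewrite lerDr ltW].
apply: le_trans (ler_sum _ (fun (i : 'I_n) _ => hterm i)) _.
rewrite big_split /= -mulr_suml.
have s1 : \sum_(i < n) (i < I)%N%:R <= I%:R :> R.
  rewrite -natr_sum ler_nat.
  elim: n => [|n IH]; first by rewrite big_ord0.
  rewrite big_ord_recr /=; case: (ltnP n I) => nI; last by rewrite addn0.
  rewrite addn1; apply: leq_ltn_trans nI.
  apply: leq_trans (_ : \sum_(i < n) 1 <= _)%N; last by rewrite sum1_card card_ord.
  by apply: leq_sum => i _; case: (_ < _)%N.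
have s2 m : \sum_(i < m) (I <= i)%N%:R * (g / c0 ^+ 2 * beta ^+ i) <=
     A * (beta ^+ I - beta ^+ (maxn m I)).
  elim: m => [|m IH]; first by rewrite big_ord0 max0n subrr mulr0.
  rewrite big_ord_recr /=; apply: le_trans (lerD IH (lexx _)) _.
  case: (boolP (I <= m)%N) => mI; last first.
    rewrite -ltnNge in mI.
    have -> : maxn m I = I by apply/maxn_idPr/ltnW.
    have -> : maxn m.+1 I = I by apply/maxn_idPr.
    by rewrite mul0r addr0.
  have -> : maxn m I = m by apply/maxn_idPl.
  have -> : maxn m.+1 I = m.+1 by apply/maxn_idPl/leqW.
  rewrite mul1r (exprS beta m) le_eqVlt; apply/orP; left; apply/eqP.
  have h1 : 1 - beta != 0 by rewrite subr_eq0 gt_eqF.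
  by rewrite /A; field; rewrite ?h1 ?lt0r_neq0.
have t2 := le_trans (s2 n) _.
rewrite (splitr eps); apply: lerD; last first.
  apply: t2; apply: le_trans hI; rewrite ler_pM2l // gerBl.
  by rewrite exprn_ge0 // ltW.
have h : \sum_(i < n) (i < I)%N%:R * (g * 4 ^+ I / K) <= I%:R * (g * 4 ^+ I / K).
  by rewrite -mulr_suml ler_wpM2r // divr_ge0 ?mulr_ge0 ?exprn_ge0 // ltW.
rewrite mulr_suml; apply: le_trans h _.
rewrite !mulrA ler_pdivrMr // -/W mulrC -ler_pdivrMr ?divr_gt0 //.
Qed.

(** The constant [K] is free of q, b and the law. Windows are grouped into blocks of length about
    2^(q+i), on which the linear barrier is at least [y i]; a crossing there forces some dyadic
    increment above its share, and the union bound runs over blocks, levels and positions. *)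
Lemma chaining (eps : R) : 0 < eps -> exists K, 1 <= K /\
  forall (T : Type) (L : fdist R T) (G : T -> nat -> R) q b, fprob L ->
  (forall t, G t 0%N = 0) ->
  (forall j lo a, (j <= q)%N -> (lo + 2 ^ j <= b)%N -> 0 < a ->
    fexp L (fun t => ind R (a < G t (lo + 2 ^ j)%N - G t lo)) <=
    C * 4 ^- (q - j) / a ^+ 4) ->
  (forall k lo a, (lo + 2 ^ (q + k) <= b)%N -> 0 < a ->
    fexp L (fun t => ind R (a < G t (lo + 2 ^ (q + k))%N - G t lo)) <=
    C * (4 * beta) ^+ k / a ^+ 2) ->
  fexp L (fun t => ind R (has (fun m => K + c0 * (m%:R / 2 ^+ q) < G t m)
    (iota 0 b.+1))) <= eps.
Proof.
move=> eps0.
(* The fifth factor 10 is the sum of the level weights, at most 5 on either side of level q. *)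
have g0 : 0 < 10 ^+ 5 * C by rewrite mulr_gt0 ?exprn_gt0.
have [K [K1 hK]] := block_sum_small g0 eps0.
have K0 : 0 < K by exact: lt_le_trans K1.
(* In block 0 the window may be short and the barrier little more than its constant; the extra [c0]
   keeps it above [y 0]. *)
exists (K + c0); split; first by rewrite (le_trans K1) // lerDl ltW.
move=> T L G q b pL G0 T1 T2.
pose y i := K + c0 * 2 ^+ i.
have y1 i : 1 <= y i.
  by rewrite (le_trans K1) // lerDl mulr_ge0 ?exprn_ge0 // ltW.
have y0 i : 0 < y i by exact: lt_le_trans (y1 i).
pose a i j := level_bound (y i) (q + i - j).
have a0 i j : 0 < a i j by exact: level_bound_gt0.
pose E t i j k : bool := (2 * k * 2 ^ j + 2 ^ j <= b)%N &&
   (a i j < G t (2 * k * 2 ^ j + 2 ^ j)%N - G t (2 * k * 2 ^ j)%N).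
apply: le_trans (_ : fexp L (fun t => \sum_(i < b.+1) \sum_(j < (q + i).+1)
   \sum_(k < 2 ^ (q + i - j)) ind R (E t i j k)) <= _).
  apply: fexp_le; first by case: pL.
  move=> t; apply: le_ind_ge0.
    by do 3![apply: sumr_ge0 => ? _]; exact: ind_ge0.
  case/hasP => m; rewrite mem_iota add0n ltnS => /andP[_ mb] hm.
  (* Truncated subtraction puts every window below 2^(q+1) into block 0. *)
  pose i := (trunc_log 2 m - q)%N.
  have tb : (m < 2 ^ (trunc_log 2 m).+1)%N by exact: trunc_log_ltn.
  have mi : (m < 2 ^ (q + i).+1)%N.
    by apply: leq_trans tb _; rewrite leq_exp2l // ltnS -leq_subLR.
  have ib : (i < b.+1)%N.
    rewrite ltnS; apply: leq_trans mb; apply: leq_trans (leq_subr _ _) _.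
    case: (posnP m) => [->|m0]; first by rewrite trunc_log0.
    apply: ltnW; apply: leq_trans (ltn_expl _ (ltnSn 1)) _.
    exact: trunc_logP.
  have yi : y i <= K + c0 + c0 * (m%:R / 2 ^+ q).
    rewrite /y -addrA lerD2l -[X in _ <= X + _]mulr1 -mulrDr ler_pM2l //.
    case: (posnP i) => [->|i0].
      by rewrite expr0 lerDl divr_ge0 // exprn_ge0.
    apply: le_trans (_ : m%:R / 2 ^+ q <= _); last by rewrite lerDr.
    rewrite ler_pdivlMr ?exprn_gt0 // -exprD addnC -natrX ler_nat.
    rewrite subnKC; last by apply: ltnW; rewrite -subn_gt0.
    have m0 : (0 < m)%N.
      rewrite lt0n; apply/eqP => m0; move: i0.
      by rewrite /i m0 (_ : trunc_log 2 0 = 0)%N.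
    exact: trunc_logP.
  rewrite (bigD1 (Ordinal ib)) //=; apply: ler_wpDr.
    by do 3![apply: sumr_ge0 => ? _]; exact: ind_ge0.
  rewrite leNgt; apply/negP => hlt.
  have noE j k : (j <= q + i)%N -> (k < 2 ^ (q + i - j))%N -> ~~ E t i j k.
    move=> jq kj; apply/negP => hE; move: hlt; apply/negP; rewrite -leNgt.
    have jq' : (j < (q + i).+1)%N by [].
    rewrite (bigD1 (Ordinal jq')) //= (bigD1 (Ordinal kj)) //= hE -addrA.
    by rewrite lerDl addr_ge0 //; do ?[apply: sumr_ge0 => ? _]; exact: ind_ge0.
  have := @dyadic_bound (G t) (a i) (q + i) b (G0 t) (fun j => ltW (a0 i j)).
  move=> /(_ _ m mi mb) h.
  have {}h : G t m <= \sum_(j < (q + i).+1) a i (q + i - j)%N.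
    apply: h => j k jq kj kb.
    by have := noE j k jq kj; rewrite /E kb /= -leNgt.
  have : \sum_(j < (q + i).+1) a i (q + i - j)%N <= y i.
    rewrite /a /level_bound -mulr_sumr.
    have := @sum_geometric_le (9 / 10) 10 (q + i).+1.
    have -> : (\sum_(j < (q + i).+1) (9 / 10) ^+ ((q + i).+1.-1 - j) : R) =
       \sum_(j < (q + i).+1) (9 / 10) ^+ (q + i - (q + i - j)).
      rewrite (reindex_inj rev_ord_inj); apply: eq_bigr => j _ /=.
      by congr (_ ^+ _); have := ltn_ord j; lia.
    set s := \sum_(_ < _) _ => hs.
    have : s <= 10 by apply: hs; lra.
    move=> s10; apply: le_trans (ler_wpM2l _ s10) _; last by lra.
    by rewrite divr_ge0 // ltW.
  by move: hm h yi; lra.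
rewrite fexp_sum; apply: le_trans (hK b.+1); apply: ler_sum => i _.
rewrite fexp_sum; apply: le_trans (_ : \sum_(j < (q + i).+1)
   10 ^+ 4 * C * ((4 * beta) ^+ i / y i ^+ 2) *
     (if (j <= q)%N then (4 / 5) ^+ (q - j) else (4 / 5) ^+ (q + i - j)) <= _).
  apply: ler_sum => j _; rewrite fexp_sum.
  have tail k : fexp L (fun t => ind R (E t i j k)) <=
      (if (j <= q)%N then C * 4 ^- (q - j) / a i j ^+ 4
       else C * (4 * beta) ^+ (j - q) / a i j ^+ 2).
    have rhs0 : 0 <= (if (j <= q)%N then C * 4 ^- (q - j) / a i j ^+ 4
       else C * (4 * beta) ^+ (j - q) / a i j ^+ 2).
      case: ifP => _; rewrite divr_ge0 ?exprn_ge0 ?(ltW (a0 _ _)) //.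
        by rewrite mulr_ge0 ?invr_ge0 ?exprn_ge0 // ltW.
      by rewrite mulr_ge0 ?exprn_ge0 ?mulr_ge0 ?(ltW C0) //; have h2 := beta_ge; lra.
    case: (boolP (2 * k * 2 ^ j + 2 ^ j <= b)%N) => kb; last first.
      rewrite (_ : (fun t => _) = fun=> 0) ?fexp_cst //.
      by apply/funext => t; rewrite /E (negbTE kb).
    rewrite (_ : (fun t => _) = fun t => ind R (a i j < G t (2 * k * 2 ^ j + 2 ^ j)%N
       - G t (2 * k * 2 ^ j)%N)); last by apply/funext => t; rewrite /E kb.
    case: ifPn => jq; first exact: T1.
    rewrite -ltnNge in jq.
    have jE : (q + (j - q) = j)%N by rewrite subnKC // ltnW.
    by have := T2 (j - q)%N (2 * k * 2 ^ j)%N (a i j); rewrite jE; exact.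
  apply: le_trans (ler_sum _ (fun (k : 'I_(2 ^ (q + i - j))) _ => tail k)) _.
  rewrite sumr_const card_ord -[leLHS]mulr_natl natrX.
  have := ltn_ord j; rewrite ltnS => jq.
  case: ifPn => jq'.
    by rewrite /a -addnBAC //; exact: small_level.
  rewrite -ltnNge in jq'.
  have := large_level (j - q) (q + i - j) (y0 i).
  by rewrite (level_index (ltnW jq') jq).
rewrite -mulr_sumr.
have -> : 10 ^+ 5 * C * ((4 * beta) ^+ i / (K + c0 * 2 ^+ i) ^+ 2) =
   10 ^+ 4 * C * ((4 * beta) ^+ i / y i ^+ 2) * 10.
  by rewrite (exprSr _ 4) /y; ring.
rewrite ler_wpM2l //.
  apply: mulr_ge0; first by rewrite mulr_ge0 ?exprn_ge0 // ltW.
  apply: divr_ge0; apply: exprn_ge0; last exact: ltW.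
  by have h2 := beta_ge; lra.
rewrite -addSn big_split_ord /=.
have -> : 10 = 5 + 5 :> R by lra.
apply: lerD.
  under eq_bigr => j _ do rewrite -ltnS ltn_ord.
  by apply: (@sum_geometric_le (4 / 5) 5 q.+1); lra.
under eq_bigr => j _ do rewrite leqNgt addSn ltnS leq_addr /=.
rewrite (eq_bigr (fun j : 'I_i => (4 / 5) ^+ (i.-1 - j))).
  by apply: (@sum_geometric_le (4 / 5) 5 i); lra.
by move=> j _; congr (_ ^+ _); have := ltn_ord j; lia.
Qed.

End Tails.
End Chaining.

(** * Coupling with the always-busy system *)

Section Coupling.
Variables (R : realType) (p : fdist R nat).
Hypothesis pp : fprob p.

Definition kw_step (V : seq nat) (tau y : nat) : seq nat :=
  sort leq (maxn tau (head 0%N V) + y.+1 :: behead V)%N.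

(* Some job of [Ts] (a list of arrival slots) starts after slot [t], the servers
   being free from the slots [V] on. *)
Fixpoint late (t : nat) (V Ts ys : seq nat) : bool :=
  match Ts, ys with
  | tau :: Ts', y :: ys' =>
      (t < maxn tau (head 0 V))%N || late t (kw_step V tau y) Ts' ys'
  | tau :: _, [::] => (t < maxn tau (head 0 V))%N
  | [::], _ => false
  end.

Fixpoint busy_step (rs : seq nat) : fdist R (nat * seq nat) :=
  if rs is r :: rs' then
    fbind (trans p r) (fun r' =>
      fmap (fun x => ((r == 0%N) + x.1, r' :: x.2)%N) (busy_step rs'))
  else fret R (0%N, [::]).

Fixpoint busy_slots (b : nat) (rs : seq nat) : fdist R (seq nat) :=
  if b is b'.+1 then
    fbind (busy_step rs) (fun x => fmap (cons x.1) (busy_slots b' x.2))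
  else fret R [::].

(** A busy server that renews in slot [a] takes the first job if it has arrived; otherwise it starts
    a dummy job and this capacity is lost. *)
Definition pop (a : nat) (Ts : seq nat) : seq nat :=
  if Ts is tau :: Ts' then if (tau <= a)%N then Ts' else Ts else [::].

Fixpoint serve (a : nat) (ds Ts : seq nat) : seq nat :=
  if ds is d :: ds' then serve a.+1 ds' (iter d (pop a) Ts) else Ts.

(** Comparison of the sorted free times entry by entry, stated through counts so that [times] needs
    no sorting. *)
Definition dominated (V times : seq nat) :=
  [/\ sorted leq V, size V = size times &
      forall z, (count (ltn z) V <= count (ltn z) times)%N].

Lemma count_ltn_full z (s : seq nat) :
  all (ltn z) s -> count (ltn z) s = size s.
Proof. by rewrite all_count => /eqP. Qed.

Lemma dominated_head V D E a :
  dominated V (D ++ a :: E) -> (head 0%N V <= a)%N.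
Proof.
case=> sV szV /(_ a) h; rewrite leqNgt; apply/negP => ha; move: h.
rewrite (@count_ltn_full a V) ?szV; last first.
  case: V sV ha {szV} => //= v V; rewrite path_sortedE; last exact: leq_trans.
  case/andP => /allP hv _ av; rewrite av /=; apply/allP => x /hv vx.
  exact: leq_trans av vx.
rewrite size_cat count_cat /= ltnn add0n.
have h1 := count_size (ltn a) D; have h2 := count_size (ltn a) E.
by lia.
Qed.

(** The queue uses the server that is free first and [head V <= a], so the new free time is at most
    a.+1 + y. Below [a] there is nothing to check, because every free time of the busy system is at
    least [a]. *)
Lemma dominated_step V D E a tau y : dominated V (D ++ a :: E) ->
  all (leq a) D -> all (leq a) E -> (tau <= a)%N ->
  dominated (kw_step V tau y) (D ++ (a.+1 + y)%N :: E).
Proof.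
move=> dom hD hE ta; have ha := dominated_head dom; case: dom => sV szV hV.
case: V sV szV hV ha => [|v V] sV szV hV ha.
  by move: szV; rewrite size_cat /= addnS.
split.
- by apply: sort_sorted; exact: leq_total.
- by rewrite /kw_step size_sort /= !size_cat /= in szV *.
move=> z; rewrite /kw_step count_sort /= !count_cat /=.
have := hV z; rewrite /= count_cat /=.
case: (leqP a z) => az h.
  have : (z < maxn tau v + y.+1 -> z < a.+1 + y)%N.
    move=> h1; apply: leq_trans h1 _; rewrite addSnnS leq_add2r geq_max ta.
    exact: ha.
  by case: (z < maxn tau v + y.+1)%N => [->|_] //; lia.
rewrite (@count_ltn_full z D); last first.
  by apply: sub_all hD => x; exact: leq_trans.
rewrite (@count_ltn_full z E); last first.
  by apply: sub_all hE => x; exact: leq_trans.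
have : (z < a.+1 + y)%N by lia.
move=> ->; have := count_size (ltn z) V; move: szV; rewrite size_cat /=.
by case: (z < _)%N; lia.
Qed.

Lemma dominated_mono V D E a c : (a <= c)%N ->
  dominated V (D ++ a :: E) -> dominated V (D ++ c :: E).
Proof.
move=> ac [sV szV hV]; split => //; first by rewrite szV !size_cat.
move=> z; apply: leq_trans (hV z) _; rewrite !count_cat /= leq_add2l leq_add2r.
by case: (ltnP z a) => // za; rewrite (leq_trans za ac).
Qed.

(** Processing times are drawn only when needed: a renewal that finds a job to serve draws the
    processing time of this job in both systems, and any other renewal draws a time that only delays
    the busy system. Jobs taken by the end of slot t start on time in the queue. *)
Lemma late_le_busy b a t rs V Ts k : (a + b = t.+1)%N -> (size Ts <= k)%N ->
  dominated V [seq (a + r)%N | r <- rs] ->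
  fexp (iid p k) (fun ys => ind R (late t V Ts ys)) <=
  fexp (busy_slots b rs) (fun ds => ind R (0 < size (serve a ds Ts))%N).
Proof.
elim: b a rs V Ts k => [|b IHb] a rs V Ts k abt kT dom.
  rewrite fexp_ret /=; case: Ts kT => [|tau Ts] kT.
    by rewrite /= fexp_cst //; exact: fprob_iid.
  rewrite -[leRHS](fexp_cst _ (fprob_iid k pp)).
  by apply: fexp_le => [|ys]; [case: (fprob_iid k pp)|exact: ind_le1].
have at_ : (a <= t)%N by lia.
rewrite /= fexp_bind.
(* Within slot [a] the servers are treated one by one: those in [dr] have already moved to slot
   a.+1, those in [rs'] have not. *)
suff key dr rs' : forall V' Ts' k', (size Ts' <= k')%N ->
   dominated V' ([seq (a.+1 + r)%N | r <- dr] ++ [seq (a + r)%N | r <- rs']) ->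
   fexp (iid p k') (fun ys => ind R (late t V' Ts' ys)) <=
   fexp (busy_step rs') (fun x => fexp (busy_slots b (dr ++ x.2))
     (fun ds => ind R (0 < size (serve a.+1 ds (iter x.1 (pop a) Ts')))%N)).
  apply: le_trans (key [::] rs V Ts k kT dom) _; rewrite le_eqVlt; apply/orP; left.
  by apply/eqP/eq_fexp => x; rewrite fexp_map.
elim: rs' dr {V Ts k kT dom} => [|r rs' IH] dr V Ts k kT dom.
  rewrite fexp_ret /=; rewrite !cats0 in dom *; apply: IHb => //; lia.
rewrite /= fexp_bind; case: r dom => [|r] dom /=; last first.
  rewrite fexp_ret fexp_map /=.
  have := IH (rcons dr r) V Ts k kT.
  rewrite map_rcons cat_rcons addSnnS => /(_ dom).
  under [X in _ <= X -> _]eq_fexp do rewrite cat_rcons.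
  exact.
rewrite /= addn0 in dom.
have allD : all (leq a) [seq (a.+1 + r)%N | r <- dr].
  by apply/allP => x /mapP[r _ ->]; lia.
have allE : all (leq a) [seq (a + r)%N | r <- rs'].
  by apply/allP => x /mapP[r _ ->]; exact: leq_addr.
have step y V' Ts' k' : (size Ts' <= k')%N ->
   dominated V' ([seq (a.+1 + r)%N | r <- dr] ++ (a.+1 + y)%N :: [seq (a + r)%N | r <- rs']) ->
   fexp (iid p k') (fun ys => ind R (late t V' Ts' ys)) <=
   fexp (busy_step rs') (fun x => fexp (busy_slots b (dr ++ y :: x.2))
     (fun ds => ind R (0 < size (serve a.+1 ds (iter x.1 (pop a) Ts')))%N)).
  move=> kT' dom'; have := IH (rcons dr y) V' Ts' k' kT'.
  rewrite map_rcons cat_rcons => /(_ dom').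
  under [X in _ <= X -> _]eq_fexp do rewrite cat_rcons.
  exact.
have popE x : iter (true + x.1) (pop a) Ts = iter (x : nat * seq nat).1 (pop a) (pop a Ts).
  by rewrite (add1n x.1) iterSr.
rewrite [leRHS](_ : _ = fexp p (fun y => fexp (busy_step rs') (fun x =>
    fexp (busy_slots b (dr ++ y :: x.2))
     (fun ds => ind R (0 < size (serve a.+1 ds (iter x.1 (pop a) (pop a Ts))))%N)))); last first.
  by apply: eq_fexp => y; rewrite fexp_map; apply: eq_fexp => x; apply: eq_fexp => ds;
    rewrite -popE.
(* No job to serve: the draw only postpones a free time of the busy system. *)
have wait : pop a Ts = Ts -> fexp (iid p k) (fun ys => ind R (late t V Ts ys)) <=
    fexp p (fun y => fexp (busy_step rs') (fun x => fexp (busy_slots b (dr ++ y :: x.2))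
     (fun ds => ind R (0 < size (serve a.+1 ds (iter x.1 (pop a) (pop a Ts))))%N))).
  move=> ->; rewrite -[leLHS](fexp_cst _ pp); apply: fexp_le => [|y]; first by case: pp.
  by apply: step => //; apply: dominated_mono dom; lia.
case: Ts kT step popE wait => [|tau Ts] kT step popE wait; first exact: wait.
case: (boolP (tau <= a)%N) => ta; last by apply: wait; rewrite /= (negbTE ta).
rewrite /= ta; case: k kT wait => // k kT _.
rewrite fexp_iidS; apply: fexp_le => [|y]; first by case: pp.
rewrite /= [(t < _)%N]ltnNge geq_max (leq_trans ta at_).
rewrite (leq_trans (dominated_head dom) at_) /=.
by apply: step => //; apply: dominated_step.
Qed.

Lemma iter_pop d a Ts : sorted leq Ts ->
  iter d (pop a) Ts = drop (minn d (count (fun tau => tau <= a)%N Ts)) Ts.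
Proof.
elim: d Ts => [|d IH] Ts sTs; first by rewrite min0n drop0.
rewrite iterSr; case: Ts sTs => [|tau Ts] sTs.
  by rewrite /pop IH //= !minn0.
have sT : sorted leq Ts by exact: path_sorted sTs.
rewrite [pop _ _]/=; case: (boolP (tau <= a)%N) => ta.
  by rewrite IH // /= ta add1n minnSS.
have c0 : count (fun tau => tau <= a)%N (tau :: Ts) = 0%N.
  apply/eqP; rewrite -leqn0 leqNgt -has_count; apply/hasPn => x.
  rewrite inE => /orP[/eqP-> //|xT]; move: sTs => /= /(order_path_min leq_trans)/allP.
  by move=> /(_ _ xT) tx; apply: contra ta; exact: leq_trans.
by rewrite IH // c0 !minn0.
Qed.

(* Lindley's argument: go back to the last slot after which no job was waiting. *)
Lemma serve_nonempty ds a Ts : sorted leq Ts -> (0 < size (serve a ds Ts))%N ->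
  (sumn ds < size Ts)%N \/
  exists2 m, (m < size ds)%N &
    (sumn (drop (size ds - m) ds) <
     count (fun tau => a + size ds - m.+1 < tau) Ts)%N.
Proof.
elim: ds a Ts => [|d ds IH] a Ts sTs /=; first by left.
rewrite iter_pop //; set c := count _ Ts => h.
have hc : (count (fun tau => a < tau)%N Ts = size Ts - c)%N.
  rewrite -(count_predC (fun tau => tau <= a)%N Ts) -/c addKn.
  by apply: eq_count => x /=; rewrite ltnNge.
have := IH a.+1 _ (drop_sorted _ sTs) h.
case=> [h1|[m ms h1]]; last first.
  right; exists m; first exact: leqW.
  rewrite subSn ?(ltnW ms) //=; apply: leq_trans h1 _.
  rewrite addSnnS.
  rewrite -[X in (_ <= count _ X)%N](cat_take_drop (minn d c) Ts) count_cat.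
  exact: leq_addl.
rewrite size_drop in h1; case: (leqP d c) => dc.
  by left; move: h1; rewrite (minn_idPl dc); lia.
right; exists (size ds) => //.
rewrite subSn // subnn drop1 /= addnS subSS addnK hc.
by move: h1; rewrite (minn_idPr (ltnW dc)).
Qed.

(** The default 1 of [head] is not a renewal, so an exhausted path contributes no departure. *)
Fixpoint departures (b : nat) (ps : seq (seq nat)) : seq nat :=
  if b is b'.+1 then
    count (fun l => head 1%N l == 0%N) ps :: departures b' (map behead ps)
  else [::].

(** [busy_slots] advances all servers slot by slot, the right-hand side draws one whole path per
    server; independence of the servers makes the two orders equivalent. *)
Lemma fexp_busy_slots b rs F :
  fexp (busy_slots b rs) F =
  fexp (fprod (map (chain p b) rs)) (fun ps => F (departures b ps)).
Proof.
elim: b rs F => [|b IH] rs F.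
  rewrite fexp_ret /= fexp_cst //; apply: fprob_prod => i.
  by rewrite size_map => ir; rewrite (nth_map 0%N) //; exact: fprob_ret.
rewrite /= fexp_bind.
under eq_fexp => x do rewrite fexp_map IH.
suff key c : fexp (busy_step rs) (fun x => fexp (fprod (map (chain p b) x.2))
      (fun ps => c x.1 ps)) =
   fexp (fprod (map (chain p b.+1) rs))
     (fun ps => c (count (fun l => head 1%N l == 0%N) ps) (map behead ps)).
  exact: (key (fun d ps => F (d :: departures b ps))).
elim: rs c => [|r rs IHr] c; first by rewrite !fexp_ret.
rewrite [map _ (r :: rs)]/= fexp_prod_cons fexp_chainS.
rewrite /= fexp_bind; apply: eq_fexp => r'.
rewrite fexp_map.
transitivity (fexp (busy_step rs) (fun x => fexp (chain p b r') (fun l =>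
    fexp (fprod (map (chain p b) x.2)) (fun ps => c ((r == 0%N) + x.1)%N (l :: ps))))).
  by apply: eq_fexp => x; exact: fexp_prod_cons.
rewrite fexp_swap; apply: eq_fexp => l.
exact: (IHr (fun d ps => c ((r == 0%N) + d)%N (l :: ps))).
Qed.

Lemma sum_departures b k ps : all (fun l => size l == b) ps -> (k <= b)%N ->
  sumn (drop k (departures b ps)) =
  (\sum_(l <- ps) count (pred1 0%N) (drop k l))%N.
Proof.
elim: b k ps => [|b IH] k ps sps kb.
  rewrite /= big1_seq // => l /= lps; move/allP: sps => /(_ _ lps) /eqP/size0nil ->.
  by [].
have sps' : all (fun l => size l == b) (map behead ps).
  by rewrite all_map; apply: sub_all sps => l /= /eqP; case: l => //= _ l [->].
case: k kb => [|k] kb; last first.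
  rewrite /= (IH k _ sps' kb) big_map; apply: eq_bigr => l _.
  by case: l.
rewrite /=; have := IH 0%N _ sps' isT; rewrite drop0 => ->.
rewrite big_map -sum1_count big_mkcond -big_split /=; apply: eq_big_seq => l lps.
move/allP: sps => /(_ _ lps); case: l {lps} => //= x l _.
by rewrite drop0; case: (x == 0%N).
Qed.

Lemma fexp_prod_chain_le b rs F G :
  (forall ps, size ps = size rs -> all (fun l => size l == b) ps ->
     F ps <= G ps) ->
  fexp (fprod (map (chain p b) rs)) F <= fexp (fprod (map (chain p b) rs)) G.
Proof.
elim: rs F G => [|r rs IH] F G FG; first by rewrite !fexp_ret FG.
rewrite !fexp_prod_cons; apply: fexp_chain_le => // l sl.
by apply: IH => ps sps aps; apply: FG; rewrite /= ?sps ?sl ?eqxx.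
Qed.

(** A late job forces a window of slots ending with t in which the busy system has fewer departures
    than there are arrivals. The test on [size ps] keeps the number of servers in the event, where
    the deficit is computed later. *)
Lemma late_le_windows t rs Ts k : sorted leq Ts -> (size Ts <= k)%N ->
  fexp (iid p k) (fun ys => ind R (late t (sort leq rs) Ts ys)) <=
  fexp (fprod (map (chain p t.+1) rs)) (fun ps =>
    ind R ((size ps == size rs) && has (fun m =>
      (\sum_(l <- ps) count (pred1 0%N) (drop (t.+1 - m) l) <
       count (fun tau => t < tau + m) Ts)%N) (iota 0 t.+2))).
Proof.
move=> sTs kT.
apply: le_trans (_ : fexp (busy_slots t.+1 rs)
    (fun ds => ind R (0 < size (serve 0 ds Ts))%N) <= _).
  apply: late_le_busy => //; split.
  - by apply: sort_sorted; exact: leq_total.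
  - by rewrite size_sort size_map.
  - by move=> z; rewrite count_sort count_map; apply: eq_leq; apply: eq_count.
rewrite fexp_busy_slots; apply: fexp_prod_chain_le => ps sps aps.
apply: le_ind => /(serve_nonempty sTs) h; rewrite sps eqxx andTb; apply/hasP.
have sD : size (departures t.+1 ps) = t.+1.
  by elim: t.+1 ps {sps aps h} => //= b IH ps; rewrite IH.
rewrite sD in h; case: h => [h|[m mt h]].
  exists t.+1; first by rewrite mem_iota ltnSn.
  rewrite subnn -(sum_departures aps (leq0n _)) drop0; apply: leq_trans h _.
  rewrite (eq_count (a2 := predT)) ?count_predT // => x /=.
  by rewrite addnS ltnS leq_addl.
exists m; first by rewrite mem_iota add0n leqW.
rewrite -(sum_departures aps (leq_subr _ _)); apply: leq_trans h _.
by apply: sub_count => x /=; lia.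
Qed.

End Coupling.

(** * Arrivals over a window *)

Section Arrivals.
Variables (R : realType) (p : fdist R nat).
Hypothesis pp : fprob p.

Fixpoint epochs (u : nat) (l : seq nat) : seq nat :=
  if l is x :: l' then u :: epochs (u + x) l' else [::].

Lemma epochs_ge u l : all (leq u) (epochs u l).
Proof.
elim: l u => //= x l IH u; rewrite leqnn /=; apply: sub_all (IH _) => y.
by apply: leq_trans; exact: leq_addr.
Qed.

Lemma sorted_epochs u l : sorted leq (epochs u l).
Proof.
elim: l u => //= x l IH u; rewrite path_sortedE; last exact: leq_trans.
rewrite IH andbT; apply: sub_all (epochs_ge _ _) => y.
by apply: leq_trans; exact: leq_addr.
Qed.

Lemma size_epochs u l : size (epochs u l) = size l.
Proof. by elim: l u => //= x l IH u; rewrite IH. Qed.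

Lemma count_epochs0 (a : pred nat) u l :
  (forall S, (u <= S)%N -> ~~ a S) -> count a (epochs u l) = 0%N.
Proof.
move=> h; apply/eqP; rewrite -leqn0 leqNgt -has_count; apply/hasPn => S.
by move/(allP (epochs_ge u l)); exact: h.
Qed.

Variables (th psi : R).
Hypotheses (th0 : 0 <= th) (psi0 : 0 <= psi)
  (laplace : fexp p (fun x => expR (- (th * x%:R))) <= expR (- psi)).

(** Exponential Markov bound for a renewal count: 1 + kap epochs up to D force kap gaps of total
    length at most D - u. As kap is real, each epoch in the induction lowers it by one; once it is
    nonpositive the bound is at least 1. *)
Lemma epochs_before_tail J u D kap : (u <= D)%N ->
  fexp (iid p J) (fun l =>
    ind R (1 + kap <= (count (fun S => S <= D)%N (epochs u l))%:R)) <=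
  expR (th * (D - u)%:R - psi * kap).
Proof.
elim: J u kap => [|J IH] u kap uD.
  rewrite fexp_ret /=; apply: le_ind_ge0 (expR_ge0 _) _ => h.
  apply: le_trans (expR_ge1Dx _); rewrite lerDl subr_ge0.
  apply: le_trans (_ : 0 <= _); last by rewrite mulr_ge0.
  by rewrite -(mulr0 psi) ler_wpM2l //; lra.
have [kap0|kap0] := leP kap 0.
  apply: le_trans (_ : 1 <= _).
    rewrite -[leRHS](fexp_cst _ (fprob_iid J.+1 pp)).
    by apply: fexp_le => [|l]; [case: (fprob_iid J.+1 pp)|exact: ind_le1].
  apply: le_trans (expR_ge1Dx _); rewrite lerDl subr_ge0.
  apply: le_trans (_ : 0 <= _); last by rewrite mulr_ge0.
  by rewrite -(mulr0 psi) ler_wpM2l.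
rewrite fexp_iidS /=.
apply: le_trans (_ : fexp p (fun x =>
    expR (th * (D - u)%:R - psi * (kap - 1)) * expR (- (th * x%:R))) <= _); last first.
  rewrite fexpZ; apply: le_trans (ler_wpM2l (expR_ge0 _) laplace) _.
  by rewrite -expRD ler_expR; lra.
apply: fexp_le => [|x]; first by case: pp.
rewrite -expRD uD.
have e l : (1 + kap <= (true + count (fun S => S <= D)%N (epochs (u + x) l))%N%:R) =
   (1 + (kap - 1) <= (count (fun S => S <= D)%N (epochs (u + x) l))%:R) :> bool.
  by rewrite natrD (_ : true%:R = 1 :> R) //; apply/idP/idP => h; lra.
under eq_fexp => l do rewrite e.
have [uxD|uxD] := leqP (u + x) D.
  apply: le_trans (IH (u + x)%N (kap - 1) uxD) _.
  by rewrite ler_expR subnDA [(D - u - x)%:R]natrB; [lra|rewrite leq_subRL].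
rewrite (_ : (fun l => _) = fun=> 0).
  by rewrite (fexp_cst _ (fprob_iid J pp)) expR_ge0.
apply/funext => l; rewrite count_epochs0 => [|S uS].
  by rewrite /ind (_ : (_ <= _) = false) //; apply/negbTE; rewrite -ltNge; lra.
by rewrite -ltnNge; exact: leq_trans uS.
Qed.

(** The epochs in ]D - v - w, D - v], written additively to avoid truncated subtraction. *)
Definition in_window (D v w S : nat) : bool := (S + v <= D < S + v + w)%N.

(** Epochs before the window are averaged out. The first epoch inside it starts a fresh renewal
    process with at most w units left, and is the 1 in 1 + kap. *)
Lemma epochs_window_tail J u D v w kap : 0 <= kap ->
  fexp (iid p J) (fun l =>
    ind R (1 + kap <= (count (in_window D v w) (epochs u l))%:R)) <=
  expR (th * w%:R - psi * kap).
Proof.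
move=> kap0; elim: J u => [|J IH] u.
  rewrite fexp_ret /=; apply: le_ind_ge0 (expR_ge0 _) _ => h.
  by exfalso; lra.
have [before|] := leqP (u + v + w) D.
  rewrite fexp_iidS -[leRHS](fexp_cst _ pp).
  apply: fexp_le => [|x]; first by case: pp.
  apply: le_trans (IH (u + x)%N); rewrite le_eqVlt; apply/orP; left; apply/eqP.
  by apply: eq_fexp => l; rewrite /= {1}/in_window [(D < _)%N]ltnNge before andbF.
have [inside|after] := leqP (u + v) D => hw.
  have uD : (u <= D - v)%N by rewrite leq_subRL; [rewrite addnC|exact: leq_trans (leq_addl u v) inside].
  apply: le_trans (_ : expR (th * (D - v - u)%:R - psi * kap) <= _).
    apply: le_trans (epochs_before_tail J.+1 kap uD).
    apply: fexp_le => [|l]; first by case: (fprob_iid J.+1 pp).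
    apply: le_ind => h; apply: le_trans h _; rewrite ler_nat.
    by apply: sub_count => S /andP[h _]; lia.
  rewrite ler_expR lerD2r; apply: ler_wpM2l => //; rewrite ler_nat; lia.
rewrite (_ : (fun l => _) = fun=> 0).
  by rewrite (fexp_cst _ (fprob_iid J.+1 pp)) expR_ge0.
apply/funext => l; rewrite count_epochs0 => [|S uS].
  by rewrite /ind (_ : (_ <= _) = false) //; apply/negbTE; rewrite -ltNge; lra.
by rewrite /in_window; lia.
Qed.

End Arrivals.

Lemma in_window0 D : in_window D 0 0 =1 pred0.
Proof. by move=> S; rewrite /in_window !addn0 /=; lia. Qed.

Lemma count_in_windowD D v w s :
  count (in_window D 0 (v + w)) s =
  (count (in_window D 0 v) s + count (in_window D v w) s)%N.
Proof.
elim: s => //= S s ->.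
have -> : (in_window D 0 (v + w) S = in_window D 0 v S + in_window D v w S :> nat)%N.
  rewrite /in_window addn0 addnA.
  case: (leqP S D); case: (leqP (S + v) D); case: (ltnP D (S + v + w)) => /=; lia.
by rewrite addnACA.
Qed.

(** * Tails of the number of arrivals in a window *)

Section ArrivalTail.
Variables (R : realType) (p : fdist R nat) (m1 m2 c b0 : R).
Hypotheses (pp : fprob p) (m1_gt0 : 0 < m1) (c_gt0 : 0 < c) (c_le1 : c <= 1)
  (b0_gt0 : 0 < b0) (b0_le1 : b0 <= 1).
Hypotheses (m1E : fexp p (fun x => x%:R) = m1)
  (m2_ge : fexp p (fun x => x%:R ^+ 2) <= m2) (m2_le : c * m2 <= m1 ^+ 2)
  (m2_gt0 : 0 < m2).

(** The power 2^28 is 256 times 16^4 from the exponential tail, times 4^2 from the bound on [Z ^+ 2]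
    in [exp_tail_arith]. *)
Definition arrival_const : R := 2 ^+ 28 / (c ^+ 4 * b0 ^+ 2).

Lemma arrival_const_ge1 : 1 <= arrival_const.
Proof.
rewrite ler_pdivlMr ?mulr_gt0 ?exprn_gt0 // mul1r.
apply: le_trans (_ : 1 <= _); last by rewrite exprn_ege1 // ler1n.
by rewrite mulr_ile1 ?exprn_ge0 ?exprn_ile1 // ltW.
Qed.

Lemma laplace_le th : 0 <= th ->
  fexp p (fun x => expR (- (th * x%:R))) <= expR (- (th * m1 - th ^+ 2 * m2)).
Proof.
move=> th0.
apply: le_trans (_ : 1 - th * m1 + th ^+ 2 * m2 <= _); last first.
  by apply: le_trans (expR_ge1Dx _); lra.
apply: le_trans (_ : fexp p (fun x => 1 - th * x%:R + th ^+ 2 * x%:R ^+ 2) <= _).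
  apply: fexp_le => [|x]; first by case: pp.
  by rewrite -exprMn; apply: expRN_le_quadratic; rewrite mulr_ge0.
rewrite fexpD fexpB fexp_cst // !fexpZ m1E lerD2l.
by rewrite ler_wpM2l ?sqr_ge0.
Qed.

Lemma count_tail_exp J D v w s : 1 < s ->
  fexp (iid p J) (fun l =>
    ind R (s < (count (in_window D v w) (epochs 0 l))%:R - w%:R / m1)) <=
  expR (- (c * (s - 1) ^+ 2 / (4 * (w%:R / m1 + (s - 1))))).
Proof.
move=> s1; set nu := w%:R / m1.
have nu0 : 0 <= nu by rewrite divr_ge0 // ltW.
set s' := s - 1; have s'0 : 0 < s' by rewrite subr_gt0.
have ns0 : 0 < nu + s' by rewrite ltr_wpDl.
(* Minimizes th^2 m2 (nu + s') - th m1 s', the exponent once w is written as nu m1. *)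
pose th := m1 * s' / (2 * m2 * (nu + s')).
have th0 : 0 <= th.
  by apply: divr_ge0; rewrite !mulr_ge0 // ltW.
have psi0 : 0 <= th * m1 - th ^+ 2 * m2.
  rewrite (_ : _ - _ = th * (m1 - th * m2)); last by ring.
  apply: mulr_ge0 => //; rewrite subr_ge0.
  rewrite (_ : th * m2 = m1 * (s' / (2 * (nu + s')))); last first.
    by rewrite /th; field; rewrite !gt_eqF.
  rewrite ger_pMr // ler_pdivrMr ?mulr_gt0 // mul1r; lra.
have k0 : 0 <= nu + s' by exact: ltW.
apply: le_trans (_ : fexp (iid p J) (fun l => ind R (1 + (nu + s') <=
   (count (in_window D v w) (epochs 0 l))%:R)) <= _).
  apply: fexp_le => [|l]; first by case: (fprob_iid J pp).
  by apply: le_ind => h; rewrite /s'; lra.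
apply: le_trans (epochs_window_tail pp th0 psi0 (laplace_le th0) J 0 D v w k0) _.
rewrite ler_expR.
have -> : th * w%:R - (th * m1 - th ^+ 2 * m2) * (nu + s') =
    - (m1 ^+ 2 / m2 * s' ^+ 2 / (4 * (nu + s'))).
  have -> : w%:R = nu * m1 by rewrite /nu mulfVK // gt_eqF.
  by rewrite /th; field; rewrite !gt_eqF.
rewrite lerN2 ler_pM2r ?invr_gt0 ?mulr_gt0 // ler_pM2r ?exprn_gt0 //.
by rewrite ler_pdivlMr.
Qed.

Lemma expRN_le_inv_pow4 (x : R) : 0 < x -> expR (- x) <= 256 / x ^+ 4.
Proof.
move=> x0; have -> : - x = 2%:R * - (x / 2) by lra.
rewrite expRM_natl; apply: le_trans (_ : (4 / (x / 2) ^+ 2) ^+ 2 <= _).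
  apply: lerXn2r; rewrite ?nnegrE ?expR_ge0 //.
    by rewrite divr_ge0 // exprn_ge0 // divr_ge0 // ltW.
  by apply: expRN_le_inv_sqr; rewrite divr_gt0.
rewrite le_eqVlt; apply/orP; left; apply/eqP; field.
by rewrite gt_eqF.
Qed.

(** The Bernstein exponent is at least c / (16 Z) with Z = (nu + s) / s^2. The assumption nu >= b0
    bounds Z^2 by a multiple of Y = nu / s^2, so exp(-x) <= 256 / x^4 yields Y^2. *)
Lemma exp_tail_arith (nu s : R) : b0 <= nu -> 2 < s -> nu <= s ^+ 2 ->
  expR (- (c * (s - 1) ^+ 2 / (4 * (nu + (s - 1))))) <=
  arrival_const * (nu / s ^+ 2) ^+ 2.
Proof.
move=> hb s2 hY.
have nu0 : 0 < nu by exact: lt_le_trans hb.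
have s0 : 0 < s by lra.
have ns0 : 0 < nu + s by exact: addr_gt0.
pose Z := (nu + s) / s ^+ 2; have Z0 : 0 < Z by rewrite divr_gt0 ?exprn_gt0.
have z0 : 0 < c / (16 * Z) by exact: divr_gt0 c_gt0 (mulr_gt0 (ltr0n R 16) Z0).
apply: le_trans (_ : expR (- (c / (16 * Z))) <= _).
  rewrite ler_expR lerN2 (_ : c / (16 * Z) = c * (s ^+ 2 / 4) / (4 * (nu + s))); last first.
    by rewrite /Z; field; rewrite !gt_eqF.
  apply: ler_pM; rewrite ?mulr_ge0 ?invr_ge0 ?mulr_ge0 ?divr_ge0 ?exprn_ge0 ?(ltW c_gt0) ?(ltW ns0) ?(ltW s0) //.
    rewrite ler_pM2l // (_ : s ^+ 2 / 4 = (s / 2) ^+ 2); last by field.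
    by apply: lerXn2r; rewrite ?nnegrE; lra.
  by rewrite lef_pV2 ?posrE ?mulr_gt0 //; lra.
apply: le_trans (expRN_le_inv_pow4 z0) _.
set Y := nu / s ^+ 2; have Y0 : 0 < Y by rewrite divr_gt0 ?exprn_gt0.
have Y1 : Y <= 1 by rewrite ler_pdivrMr ?exprn_gt0 // mul1r.
have Z2 : Z ^+ 2 <= 4 * Y / b0.
  pose W := (s ^+ 2)^-1; have W0 : 0 < W by rewrite invr_gt0 exprn_gt0.
  have WY : W <= Y / b0.
    by rewrite ler_pdivlMr // mulrC /Y ler_pM2r.
  have YYb : Y * Y <= Y / b0.
    rewrite ler_pM2l //; apply: le_trans Y1 _.
    by rewrite invf_ge1.
  have -> : Z ^+ 2 = Y * Y + W + 2 * (nu * s * W ^+ 2).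
    by rewrite /Z /Y /W; field; rewrite gt_eqF.
  have : 2 * (nu * s * W ^+ 2) <= Y * Y + W.
    have -> : Y * Y + W = (nu ^+ 2 + s ^+ 2) * W ^+ 2.
      by rewrite /Y /W; field; rewrite gt_eqF.
    rewrite mulrA ler_pM2r ?exprn_gt0 //.
    by have := sqr_ge0 (nu - s); rewrite sqrrB; lra.
  by rewrite -mulrA; lra.
have -> : 256 / (c / (16 * Z)) ^+ 4 = 2 ^+ 24 / c ^+ 4 * (Z ^+ 2) ^+ 2.
  rewrite (_ : 2 ^+ 24 = 256 * 16 ^+ 4) ?exprn_gt0 //; last by ring.
  by field; rewrite !gt_eqF.
have -> : arrival_const * Y ^+ 2 = 2 ^+ 24 / c ^+ 4 * (4 * Y / b0) ^+ 2.
  rewrite /arrival_const (_ : 2 ^+ 28 = 2 ^+ 24 * 16); last by ring.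
  by move: (2 ^+ 24) => N; field; rewrite !gt_eqF.
apply: ler_wpM2l; first by rewrite divr_ge0 // exprn_ge0 // ltW.
apply: lerXn2r => //; rewrite nnegrE; first exact: sqr_ge0.
by apply: divr_ge0; [apply: mulr_ge0 => //|]; exact: ltW.
Qed.

(** When s^2 < nu or s <= 2 the right-hand side is at least 1; what remains is the range of the
    exponential bound. *)
Lemma count_tail J D v w s : 0 < s -> b0 <= w%:R / m1 ->
  fexp (iid p J) (fun l => ind R
    (s < (count (in_window D v w) (epochs 0 l))%:R - w%:R / m1)) <=
  arrival_const * (w%:R / m1 / s ^+ 2) ^+ 2.
Proof.
move=> s0 hb; set nu := w%:R / m1 in hb *.
have nu0 : 0 < nu by exact: lt_le_trans hb.
have pJ := fprob_iid J pp.
have A1 := arrival_const_ge1.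
have le1 : fexp (iid p J) (fun l => ind R
    (s < (count (in_window D v w) (epochs 0 l))%:R - nu)) <= 1.
  rewrite -[leRHS](fexp_cst _ pJ).
  by apply: fexp_le => [|l]; [case: pJ|exact: ind_le1].
have [hY|hY] := leP nu (s ^+ 2); last first.
  apply: le_trans le1 _; rewrite -[leLHS]mul1r; apply: ler_pM => //.
  by apply: exprn_ege1; rewrite ler_pdivlMr ?exprn_gt0 // mul1r ltW.
have [s2|s2] := leP s 2; last first.
  apply: le_trans (exp_tail_arith hb s2 hY).
  by apply: count_tail_exp; lra.
apply: le_trans le1 _.
have -> : arrival_const * (nu / s ^+ 2) ^+ 2 =
    2 ^+ 24 * ((c ^+ 4)^-1 * (4 / s ^+ 2 * (nu / b0)) ^+ 2).
  rewrite /arrival_const (_ : 2 ^+ 28 = 2 ^+ 24 * 16); last by ring.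
  by move: (2 ^+ 24) => N; field; rewrite !gt_eqF.
have p1 : 1 <= 2 ^+ 24 :> R by rewrite exprn_ege1 // ler1n.
have p2 : 1 <= (c ^+ 4)^-1 by rewrite invf_ge1 ?exprn_gt0 // exprn_ile1 // ltW.
have p3 : 1 <= 4 / s ^+ 2.
  rewrite ler_pdivlMr ?exprn_gt0 // mul1r (_ : 4 = 2 ^+ 2); last by ring.
  by apply: lerXn2r => //; rewrite nnegrE // ltW.
have p4 : 1 <= nu / b0 by rewrite ler_pdivlMr // mul1r.
have p5 : 1 <= (4 / s ^+ 2 * (nu / b0)) ^+ 2 by rewrite exprn_ege1 // mulr_ege1.
exact: mulr_ege1 p1 (mulr_ege1 p2 p5).
Qed.

Lemma count_tail_weak J D v w s : 0 < s -> b0 <= w%:R / m1 ->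
  fexp (iid p J) (fun l => ind R
    (s < (count (in_window D v w) (epochs 0 l))%:R - w%:R / m1)) <=
  arrival_const * (w%:R / m1 / s ^+ 2).
Proof.
move=> s0 hb; set nu := w%:R / m1.
have nu0 : 0 < nu by exact: lt_le_trans hb.
have pJ := fprob_iid J pp.
have A1 := arrival_const_ge1.
have Y0 : 0 <= nu / s ^+ 2 by rewrite divr_ge0 ?exprn_ge0 // ltW.
have [hY|hY] := leP (nu / s ^+ 2) 1.
  apply: le_trans (count_tail J D v s0 hb) _; rewrite -/nu.
  apply: ler_wpM2l; first exact: le_trans A1.
  by rewrite expr2 ler_piMl.
apply: le_trans (_ : 1 <= _); last by rewrite mulr_ege1 // ltW.
rewrite -[leRHS](fexp_cst _ pJ).
by apply: fexp_le => [|l]; [case: pJ|exact: ind_le1].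
Qed.

End ArrivalTail.

(** * The queue in slotted time *)

Section SlottedQueue.
Variable R : realType.

Lemma fexp_prod_size T (Ls : seq (fdist R T)) F G :
  (forall l, size l = size Ls -> F l <= G l) -> all (@fpos R T) Ls ->
  fexp (fprod Ls) F <= fexp (fprod Ls) G.
Proof.
elim: Ls F G => [|L Ls IH] F G FG; first by move=> _; rewrite !fexp_ret FG.
move=> /andP[L0 Ls0]; rewrite !fexp_prod_cons; apply: fexp_le => // x.
by apply: IH => // l sl; rewrite FG //= sl.
Qed.

(** If one counted entry survives the removal of the last m, all removed entries are counted too,
    since the property is upward closed. This is how the [m0] jobs exempted in [overload] reappear
    as a surplus of m0 arrivals. *)
Lemma count_take_sorted (a : pred nat) (s : seq nat) j m :
  (forall x y, (x <= y)%N -> a x -> a y) -> sorted leq s ->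
  (m <= j)%N -> (j <= size s)%N -> (0 < count a (take (j - m) s))%N ->
  (count a (take (j - m) s) + m)%N = count a (take j s).
Proof.
move=> amono ss mj js; rewrite -has_count => /hasP[x xs ax].
have hs := cat_take_drop (j - m) (take j s).
rewrite take_takel ?leq_subr // in hs.
have szd : size (drop (j - m) (take j s)) = m.
  rewrite size_drop size_takel //; lia.
move: (drop _ _) hs szd => d hs szd.
rewrite -hs count_cat; congr (_ + _)%N; rewrite -szd.
have srt : sorted leq (take (j - m) s ++ d) by rewrite hs; apply: take_sorted.
symmetry; apply/eqP; rewrite -all_count; apply/allP => y yd; apply: amono ax.
case/splitPr: xs srt => s1 s2; rewrite -catA /= => srt.
have : sorted leq (x :: d).
  apply: (subseq_sorted leq_trans) srt; apply: subseq_trans (suffix_subseq s1 _).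
  by rewrite /= eqxx; exact: suffix_subseq.
by rewrite /= path_sortedE; [case/andP => /allP/(_ _ yd)|exact: leq_trans].
Qed.

Section Windows.
Variable E : nat.
Hypothesis E0 : (0 < E)%N.

(* Time is measured in units of 1/E slot; the arrival epochs [epochs 0 l] are
   rounded down by at most one unit per job, which [taus] compensates. *)
Fixpoint taus (k u : nat) (l : seq nat) : seq nat :=
  if l is x :: l' then ((u + k) %/ E).+1 :: taus k.+1 (u + x) l' else [::].

Lemma taus_ge k u l : all (leq ((u + k) %/ E).+1) (taus k u l).
Proof.
elim: l k u => //= x l IH k u; rewrite leqnn /=; apply: sub_all (IH _ _) => y.
by apply: leq_trans; rewrite ltnS leq_div2r // leq_add // leq_addr.
Qed.

Lemma sorted_taus k u l : sorted leq (taus k u l).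
Proof.
elim: l k u => //= x l IH k u; rewrite path_sortedE; last exact: leq_trans.
rewrite IH andbT; apply: sub_all (taus_ge _ _ _) => y.
by apply: leq_trans; rewrite ltnS leq_div2r // leq_add // leq_addr.
Qed.

Lemma size_taus k u l : size (taus k u l) = size l.
Proof. by elim: l k u => //= x l IH k u; rewrite IH. Qed.

Definition arrived (t : nat) (l : seq nat) : nat :=
  count (fun S => S <= E * t)%N (epochs 0 l).

(** The compensation adds the index of the job, which stays below E and so amounts to less than one
    slot; the additional slot in the window pays for it. *)
Lemma count_taus_le t m k u l : (k + size l <= E)%N ->
  (count (fun tau => t < tau + m)
     (take (count (fun S => S <= E * t) (epochs u l)) (taus k u l)) <=
   count (in_window (E * t) 0 (E * m.+1)) (epochs u l))%N.
Proof.
elim: l k u => //= x l IH k u kl.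
case: (boolP (u <= E * t)%N) => ut; last first.
  rewrite add0n count_epochs0 ?take0 // => S uS.
  by rewrite -ltnNge; rewrite -ltnNge in ut; apply: leq_trans ut (leq_trans (leq_addr _ _) uS).
rewrite add1n /=; apply: leq_add; last by apply: IH; lia.
have : (t < ((u + k) %/ E).+1 + m -> in_window (E * t) 0 (E * m.+1) u)%N.
  rewrite addSn ltnS => h; rewrite /in_window addn0 ut /= mulnS.
  have h1 : (E * t <= E * ((u + k) %/ E) + E * m)%N by rewrite -mulnDr leq_mul2l h orbT.
  have h2 : (E * ((u + k) %/ E) <= u + k)%N by rewrite mulnC leq_trunc_div.
  by lia.
by case: (t < _)%N => [->|].
Qed.

(* Failure of the bound: too many arrivals, or a job other than the last [m0]
   ones arrived by slot [t] starts after it. *)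
Definition overload (t m0 : nat) (rs al sg : seq nat) : bool :=
  ~~ (arrived t al < size al)%N ||
  late t (sort leq rs) (take (arrived t al - m0) (taus 0 0 al)) sg.

End Windows.

Section Core.
Variables (C L beta B c b0 : R) (Ln : nat).
Hypotheses (C0 : 0 < C) (beta_ge : 4 / 5 <= beta) (beta_lt1 : beta < 1)
  (B0 : 0 < B) (c_gt0 : 0 < c) (c_le1 : c <= 1) (b0_gt0 : 0 < b0) (b0_le1 : b0 <= 1).

Let beta0 : 0 < beta. Proof. by apply: lt_le_trans beta_ge; lra. Qed.

Lemma sqr_exp2V d : (2 ^- d) ^+ 2 = 4 ^- d :> R.
Proof.
have h : (2^-1) ^+ 2 = 4^-1 :> R by field.
by rewrite -!exprVn -exprM mulnC exprM h.
Qed.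

(** After division by sqrt n the tail bounds of the deficit no longer involve n, so the chaining
    constant does not depend on n, q or b. *)
Lemma departures_deficit (eps : R) : 0 < eps -> exists K, 1 <= K /\
  forall (p : fdist R nat) H n q b, fprob p -> all (fun x => x.1 < H)%N p ->
  (0 < n)%N ->
  (forall k, excess_mean p (Ln * 2 ^ k * 2 ^ q) <= C * beta ^+ k * (2 ^ q)%:R) ->
  (forall k, trunc_sqr p (Ln * 2 ^ k * 2 ^ q) <= C * (2 * beta) ^+ k * (2 ^ q)%:R ^+ 2) ->
  (forall k, (2 ^ q)%:R / 2 <= trunc_mean p (Ln * 2 ^ k * 2 ^ q)) ->
  fexp (iid (busy_path p H b) n) (fun ps => ind R (has (fun m =>
    Num.sqrt n%:R * (K + B / 8 * (m%:R / 2 ^+ q)) < deficit p b ps m)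
    (iota 0 b.+1))) <= eps.
Proof.
move=> eps0.
pose C1 : R := 64 * (10 + 8 * Ln%:R) ^+ 2 + var_const Ln C.
have CV : 0 <= var_const Ln C.
  by rewrite /var_const !mulr_ge0 ?addr_ge0 ?mulr_ge0 ?exprn_ge0 // ltW.
have C64 : 0 < 64 * (10 + 8 * Ln%:R) ^+ 2 :> R.
  by rewrite mulr_gt0 // exprn_gt0 // ltr_wpDr // mulr_ge0.
have C10 : 0 < C1 by rewrite ltr_wpDr.
have B8 : 0 < B / 8 by rewrite divr_gt0.
have [K [K1 hK]] := chaining C10 beta_ge beta_lt1 B8 eps0.
exists K; split=> // p H n q b pp pH n0 h1 h2 h3.
have nr0 : 0 < n%:R :> R by rewrite ltr0n.
have sn0 : 0 < Num.sqrt n%:R :> R by rewrite sqrtr_gt0.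
have snn : Num.sqrt n%:R ^+ 2 = n%:R :> R by rewrite sqr_sqrtr // ltW.
have M0 : (0 < 2 ^ q)%N by rewrite expn_gt0.
have Mr0 : 0 < (2 ^ q)%:R :> R by rewrite ltr0n.
(* Outcomes are lists of arbitrary length, so the deficit at 0 is only known to be nonpositive;
   subtracting it makes G vanish at 0. *)
pose G ps m := (deficit p b ps m - deficit p b ps 0) / Num.sqrt n%:R.
have pL : fprob (iid (busy_path p H b) n) by apply: fprob_iid; exact: (fprob_busy_path pp pH).
have GE (a : R) (ps : seq (seq nat)) lo w : (a < G ps (lo + w)%N - G ps lo) =
    (a * Num.sqrt n%:R < deficit p b ps (lo + w) - deficit p b ps lo).
  rewrite /G -mulrBl ltr_pdivlMr //; congr (_ < _); ring.
have G0 ps : G ps 0%N = 0 by rewrite /G subrr mul0r.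
refine (le_trans _ (hK _ (iid (busy_path p H b) n) G q b pL G0 _ _)).
- apply: fexp_le => [|ps]; first by case: pL.
  apply: le_ind => /hasP[m mb hm]; apply/hasP; exists m => //.
  rewrite /G ltr_pdivlMr // mulrC; apply: lt_le_trans hm _.
  rewrite lerBrDr gerDl /deficit; apply: (big_ind (fun x : R => x <= 0)) => //.
  + by move=> x y x0 y0; rewrite -[0]addr0 lerD.
  + by move=> l _; rewrite mul0r sub0r oppr_le0 ler0n.
- move=> j lo a jq lob a0; under eq_fexp => ps do rewrite GE.
  have wM : (2 ^ j <= 2 ^ q)%N by rewrite leq_exp2l.
  have V0 : 0 < (10 + 8 * Ln%:R) * ((2 ^ j)%:R / (2 ^ q)%:R) :> R.
    by rewrite mulr_gt0 ?divr_gt0 ?ltr0n ?expn_gt0 // ltr_wpDr // mulr_ge0.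
  apply: le_trans (deficit_tail_exp pp pH lob (mulr_gt0 a0 sn0) n0 V0 _) _.
    exact: renewals_sqr_small M0 h3 _ wM.
  rewrite [(a * _) ^+ 2]exprMn snn.
  have -> : n%:R * ((10 + 8 * Ln%:R) * ((2 ^ j)%:R / (2 ^ q)%:R)) / (a ^+ 2 * n%:R) =
     (10 + 8 * Ln%:R) * (2 ^- (q - j)) / a ^+ 2 :> R.
    rewrite -{1}(subnKC jq) !natrX exprD.
    by field; rewrite !expf_neq0 ?gt_eqF.
  rewrite -mulrA exprMn mulrA expr_div_n.
  have -> : (2 ^- (q - j)) ^+ 2 = 4 ^- (q - j) :> R.
    exact: sqr_exp2V.
  rewrite -exprM mulrA ler_pM2r ?invr_gt0 ?exprn_gt0 // ler_pM2r ?invr_gt0 ?exprn_gt0 //.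
  by rewrite lerDl.
- move=> k lo a lob a0; under eq_fexp => ps do rewrite GE.
  have wE : (2 ^ (q + k) = 2 ^ k * 2 ^ q)%N by rewrite -expnD addnC.
  rewrite wE in lob *.
  have hv := renewals_var_large pp pH M0 beta0 h1 h2 h3 k.
  have ht := deficit_tail_var pp pH n lob (mulr_gt0 a0 sn0) hv.
  apply: le_trans ht _.
  rewrite [(a * _) ^+ 2]exprMn snn.
  have -> : n%:R * (var_const Ln C * (4 * beta) ^+ k) / (a ^+ 2 * n%:R) =
    var_const Ln C * (4 * beta) ^+ k / a ^+ 2.
    by field; rewrite !gt_eqF.
  rewrite ler_pM2r ?invr_gt0 ?exprn_gt0 // ler_pM2r ?exprn_gt0 ?mulr_gt0 //.
  by rewrite lerDr ltW.
Qed.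

(** Short windows use the squared tail bound, long ones its weak form: a growth 2^k, linear in the
    length, is below (4 beta)^k. *)
Lemma arrivals_excess (eps : R) : 0 < eps -> exists K, 1 <= K /\
  forall (p : fdist R nat) m1 m2 n q E t b J, fprob p -> 0 < m1 -> 0 < m2 ->
  (0 < n)%N -> (0 < E)%N ->
  fexp p (fun x => x%:R) = m1 -> fexp p (fun x => x%:R ^+ 2) <= m2 ->
  c * m2 <= m1 ^+ 2 -> b0 <= E%:R / m1 -> E%:R / m1 <= n%:R / 2 ^+ q ->
  fexp (iid p J) (fun l => ind R (has (fun m =>
    Num.sqrt n%:R * (K + B / 8 * (m%:R / 2 ^+ q)) <
    (count (in_window (E * t) 0 (E * m)) (epochs 0 l))%:R - m%:R * (E%:R / m1))
    (iota 0 b.+1))) <= eps.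
Proof.
move=> eps0.
have B8 : 0 < B / 8 by rewrite divr_gt0.
have A1 := arrival_const_ge1 c_gt0 c_le1 b0_gt0 b0_le1.
have A0 : 0 < arrival_const c b0 by apply: lt_le_trans A1.
have [K [K1 hK]] := chaining A0 beta_ge beta_lt1 B8 eps0.
exists K; split=> // p m1 m2 n q E t b J pp m10 m20 n0 E0 e1 e2 e12 hb hr.
have nr0 : 0 < n%:R :> R by rewrite ltr0n.
have Er0 : 0 < E%:R :> R by rewrite ltr0n.
have sn0 : 0 < Num.sqrt n%:R :> R by rewrite sqrtr_gt0.
have snn : Num.sqrt n%:R ^+ 2 = n%:R :> R by rewrite sqr_sqrtr // ltW.
pose cnt l m : R := (count (in_window (E * t) 0 (E * m)) (epochs 0 l))%:R.
pose G l m := (cnt l m - m%:R * (E%:R / m1)) / Num.sqrt n%:R.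
have pL : fprob (iid p J) by exact: fprob_iid.
have G0 l : G l 0%N = 0.
  rewrite /G /cnt (eq_count (a2 := pred0)) ?count_pred0 ?mul0r ?subrr ?mul0r //.
  by rewrite muln0; exact: in_window0.
have GE (a : R) l lo w : (a < G l (lo + w)%N - G l lo) =
    (a * Num.sqrt n%:R < (count (in_window (E * t) (E * lo) (E * w)) (epochs 0 l))%:R
       - (E * w)%:R / m1).
  rewrite /G -mulrBl ltr_pdivlMr //; congr (_ < _).
  have -> : cnt l (lo + w)%N = cnt l lo +
      (count (in_window (E * t) (E * lo) (E * w)) (epochs 0 l))%:R.
    by rewrite /cnt -natrD -count_in_windowD mulnDr.
  by rewrite natrM natrD; ring.
have nu w : (E * w)%:R / m1 = w%:R * (E%:R / m1) by rewrite natrM; ring.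
have hbw w : (0 < w)%N -> b0 <= (E * w)%:R / m1.
  by move=> w0; rewrite nu; apply: le_trans hb _; rewrite ler_peMl ?ler1n // divr_ge0 // ltW.
have rE (a : R) w : 0 < a -> (E * w)%:R / m1 / (a * Num.sqrt n%:R) ^+ 2 <= w%:R / 2 ^+ q / a ^+ 2.
  move=> a0; rewrite nu exprMn snn.
  have -> : w%:R * (E%:R / m1) / (a ^+ 2 * n%:R) = w%:R * (E%:R / m1 / n%:R) / a ^+ 2.
    by field; rewrite !gt_eqF.
  rewrite ler_pM2r ?invr_gt0 ?exprn_gt0 // ler_wpM2l // ler_pdivrMr //.
  by rewrite [leRHS]mulrC.
have R0 (a : R) w : 0 < a -> 0 <= (E * w)%:R / m1 / (a * Num.sqrt n%:R) ^+ 2.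
  by move=> a0; rewrite !divr_ge0 // ?exprn_ge0 ?mulr_ge0 // ltW.
refine (le_trans _ (hK _ (iid p J) G q b pL G0 _ _)).
- apply: fexp_le => [|l]; first by case: pL.
  apply: le_ind => /hasP[m mb hm]; apply/hasP; exists m => //.
  by rewrite /G ltr_pdivlMr // mulrC.
- move=> j lo a jq _ a0; under eq_fexp => l do rewrite GE.
  apply: le_trans (count_tail pp m10 c_gt0 c_le1 b0_gt0 b0_le1 e1 e2 e12 m20 J _ _
    (mulr_gt0 a0 sn0) (hbw _ _)) _; first by rewrite expn_gt0.
  rewrite -[leRHS]mulrA; apply: ler_wpM2l; first exact: ltW.
  apply: le_trans (_ : ((2 ^ j)%:R / 2 ^+ q / a ^+ 2) ^+ 2 <= _).
    by apply: lerXn2r; rewrite ?nnegrE ?R0 ?rE // !divr_ge0 // exprn_ge0 // ltW.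
  rewrite le_eqVlt; apply/orP; left; apply/eqP.
  rewrite -{1}(subnKC jq) natrX exprD.
  rewrite -sqr_exp2V.
  by field; rewrite !expf_neq0 ?gt_eqF.
- move=> k lo a _ a0; under eq_fexp => l do rewrite GE.
  apply: le_trans (count_tail_weak pp m10 c_gt0 c_le1 b0_gt0 b0_le1 e1 e2 e12 m20 J _ _
    (mulr_gt0 a0 sn0) (hbw _ _)) _; first by rewrite expn_gt0.
  rewrite -[leRHS]mulrA; apply: ler_wpM2l; first exact: ltW.
  apply: le_trans (rE _ _ a0) _.
  rewrite ler_pM2r ?invr_gt0 ?exprn_gt0 // natrX exprD mulrAC mulfV ?expf_neq0 // mul1r.
  apply: lerXn2r; rewrite ?nnegrE // ?mulr_ge0 ?(ltW beta0) //.
  by have := beta_ge; lra.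
Qed.

End Core.
End SlottedQueue.

(** * Probability of an overload, uniformly in n and in time *)

Section Overload.
Variables (R : realType) (C beta B c b0 : R) (L : nat).
Hypotheses (C0 : 0 < C) (beta_ge : 4 / 5 <= beta) (beta_lt1 : beta < 1)
  (B0 : 0 < B) (c_gt0 : 0 < c) (c_le1 : c <= 1) (b0_gt0 : 0 < b0) (b0_le1 : b0 <= 1).

(* [n / mu] is the service capacity per slot and [r] the arrival rate; the slack
   between the two absorbs both fluctuation terms [s * B / 8 * m / M]. *)
Lemma capacity_slack (n s M mu r K1 K2 m0 m S W : R) :
  s ^+ 2 = n -> 0 < s -> 1 <= M -> 1 <= mu -> mu <= M + 1 -> 0 <= m ->
  8 * s <= B * M -> r <= (n - B / 2 * s) / M -> s * (K1 + K2 + B) <= m0 ->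
  S + m0 < W -> W - (m + 1) * r <= s * (K2 + B / 8 * ((m + 1) / M)) ->
  s * (K1 + B / 8 * (m / M)) < n * (m / mu) - S.
Proof.
move=> sn s0 M1 mu1 muM mm sM rM m0E SW Wr.
have M0 : 0 < M by lra.
have mu0 : 0 < mu by lra.
pose u := s / M.
have u0 : 0 < u by rewrite divr_gt0.
have uB : u <= B / 8 by rewrite ler_pdivrMr //; lra.
have us : u <= s by rewrite ler_pdivrMr // ler_peMr // ltW.
have nM : n / M = s * u by rewrite -sn /u; field; rewrite gt_eqF.
(* As mu <= M + 1, rounding processing times up costs at most u^2 per slot, and u <= B / 8 makes
   this at most B / 8 * u. *)
have e1 : n / M - u ^+ 2 <= n / mu.
  apply: le_trans (_ : n / (M + 1) <= _); last first.
    by rewrite ler_wpM2l ?lef_pV2 ?posrE -?sn ?sqr_ge0 //; lra.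
  rewrite ler_pdivlMr; last lra.
  have -> : (n / M - u ^+ 2) * (M + 1) = n - u ^+ 2.
    by rewrite nM -sn /u; field; rewrite gt_eqF.
  by have := sqr_ge0 u; lra.
have e2 : r <= s * u - B / 2 * u.
  by apply: le_trans rM _; rewrite mulrBl nM /u -[B / 2 * s / M]mulrA.
have e3 : u ^+ 2 <= B / 8 * u by rewrite expr2 ler_pM2r.
(* Of the drift B u per slot, half is spent in the bound on [r] and an eighth on rounding; the
   fluctuations need two of the remaining three eighths. *)
have h1 : m * (r + 3 / 8 * (B * u)) <= m * (n / mu).
  by apply: ler_wpM2l => //; lra.
have h2 : s * u <= s * (B / 8) by rewrite ler_pM2l.
have h3 : B * u <= B * s by rewrite ler_pM2l.
have -> : n * (m / mu) = m * (n / mu) by ring.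
have hK : s * (K1 + B / 8 * (m / M)) = s * K1 + B / 8 * (m * u) by rewrite /u; ring.
have hK2 : s * (K2 + B / 8 * ((m + 1) / M)) = s * K2 + B / 8 * (m * u) + B / 8 * u.
  by rewrite /u; ring.
rewrite hK; rewrite hK2 in Wr.
have Bu : 0 < B * u by exact: mulr_gt0.
have mu' : 0 <= m * (B * u) by exact: mulr_ge0 mm (ltW Bu).
rewrite !mulrDr in m0E h1; rewrite mulrDl mul1r in Wr.
have e4 : B / 8 * (m * u) = m * (B * u) / 8 by field.
have e5 : m * (3 / 8 * (B * u)) = 3 * (m * (B * u)) / 8 by field.
rewrite e4 in Wr *; rewrite e5 in h1.
by lra.
Qed.

(** [K] is uniform in n, t and all discretization parameters. Outside an arrival event of
    probability at most eps / 2, an overload forces a large deficit of departures, which is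
    estimated under the stationary law at level H and transferred to the initial law [pi0]. *)
Lemma overload_unlikely (eps : R) : 0 < eps -> exists K, 0 < K /\
  forall (p pA pi0 : fdist R nat) H n q E t J Ks m0 (m1 m2 : R),
  fprob p -> fprob pA -> fprob pi0 -> all (fun x => x.1 < H)%N p -> (0 < n)%N ->
  (0 < E)%N ->
  (forall k, excess_mean p (L * 2 ^ k * 2 ^ q) <= C * beta ^+ k * (2 ^ q)%:R) ->
  (forall k, trunc_sqr p (L * 2 ^ k * 2 ^ q) <= C * (2 * beta) ^+ k * (2 ^ q)%:R ^+ 2) ->
  (forall k, (2 ^ q)%:R / 2 <= trunc_mean p (L * 2 ^ k * 2 ^ q)) ->
  mean_service p <= 2 ^+ q + 1 ->
  (forall f, (forall x, 0 <= f x) ->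
     fexp pi0 f <= (1 + n%:R^-1) * fexp (residual_law p H) f) ->
  0 < m1 -> 0 < m2 ->
  fexp pA (fun x => x%:R) = m1 -> fexp pA (fun x => x%:R ^+ 2) <= m2 ->
  c * m2 <= m1 ^+ 2 -> b0 <= E%:R / m1 ->
  E%:R / m1 <= (n%:R - B / 2 * Num.sqrt n%:R) / 2 ^+ q ->
  8 * Num.sqrt n%:R <= B * 2 ^+ q ->
  (J <= E)%N -> (J <= Ks)%N ->
  t.+1%:R * (E%:R / m1) + Num.sqrt n%:R * (K + B / 8 * (t.+1%:R / 2 ^+ q)) < J%:R ->
  Num.sqrt n%:R * K <= m0%:R ->
  fexp (iid pi0 n) (fun rs => fexp (iid pA J) (fun al => fexp (iid p Ks) (fun sg =>
    ind R (overload E t m0 rs al sg)))) <= eps.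
Proof.
move=> eps0.
have e1_0 : 0 < expR 1 :> R by exact: expR_gt0.
have epsa : 0 < eps / 2 by rewrite divr_gt0.
(* The factor exp 1 pays for the change from the stationary law to [pi0] over n servers. *)
have epsd : 0 < eps / 2 / expR 1 by rewrite divr_gt0.
have [K1 [K11 hD]] := departures_deficit L C0 beta_ge beta_lt1 B0 epsd.
have [K2 [K21 hA]] := arrivals_excess beta_ge beta_lt1 B0 c_gt0 c_le1 b0_gt0 b0_le1 epsa.
exists (K1 + K2 + B); split; first by rewrite !addr_gt0 // (lt_le_trans ltr01).
move=> p pA pi0 H n q E t J Ks m0 m1 m2 pp ppA pp0 pH n0 E0 h1 h2 h3 hmu hpi0 m10 m20
  e1 e2 e12 hb hr hq JE JK hJ hm0.
have nr0 : 0 < n%:R :> R by rewrite ltr0n.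
have s0 : 0 < Num.sqrt n%:R :> R by rewrite sqrtr_gt0.
have snn : Num.sqrt n%:R ^+ 2 = n%:R :> R by rewrite sqr_sqrtr // ltW.
have M1 : 1 <= 2 ^+ q :> R by rewrite exprn_ege1 // ler1n.
have M0 : 0 < 2 ^+ q :> R by lra.
have ppi := fprob_residual_law pp pH.
pose r := E%:R / m1.
pose bad al := has (fun m => Num.sqrt n%:R * (K2 + B / 8 * (m%:R / 2 ^+ q)) <
    (count (in_window (E * t) 0 (E * m)) (epochs 0 al))%:R - m%:R * r) (iota 0 t.+3).
pose low ps := has (fun m => Num.sqrt n%:R * (K1 + B / 8 * (m%:R / 2 ^+ q)) <
    deficit p t.+1 ps m) (iota 0 t.+2).
have rn : r <= n%:R / 2 ^+ q.
  apply: le_trans hr _; rewrite ler_pM2r ?invr_gt0 // gerBl.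
  by rewrite mulr_ge0 ?divr_ge0 // ltW.
have hbad : fexp (iid pA J) (fun al => ind R (bad al)) <= eps / 2.
  exact: (hA pA m1 m2 n q E t t.+2 J ppA m10 m20 n0 E0 e1 e2 e12 hb rn).
have hlow : fexp (iid (busy_path p H t.+1) n) (fun ps => ind R (low ps)) <=
   eps / 2 / expR 1.
  exact: (hD p H n q t.+1 pp pH n0 h1 h2 h3).
have pJ := fprob_iid J ppA.
have pK := fprob_iid Ks pp.
have good al sgs : size al = J -> ~~ bad al -> fexp (iid pi0 n) (fun rs =>
    fexp (iid p Ks) (fun sg => ind R (overload E t m0 rs al sg))) <= eps / 2 + 0 * sgs.
  rewrite mul0r addr0 => sal gal.
  have win m : (m < t.+3)%N ->
      (count (in_window (E * t) 0 (E * m)) (epochs 0 al))%:R - m%:R * r <=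
      Num.sqrt n%:R * (K2 + B / 8 * (m%:R / 2 ^+ q)).
    move=> mt; rewrite leNgt; apply/negP => h; move/negP: gal; apply.
    by apply/hasP; exists m; rewrite ?mem_iota.
  have arr_lt : (arrived E t al < size al)%N.
    rewrite sal -(ltr_nat R); apply: le_lt_trans hJ.
    have := win t.+1 (leqnSn _).
    have -> : count (in_window (E * t) 0 (E * t.+1)) (epochs 0 al) = arrived E t al.
      apply: eq_count => S; rewrite /in_window !addn0.
      by rewrite mulnS addnA -[X in (X < _)%N]add0n ltn_add2r addn_gt0 E0 orbT andbT.
    have hs : Num.sqrt n%:R * (K2 + B / 8 * (t.+1%:R / 2 ^+ q)) <=
        Num.sqrt n%:R * (K1 + K2 + B + B / 8 * (t.+1%:R / 2 ^+ q)).
      by have hB := B0; rewrite ler_pM2l //; lra.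
    rewrite -/r; lra.
  set Ts := take (arrived E t al - m0) (taus E 0 0 al).
  have sTs : sorted leq Ts by apply: take_sorted; exact: sorted_taus.
  have szTs : (size Ts <= Ks)%N.
    by apply: leq_trans JK; rewrite -sal -(size_taus E 0 0 al) size_take_min geq_minr.
  pose ev ps := (size ps == n) && has (fun m =>
      (\sum_(l <- ps) count (pred1 0%N) (drop (t.+1 - m) l) <
       count (fun tau => t < tau + m) Ts)%N) (iota 0 t.+2).
  have evlow ps : ev ps -> low ps.
    case/andP => /eqP sps /hasP[m]; rewrite mem_iota add0n => /andP[_ mt] hm.
    apply/hasP; exists m; first by rewrite mem_iota.
    rewrite /deficit sumrB big_const_seq count_predT sps iter_addr_0 -[X in X - _]mulr_natl.
    set S := \sum_(l <- ps) renewals R _.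
    have SE : S = (\sum_(l <- ps) count (pred1 0%N) (drop (t.+1 - m) l))%N%:R.
      by rewrite /S natr_sum.
    have cnt0 : (0 < count (fun tau => t < tau + m)%N Ts)%N by exact: leq_ltn_trans hm.
    (* A positive count excludes clipping in [arrived E t al - m0]. *)
    have m0a : (m0 <= arrived E t al)%N.
      rewrite leqNgt; apply/negP => h; move: cnt0; rewrite /Ts.
      by rewrite (_ : arrived E t al - m0 = 0)%N ?take0 //; apply/eqP; rewrite subn_eq0 ltnW.
    have mono x y : (x <= y)%N -> (t < x + m)%N -> (t < y + m)%N.
      by move=> xy h; apply: leq_trans h _; rewrite leq_add2r.
    have szt : (arrived E t al <= size (taus E 0 0 al))%N by rewrite size_taus ltnW.
    have cnt := count_take_sorted mono (sorted_taus E 0 0 al) m0a szt cnt0.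
    have szE : (0 + size al <= E)%N by rewrite add0n sal.
    have cw := count_taus_le E0 t m 0 szE; rewrite -/(arrived E t al) -cnt in cw.
    have w1 := win m.+1 _; have {}w1 := w1 (mt : m.+1 < t.+3)%N.
    apply: (@capacity_slack n%:R _ (2 ^+ q) (mean_service p) r K1 K2 m0%:R m%:R S
      (count (in_window (E * t) 0 (E * m.+1)) (epochs 0 al))%:R) => //.
    - exact: mean_service_ge1.
    - rewrite SE -natrD ltr_nat; apply: leq_trans cw; rewrite -addSn leq_add2r.
      exact: hm.
    - by rewrite natr1.
  have stepA : fexp (iid pi0 n) (fun rs => fexp (iid p Ks) (fun sg =>
       ind R (overload E t m0 rs al sg))) <=
     fexp (iid pi0 n) (fun rs => fexp (fprod (map (chain p t.+1) rs)) (fun ps => ind R (ev ps))).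
    apply: fexp_prod_size; last first.
      by rewrite all_nseq; case: pp0 => ->; rewrite orbT.
    move=> rs; rewrite size_nseq => srs.
    have := late_le_windows pp t rs sTs szTs; rewrite /ev srs.
    by rewrite /overload arr_lt.
  apply: le_trans stepA _.
  have c0 : 0 <= 1 + n%:R^-1 :> R by rewrite addr_ge0 // invr_ge0 ltW.
  apply: le_trans (fexp_iid_le n pp0 ppi c0 hpi0 _) _.
    move=> rs; apply: fexp_ge0 => [|ps]; last exact: ind_ge0.
    suff [] : fprob (fprod (map (chain p t.+1) rs)) by [].
    apply: fprob_prod => i; rewrite size_map => ir.
    by rewrite (nth_map 0%N) //; exact: fprob_chain.
  rewrite -fexp_iid_bind -/(busy_path p H t.+1).
  have hn : (1 + n%:R^-1) ^+ n <= expR 1 :> R.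
    apply: le_trans (_ : expR (n%:R^-1) ^+ n <= _).
      by apply: lerXn2r; rewrite ?nnegrE ?expR_ge0 // expR_ge1Dx.
    by rewrite -expRM_natl mulfV // gt_eqF.
  have hl : fexp (iid (busy_path p H t.+1) n) (fun ps => ind R (ev ps)) <= eps / 2 / expR 1.
    apply: le_trans hlow; apply: fexp_le => [|ps]; last exact/le_ind/evlow.
    by case: (fprob_iid n (fprob_busy_path pp pH t.+1)).
  apply: le_trans (ler_pM _ _ hn hl) _.
  - by rewrite exprn_ge0.
  - apply: fexp_ge0 => [|ps]; last exact: ind_ge0.
    by case: (fprob_iid n (fprob_busy_path pp pH t.+1)).
  - by rewrite mulrC mulfVK // gt_eqF.
rewrite fexp_swap.
apply: le_trans (_ : fexp (iid pA J) (fun al => ind R (bad al) + eps / 2) <= _); last first.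
  by rewrite fexpD (fexp_cst _ pJ); lra.
apply: fexp_prod_size; last first.
  by rewrite all_nseq; case: ppA => ->; rewrite orbT.
move=> al; rewrite size_nseq => sal.
have [bal|gal] := boolP (bad al); last first.
  by rewrite /ind mulr0n add0r; have := good al 0 sal gal; rewrite mul0r addr0.
apply: le_trans (_ : 1 <= _); last by rewrite /ind lerDl ltW.
rewrite -[leRHS](fexp_cst _ (fprob_iid n pp0)); apply: fexp_le => [|rs].
  by case: (fprob_iid n pp0).
rewrite -[leRHS](fexp_cst _ pK); apply: fexp_le => [|sg]; last exact: ind_le1.
by case: pK.
Qed.

End Overload.

(** * From real time to slots *)

Lemma perm_cons_middle (T : eqType) (x : T) u v w :
  perm_eq (x :: u) (v ++ x :: w) = perm_eq u (v ++ w).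
Proof.
by apply/permP/permP => h a; have := h a; rewrite /= !count_cat /=; lia.
Qed.

Section RealTime.
Variables (R : realType) (n : nat) (delta : R) (t : nat).
Hypotheses (n0 : (0 < n)%N) (delta_gt0 : 0 < delta).

Section FreeTimes.
Variables at_ pt : nat -> R.

Let f := server_free_times n at_ pt.

Lemma size_server_free_times j : size (f j) = n.
Proof.
elim: j => [|j IH]; first by rewrite /f /= size_nseq.
by rewrite /f /= size_sort /= size_behead -/(f j) IH prednK.
Qed.

Lemma sorted_server_free_times j : sorted <=%R (f j).
Proof.
case: j => [|j]; last by rewrite /f /=; apply: sort_sorted; exact: le_total.
by rewrite /f /=; elim: n => //= k; case: k => //= k ->; rewrite lexx.
Qed.

Lemma count_server_free_times (a : pred R) j :
  count a (f j.+1) = (a (departure_time n at_ pt j) + count a (behead (f j)))%N.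
Proof. by rewrite /f /= count_sort. Qed.

Lemma count_behead (a : pred R) j :
  count a (f j) = (a (head 0%R (f j)) + count a (behead (f j)))%N.
Proof.
by move: (size_server_free_times j); case: (f j) => //= s0; move: n0; rewrite -s0.
Qed.

(** A job that starts by z takes over a server that is free by z, so updating its free time does not
    disturb the count of the earlier jobs. Hence at most n of these jobs are in service after z. *)
Lemma count_in_service z j :
  (forall i, (i < j)%N -> start_time n at_ pt i <= z) -> 0 <= z ->
  count (fun x => z < x) (f j) =
  count (fun i => z < departure_time n at_ pt i) (iota 0 j).
Proof.
move=> h z0; elim: j h => [|j IH] h.
  by rewrite /f /= count_nseq ltNge z0.
rewrite count_server_free_times -addn1 iotaD count_cat /= addn0 add0n addnC.
congr (_ + _)%N; rewrite -IH => [|i ij]; last by apply: h; rewrite ltnW.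
rewrite [RHS]count_behead.
have := h j (ltnSn j); rewrite /start_time ge_max => /andP[_ hz].
by rewrite ltNge hz.
Qed.

(** Only slots up to t are compared, because truncated processing times are reliable only up to this
    horizon. *)
Definition slot_dominates (V : seq nat) (j : nat) := [/\ sorted leq V, size V = n &
  forall z, (z <= t)%N -> (count (fun x => delta * z%:R < x)%R (f j) <= count (ltn z) V)%N].

(** Pathwise comparison of the real recursion with the slotted one. The second alternatives in the
    hypotheses cover the values cut by truncation, which lie beyond the horizon. *)
Lemma starts_on_time Ts sg V j : slot_dominates V j ->
  (forall i, (i < size Ts)%N ->
     at_ (j + i) <= delta * (nth 0%N Ts i)%:R \/ (t < nth 0%N Ts i)%N) ->
  (forall i, (i < size Ts)%N ->
     pt (j + i) <= delta * (nth 0%N sg i).+1%:R \/ (t <= nth 0%N sg i)%N) ->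
  (size Ts <= size sg)%N -> ~~ late t V Ts sg ->
  forall i, (i < size Ts)%N -> start_time n at_ pt (j + i) <= delta * t%:R.
Proof.
elim: Ts sg V j => // tau Ts IH [|y sg] V j //= [sV szV dom] hat hpt szs.
rewrite negb_or -leqNgt geq_max => /andP[/andP[taut hV] nl].
have taur : at_ j <= delta * tau%:R.
  by have := hat 0%N isT; rewrite addn0 /=; case=> //; rewrite ltnNge taut.
set v := head 0%N V in hV nl.
have vV : V = v :: behead V.
  by rewrite /v; case: (V) szV => // s0; move: n0; rewrite -s0.
(* Otherwise all n servers are busy after slot [v], whereas the head of [V] is [v] and leaves at
   most n - 1. *)
have headf : head 0 (f j) <= delta * v%:R.
  rewrite leNgt; apply/negP => h; have := dom v hV.
  have -> : count (fun x => delta * v%:R < x) (f j) = n.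
    rewrite -(size_server_free_times j); apply/eqP; rewrite -all_count.
    move: h (sorted_server_free_times j); case: (f j) => //= x l h.
    rewrite path_sortedE; last exact: le_trans.
    by rewrite h => /andP[/allP hl _]; apply/allP => z /hl; exact: lt_le_trans.
  rewrite vV /= ltnn add0n => h2.
  have := count_size (ltn v) (behead V); rewrite size_behead szV => h3.
  by move: (leq_trans h2 h3); rewrite leqNgt ltn_predL n0.
have startle : start_time n at_ pt j <= delta * (maxn tau v)%:R.
  rewrite /start_time ge_max; apply/andP; split.
    by apply: le_trans taur _; rewrite ler_pM2l // ler_nat leq_maxl.
  by apply: le_trans headf _; rewrite ler_pM2l // ler_nat leq_maxr.
have startt : start_time n at_ pt j <= delta * t%:R.
  by apply: le_trans startle _; rewrite ler_pM2l // ler_nat geq_max taut.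
case=> [|i] it; first by rewrite addn0.
rewrite addnS -addSn; apply: (IH sg (kw_step V tau y)) => //.
- split.
  + by apply: sort_sorted; exact: leq_total.
  + by rewrite /kw_step size_sort /= size_behead szV prednK.
  move=> z zt; rewrite count_server_free_times /kw_step count_sort /=.
  apply: leq_add.
    have [hdep|//] := boolP (delta * z%:R < _).
    rewrite lt0n; apply/eqP => /eqP; rewrite eqb0 -leqNgt => hz.
    move: hdep; apply/negP; rewrite -leNgt /departure_time.
    have := hpt 0%N isT; rewrite addn0 /= => -[hp|ty]; last first.
      by exfalso; move: zt; rewrite leqNgt => /negP; apply; lia.
    apply: le_trans (lerD startle hp) _.
    by rewrite -mulrDr -natrD ler_pM2l // ler_nat.
  have [zv|vz] := ltnP z v.
    have -> : count (ltn z) (behead V) = size (behead V).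
      apply/eqP; rewrite -all_count; move: sV; rewrite vV /=.
      rewrite path_sortedE; last exact: leq_trans.
      by case/andP => /allP h _; apply/allP => x /h; exact: leq_trans.
    apply: leq_trans (count_size _ _) _.
    by rewrite !size_behead szV size_server_free_times.
  have vz0 : (z < v)%N = false by apply/negbTE; rewrite -leqNgt.
  have hV2 : count (ltn z) V = count (ltn z) (behead V).
    by rewrite {1}vV /= vz0.
  have := dom z zt; rewrite count_behead hV2.
  by rewrite ltNge (le_trans headf) // ler_pM2l // ler_nat.
- by move=> k kT; have := hat k.+1 kT; rewrite addSnnS.
- by move=> k kT; have := hpt k.+1 kT; rewrite addSnnS.
Qed.

End FreeTimes.

Lemma head_nth_gt D (s : seq nat) :
  sorted leq s -> (count (fun x => x <= D)%N s < size s)%N ->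
  (D < nth 0%N s (count (fun x => x <= D)%N s))%N.
Proof.
elim: s => //= x s IH sx.
have [xD|Dx] := leqP x D; first by rewrite add1n ltnS; apply: IH; exact: path_sorted sx.
rewrite add0n => _.
have -> : count (fun x => x <= D)%N s = 0%N.
  apply/eqP; rewrite -leqn0 leqNgt -has_count; apply/hasPn => y ys.
  move: sx; rewrite path_sortedE; last exact: leq_trans.
  by case/andP => /allP/(_ _ ys) xy _; rewrite -ltnNge; exact: leq_trans xy.
by [].
Qed.

Lemma nth_epochs u l i : (i < size l)%N ->
  nth 0%N (epochs u l) i = (u + sumn (take i l))%N.
Proof.
elim: l u i => // x l IH u [|i] il /=; first by rewrite addn0.
by rewrite IH // addnA.
Qed.

Lemma nth_taus E k u l i : (i < size l)%N ->
  nth 0%N (taus E k u l) i = ((u + sumn (take i l) + (k + i)) %/ E).+1.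
Proof.
elim: l k u i => // x l IH k u [|i] il /=; first by rewrite !addn0.
by rewrite IH // [(u + (x + _))%N]addnA [(k.+1 + i)%N]addSnnS.
Qed.

Fact busy_start_ge0 (rs : seq nat) :
  all (fun r => 0 <= r) [seq delta * r%:R | r <- take n rs].
Proof. by rewrite all_map; apply/allP => r _ /=; rewrite mulr_ge0 // ltW. Qed.

Fact busy_start_size (rs : seq nat) :
  (size [seq (delta * r%:R)%R | r <- take n rs] <= n)%N.
Proof. by rewrite size_map size_take_min geq_minl. Qed.

(** [take n] makes the state well formed for every list; the lists of interest have n entries. The
    first outside arrival takes place at time 0. *)
Definition busy_start (rs : seq nat) : initial_condition R n :=
  @InitialCondition R n 0 [seq delta * r%:R | r <- take n rs] 0
    (lexx 0) (busy_start_ge0 rs) (busy_start_size rs)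
    (fun h => False_ind _ (Bool.diff_false_true h)).

Section Initial.
Variables (rs : seq nat) (a s : nat -> R).
Hypotheses (szrs : size rs = n).

Let at_ := arrival_time (busy_start rs) a.
Let pt := processing_time (busy_start rs) s.
Let f := server_free_times n at_ pt.

Let szsv : size (residual_services (busy_start rs)) = n.
Proof. by rewrite /= size_map take_oversize ?szrs. Qed.

Lemma busy_start_arrival k : at_ (n + k) = \sum_(i < k) a i.
Proof.
rewrite /at_ /arrival_time szsv /= addn0 ltnNge leq_addr /= add0r.
by rewrite addKn.
Qed.

Lemma busy_start_arrival0 j : (j < n)%N -> at_ j = 0.
Proof. by move=> jn; rewrite /at_ /arrival_time szsv /= addn0 jn. Qed.

Lemma busy_start_processing k : pt (n + k) = s k.
Proof. by rewrite /pt /processing_time szsv ltnNge leq_addr /= addKn. Qed.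

Lemma busy_start_processing0 j : (j < n)%N -> pt j = delta * (nth 0%N rs j)%:R.
Proof.
move=> jn; rewrite /pt /processing_time szsv jn /=.
by rewrite (nth_map 0%N) ?take_oversize ?szrs.
Qed.

(** While fewer than n jobs are assigned, some free time is still 0, so each initial job starts at
    once on a server of its own. *)
Lemma busy_start_free j : (j <= n)%N ->
  perm_eq (f j) ([seq delta * r%:R | r <- take j rs] ++ nseq (n - j) 0) /\
  ((j < n)%N -> start_time n at_ pt j = 0).
Proof.
have ge0 k : all (fun x => 0 <= x) [seq delta * r%:R | r <- take k rs].
  by rewrite all_map; apply/allP => r _ /=; rewrite mulr_ge0 // ltW.
have hd k : (k < n)%N ->
    perm_eq (f k) ([seq delta * r%:R | r <- take k rs] ++ nseq (n - k) 0) ->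
    head 0 (f k) = 0.
  move=> kn pk; have z : 0 \in f k.
    by rewrite (perm_mem pk) mem_cat mem_nseq subn_gt0 kn eqxx orbT.
  have : all (fun x => 0 <= x) (f k).
    rewrite (perm_all _ pk) all_cat ge0 /=; apply/allP => x.
    by rewrite mem_nseq => /andP[_ /eqP ->].
  move: (sorted_server_free_times at_ pt k) z; rewrite -/f; case: (f k) => //= x l.
  rewrite path_sortedE; last exact: le_trans.
  case/andP => /allP xl _; rewrite inE => /orP[/eqP <- //|/xl x0 /andP[x0' _]].
  by apply/eqP; rewrite eq_le x0.
have st k : (k < n)%N -> head 0 (f k) = 0 -> start_time n at_ pt k = 0.
  by move=> kn h; rewrite /start_time -/(f k) h busy_start_arrival0 // maxxx.
elim: j => [|j IH] jn.
  have p0 : perm_eq (f 0) ([seq delta * r%:R | r <- take 0 rs] ++ nseq (n - 0) 0).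
    by rewrite take0 /= subn0.
  by split=> // h; apply: st => //; exact: hd.
have [pj _] := IH (ltnW jn).
have hj := hd j jn pj.
have pS : perm_eq (f j.+1) ([seq delta * r%:R | r <- take j.+1 rs] ++ nseq (n - j.+1) 0).
  rewrite /f /= perm_sort -/(f j) hj busy_start_arrival0 // maxxx add0r.
  rewrite busy_start_processing0 // (take_nth 0%N) ?szrs // map_rcons cat_rcons.
  rewrite perm_cons_middle -(perm_cons_middle 0).
  have -> : 0 :: behead (f j) = f j.
    move: hj (size_server_free_times at_ pt j); rewrite -/f.
    by case: (f j) => [_ s0|x l /= -> //]; move: n0; rewrite -s0.
  by move: pj; rewrite -subnSK.
by split=> // h; apply: st => //; exact: hd.
Qed.

Lemma busy_start_dominates :
  slot_dominates at_ pt (sort leq rs) n.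
Proof.
split.
- by apply: sort_sorted; exact: leq_total.
- by rewrite size_sort.
move=> z _; have [pf _] := busy_start_free (leqnn n).
rewrite count_sort -/f (permP pf) subnn cats0 count_map take_oversize ?szrs //.
by apply: sub_count => r /=; rewrite ltr_pM2l // ltr_nat.
Qed.

Variables (E m0 : nat) (al sg : seq nat).
Hypotheses (E0 : (0 < E)%N) (a_ge0 : forall i, 0 <= a i) (szal : (size al <= size sg)%N).
Hypothesis a_al : forall i, (i < size al)%N ->
  delta / E%:R * (nth 0%N al i)%:R <= a i /\
  (a i <= delta / E%:R * (nth 0%N al i).+1%:R \/ (E * t.+1 <= nth 0%N al i)%N).
Hypothesis s_sg : forall i, (i < size sg)%N ->
  s i <= delta * (nth 0%N sg i).+1%:R \/ (t <= nth 0%N sg i)%N.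

Let eta := delta / E%:R.
Let eta0 : 0 < eta. Proof. by rewrite divr_gt0 // ltr0n. Qed.

Lemma sum_al_le k : (k <= size al)%N ->
  eta * (sumn (take k al))%:R <= \sum_(i < k) a i.
Proof.
elim: k => [|k IH] kl; first by rewrite take0 big_ord0 mulr0.
rewrite (take_nth 0%N) // sumn_rcons natrD mulrDr big_ord_recr /=.
by apply: lerD; [exact: IH (ltnW kl)|case: (a_al kl)].
Qed.

Lemma sum_al_ge k : (k <= size al)%N ->
  \sum_(i < k) a i <= eta * (sumn (take k al) + k)%:R \/
  (E * t.+1 <= sumn (take k al))%N.
Proof.
elim: k => [|k IH] kl; first by left; rewrite take0 big_ord0 mulr0.
rewrite (take_nth 0%N) // sumn_rcons big_ord_recr /=.
have [_ [h|h]] := a_al kl; last by right; apply: leq_trans h (leq_addl _ _).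
case: (IH (ltnW kl)) => h2; last by right; apply: leq_trans h2 (leq_addr _ _).
left; apply: le_trans (lerD h2 h) _; rewrite -/eta -mulrDr -natrD.
by rewrite ler_pM2l // ler_nat; lia.
Qed.

(** With N arrivals by slot t and J = N - m0, jobs before n + J have started, so at most n of them
    are in service; jobs from n + N on have not arrived; at most m0 jobs lie between. *)
Lemma number_in_system_le : ~~ overload E t m0 rs al sg ->
  (number_in_system (busy_start rs) a s (delta * t%:R) <= (n + m0)%:R%:E)%E.
Proof.
rewrite negb_or negbK => /andP[arr_lt nl].
set N := arrived E t al in arr_lt nl.
set J := (N - m0)%N in nl.
set Ts := take J (taus E 0 0 al) in nl.
have JN : (J <= N)%N by rewrite leq_subr.
have szTs : size Ts = J.
  by rewrite size_takel // size_taus; apply: leq_trans JN (ltnW arr_lt).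
have Jal : (J < size al)%N by exact: leq_ltn_trans arr_lt.
have t0 : 0 <= delta * t%:R :> R by rewrite mulr_ge0 // ltW.
have hstart i : (i < n + J)%N -> start_time n at_ pt i <= delta * t%:R.
  have [iN _|Ni iJ] := ltnP i n.
    by have [_ ->] := busy_start_free (ltnW iN).
  rewrite -(subnKC Ni); apply: (starts_on_time busy_start_dominates _ _ _ nl).
  - move=> k; rewrite szTs => kJ; rewrite busy_start_arrival.
    have kal : (k < size al)%N by exact: ltn_trans Jal.
    rewrite nth_take // nth_taus // !add0n.
    case: (sum_al_ge (ltnW kal)) => h; [left|right].
      apply: le_trans h _; rewrite /eta mulrAC -mulrA ler_pM2l //.
      rewrite ler_pdivrMr ?ltr0n // -natrM ler_nat ltnW //.
      exact: ltn_ceil.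
    apply: leq_trans (_ : t.+1.+1 <= _)%N => //; rewrite ltnS.
    rewrite leq_divRL // mulnC; apply: leq_trans h _; exact: leq_addr.
  - move=> k; rewrite szTs => kJ; rewrite busy_start_processing; apply: s_sg.
    by apply: leq_trans szal; exact: ltn_trans Jal.
  - by rewrite szTs; apply: leq_trans szal; exact: ltnW.
  - by rewrite szTs ltn_subLR.
have hlate k : (N <= k)%N -> delta * t%:R < at_ (n + k).
  move=> Nk; rewrite busy_start_arrival.
  apply: lt_le_trans (_ : \sum_(i < N) a i <= _); last first.
    rewrite -(subnKC Nk) big_split_ord /= lerDl; apply: sumr_ge0 => i _.
    exact: a_ge0.
  apply: lt_le_trans (sum_al_le (ltnW arr_lt)).
  have := head_nth_gt (sorted_epochs 0 al); rewrite size_epochs.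
  move=> /(_ _ arr_lt); rewrite -/N nth_epochs // add0n => h.
  rewrite /eta mulrAC -mulrA ltr_pM2l // ltr_pdivlMr ?ltr0n //.
  by rewrite -natrM ltr_nat mulnC.
pose L := [seq j <- iota 0 (n + J) | delta * t%:R < departure_time n at_ pt j]
   ++ iota (n + J) (N - J).
have szL : (size L <= n + m0)%N.
  rewrite size_cat size_iota size_filter -count_in_service //.
  apply: leq_add; last by rewrite /J; lia.
  by apply: leq_trans (count_size _ _) _; rewrite size_server_free_times.
rewrite /number_in_system -/at_ -/pt.
set A := [set j | _].
have AL : A `<=` [set` L].
  move=> j /andP[hat hdep] /=; rewrite mem_cat mem_filter mem_iota hdep /= add0n.
  have [//|h] := ltnP j (n + J).
  rewrite mem_iota h /=.
  rewrite -addnA subnKC //; rewrite ltnNge; apply/negP => h2.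
  have nj : (n <= j)%N by apply: leq_trans h2; exact: leq_addr.
  move: hat; apply/negP; rewrite -ltNge -(subnKC nj); apply: hlate.
  by rewrite leq_subRL.
have Afin : finite_set A by apply: sub_finite_set AL _; exact: finite_seq.
rewrite /counting ifT; last exact/asboolP.
rewrite lee_fin ler_nat; apply: leq_trans szL.
apply: leq_trans (_ : #|` [fset x in L]%fset| <= _)%N.
  apply: fsubset_leq_card; apply/fsubsetP => j.
  rewrite in_fset_set // => /set_mem jA; rewrite in_fset.
  exact: AL.
by rewrite card_fseq size_undup.
Qed.

End Initial.
End RealTime.

(** * Discretized random variables *)

Lemma set_boolE (T : Type) (b : bool) : [set _ : T | b] = if b then setT else set0.
Proof. by case: b; apply/seteqP; split. Qed.

Section Discretization.
Variables (R : realType) (d : measure_display) (T : measurableType d)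
  (P : probability T R) (X : {RV P >-> R}) (f : R -> nat) (H : nat).
Hypotheses (mf : forall k, measurable (f @^-1` [set k]))
  (fH : forall x, (f x < H)%N).

Definition dlaw : fdist R nat :=
  [seq (k, fine (P (X @^-1` (f @^-1` [set k])))) | k <- iota 0 H].

Let A k := X @^-1` (f @^-1` [set k]).

Let mA k : measurable (A k).
Proof. by rewrite -[A k]setTI; exact: measurable_funPT. Qed.

Let gE (g : nat -> R) w :
  g (f (X w)) = \sum_(k <- iota 0 H) g k * \1_(A k) w.
Proof.
rewrite (bigD1_seq (f (X w))) ?iota_uniq ?mem_iota //=.
rewrite indicE mem_set // mulr1 big1 ?addr0 // => k kf.
by rewrite indicE memNset ?mulr0 // => /= h; rewrite h eqxx in kf.
Qed.

Lemma measurable_disc (g : nat -> R) : measurable_fun setT (fun w => g (f (X w))).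
Proof.
rewrite (_ : (fun w => _) = fun w => \sum_(k <- iota 0 H) g k * \1_(A k) w).
  apply: measurable_sum => k; exact: measurable_funM.
by apply/funext => w; exact: gE.
Qed.

Lemma fexp_dlaw (g : nat -> R) : (forall k, 0 <= g k) ->
  (fexp dlaw g)%:E = (\int[P]_w (g (f (X w)))%:E)%E.
Proof.
move=> g0.
under eq_integral => w _ do rewrite gE -sumEFin.
rewrite ge0_integral_sum //; last first.
- by move=> k w _; rewrite lee_fin mulr_ge0.
- move=> k; apply/measurable_EFinP; exact: measurable_funM.
rewrite /fexp /dlaw big_map -sumEFin; apply: eq_bigr => k _ /=.
under eq_integral => w _ do rewrite EFinM.
rewrite ge0_integralZl_EFin //; last first.
  by apply/measurable_EFinP; exact: measurable_indic (mA k).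
have -> : (\int[P]_x (\1_(A k) x)%:E = P (A k))%E.
  by rewrite integral_indic; [rewrite setIT|exact: measurableT|exact: mA].
rewrite -[P (A k)]fineK; last by apply: fin_num_measure; exact: mA.
by rewrite -EFinM mulrC.
Qed.

Lemma fprob_dlaw : fprob dlaw.
Proof.
split.
  by rewrite /fpos all_map; apply/allP => k _ /=; exact: fine_ge0.
apply: EFin_inj; rewrite (@fexp_dlaw (fun=> 1)) => [|_]; last exact: ler01.
by have := expectation_cst P (1 : R); rewrite unlock.
Qed.

Lemma dlaw_lt : all (fun x => x.1 < H)%N dlaw.
Proof. by rewrite all_map; apply/allP => k /=; rewrite mem_iota. Qed.

Lemma fexp_dlaw_le (g : nat -> R) (h : T -> R) (c : R) :
  (forall k, 0 <= g k) -> measurable_fun setT h ->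
  (forall w, g (f (X w)) <= h w) ->
  (\int[P]_w (h w)%:E <= c%:E)%E -> fexp dlaw g <= c.
Proof.
move=> g0 mh gh hc; rewrite -lee_fin fexp_dlaw //; apply: le_trans hc.
apply: ge0_le_integral => //.
- by move=> w _; rewrite lee_fin.
- by apply/measurable_EFinP; exact: measurable_disc.
- by apply/measurable_EFinP.
- by move=> w _; rewrite lee_fin.
Qed.

Lemma fexp_dlaw_ge (g : nat -> R) (h : T -> R) (c : R) :
  (forall k, 0 <= g k) -> measurable_fun setT h -> (forall w, 0 <= h w) ->
  (forall w, h w <= g (f (X w))) ->
  (c%:E <= \int[P]_w (h w)%:E)%E -> c <= fexp dlaw g.
Proof.
move=> g0 mh h0 gh hc; rewrite -lee_fin fexp_dlaw //; apply: le_trans hc _.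
apply: ge0_le_integral => //.
- by move=> w _; rewrite lee_fin.
- by apply/measurable_EFinP.
- by apply/measurable_EFinP; exact: measurable_disc.
- by move=> w _; rewrite lee_fin.
Qed.

End Discretization.

(** * Joint law of independent rounded variables *)

Section IndependentDiscretizations.
Variables (R : realType) (d : measure_display) (T : measurableType d)
  (P : probability T R) (I : choiceType) (X : I -> {RV P >-> R})
  (f : I -> R -> nat) (H : I -> nat).
Hypotheses (indep : mutually_independent X)
  (mf : forall i k, measurable (f i @^-1` [set k]))
  (fH : forall i x, (f i x < H i)%N).

Let Z i w := f i (X i w).

Let mZ i k : measurable [set w | Z i w = k].
Proof.
rewrite (_ : [set w | _] = X i @^-1` (f i @^-1` [set k])) //.
by rewrite -[X in measurable X]setTI; exact: measurable_funPT.
Qed.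

Lemma measurable_disc_seq (s : seq I) (F : seq nat -> bool) :
  measurable [set w | F [seq Z i w | i <- s]].
Proof.
elim: s F => [|i s IH] F.
  by rewrite /= set_boolE; case: ifP => _; [exact: measurableT|exact: measurable0].
rewrite (_ : [set w | _] = \bigcup_k ([set w | Z i w = k] `&`
    [set w | F (k :: [seq Z i w | i <- s])])).
  apply: bigcup_measurable => k _; apply: measurableI => //.
  exact: (IH (fun l => F (k :: l))).
apply/seteqP; split => [w /= h|w [k _ [/= <-]]] //.
by exists (Z i w).
Qed.

Lemma measurable_all_eq (c : seq I) (kap : I -> nat) :
  measurable [set w | all (fun i => Z i w == kap i) c].
Proof.
rewrite (_ : [set w | _] = [set w | all (fun x => x.1 == x.2)
   (zip [seq Z i w | i <- c] (map kap c))]).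
  exact: (measurable_disc_seq c (fun l => all (fun x => x.1 == x.2) (zip l (map kap c)))).
by apply/funext => w /=; congr is_true; elim: c => //= i c ->.
Qed.

Lemma probability_all_eq (c : seq I) (kap : I -> nat) : uniq c ->
  P [set w | all (fun i => Z i w == kap i) c] =
  (\prod_(i <- c) fine (P [set w | Z i w = kap i]))%:E.
Proof.
move=> uc.
have -> : [set w | all (fun i => Z i w == kap i) c] =
    \bigcap_(i in [set` [fset i in c]%fset]) (X i @^-1` (f i @^-1` [set kap i])).
  apply/seteqP; split => w /=.
    by move=> /allP h i /=; rewrite !inE => /h /eqP.
  move=> h; apply/allP => i ic; apply/eqP.
  by apply: h => /=; rewrite !inE.
rewrite indep // -prodEFin.
rewrite (perm_big c) /=; last first.
  by apply: uniq_perm => //= i; rewrite !inE.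
by apply: eq_bigr => i _; rewrite fineK // fin_num_measure.
Qed.

(** The coordinates in [c] are already fixed. Splitting the event according to the value of the next
    one moves it from [s] to [c], so independence is applied to cylinders only. *)
Lemma probability_disc_seq_gen (s c : seq I) (kap : I -> nat) (F : seq nat -> bool) :
  uniq (c ++ s) ->
  P ([set w | all (fun i => Z i w == kap i) c] `&` [set w | F [seq Z i w | i <- s]]) =
  ((\prod_(i <- c) fine (P [set w | Z i w = kap i])) *
   fexp (fprod [seq dlaw (X i) (f i) (H i) | i <- s]) (fun l => ind R (F l)))%:E.
Proof.
elim: s c kap F => [|i s IH] c kap F.
  rewrite cats0 /= set_boolE => uc; rewrite fexp_ret; case: (F [::]).
    by rewrite /ind mulr1 setIT probability_all_eq.
  by rewrite /ind mulr0 setI0 measure0.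
move=> ucs.
have ics : i \notin c by move: ucs; rewrite cat_uniq /= negb_or => /and3P[_ /andP[]].
have ucs' : uniq ((i :: c) ++ s) by rewrite -[_ ++ s]/([:: i] ++ c ++ s) uniq_catCA.
have nij j : j \in c -> (j == i) = false.
  by move=> jc; apply/negbTE; apply: contraNneq ics => <-.
pose kp k j := if j == i then k else kap j.
have kpc k w : all (fun j => Z j w == kp k j) c = all (fun j => Z j w == kap j) c.
  by apply: eq_in_all => j jc; rewrite /kp (nij j jc).
pose G k := [set w | all (fun j => Z j w == kp k j) (i :: c)] `&`
   [set w | F (k :: [seq Z j w | j <- s])].
rewrite (_ : _ `&` _ = \big[setU/set0]_(k < H i) G k); last first.
  apply/seteqP; split => w.
    case=> /= h1 h2; rewrite -bigcup_mkord; exists (Z i w) => /=; first exact: fH.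
    by split => //=; rewrite {1}/kp eqxx eqxx /= kpc.
  rewrite -bigcup_mkord => -[k _ [/= /andP[/eqP hk hc] hF]].
  rewrite /kp eqxx in hk; split; first by rewrite /= -(kpc k).
  by rewrite /= hk.
rewrite measure_bigsetU; last first.
- apply/trivIsetP => k k' _ _ kk'; apply/seteqP; split => // w [[/= + _] [/= + _]].
  rewrite /kp eqxx => /andP[/eqP -> _] /andP[/eqP h _].
  by move: kk'; rewrite h eqxx.
- move=> k; apply: measurableI; first exact: measurable_all_eq.
  exact: (measurable_disc_seq s (fun l => F (k :: l))).
have -> : fexp (fprod [seq dlaw (X j) (f j) (H j) | j <- i :: s]) (fun l => ind R (F l)) =
    \sum_(k <- iota 0 (H i)) fine (P [set w | Z i w = k]) *
      fexp (fprod [seq dlaw (X j) (f j) (H j) | j <- s]) (fun l => ind R (F (k :: l))).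
  by rewrite [map _ _]/= fexp_prod_cons {1}/fexp big_map.
rewrite mulr_sumr -sumEFin.
rewrite -(big_mkord xpredT (fun k => P (G k))) /index_iota subn0.
apply: eq_bigr => k _; rewrite /G.
have /= -> := IH (i :: c) (kp k) (fun l => F (k :: l)) ucs'.
rewrite big_cons {1}/kp eqxx -mulrA mulrCA; congr ((_ * _)%:E); rewrite big_seq [RHS]big_seq; apply: eq_bigr => j jc.
by rewrite /kp (nij j jc).
Qed.

Lemma probability_disc_seq (s : seq I) (F : seq nat -> bool) : uniq s ->
  P [set w | F [seq Z i w | i <- s]] =
  (fexp (fprod [seq dlaw (X i) (f i) (H i) | i <- s]) (fun l => ind R (F l)))%:E.
Proof.
move=> us; have := @probability_disc_seq_gen s [::] (fun=> 0%N) F us.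
by rewrite big_nil mul1r /= set_boolE setTI.
Qed.

End IndependentDiscretizations.

Lemma fexp_iid_cat (R : realType) (pA pS : fdist R nat) J K
  (Phi : seq nat -> seq nat -> R) :
  fexp (fprod (nseq J pA ++ nseq K pS)) (fun l => Phi (take J l) (drop J l)) =
  fexp (iid pA J) (fun al => fexp (iid pS K) (Phi al)).
Proof.
elim: J Phi => [|J IH] Phi.
  by rewrite fexp_ret; apply: eq_fexp => l; rewrite take0 drop0.
rewrite [nseq _ _ ++ _]/= fexp_prod_cons fexp_iidS; apply: eq_fexp => x.
exact: (IH (fun al => Phi (x :: al))).
Qed.

Lemma map_cstE (T U : Type) (g : T -> U) (s : seq T) (y : U) :
  (forall x, g x = y) -> map g s = nseq (size s) y.
Proof. by move=> gy; elim: s => //= x s ->; rewrite gy. Qed.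

Section Primitives.
Variables (R : realType)
    (dA dS d : measure_display) (TA : measurableType dA)
    (TS : measurableType dS) (T : measurableType d)
    (PA : probability TA R) (PS : probability TS R) (P : probability T R)
    (A : {RV PA >-> R}) (S : {RV PS >-> R})
    (arr srv : nat -> {RV P >-> R}).
Hypothesis prim : iid_primitives A S arr srv.
Variables (fA fS : R -> nat) (HA HS : nat).
Hypotheses (mfA : forall k, measurable (fA @^-1` [set k]))
  (mfS : forall k, measurable (fS @^-1` [set k]))
  (fHA : forall x, (fA x < HA)%N) (fHS : forall x, (fS x < HS)%N).

Lemma probability_primitives J K (Phi : seq nat -> seq nat -> bool) :
  let D := [set w | Phi (mkseq (fun i => fA (arr i w)) J)
                        (mkseq (fun i => fS (srv i w)) K)] in
  measurable D /\
  P D = (fexp (iid (dlaw A fA HA) J) (fun al => fexp (iid (dlaw S fS HS) K)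
      (fun sg => ind R (Phi al sg))))%:E.
Proof.
move=> D; case: prim => lA lS ind_.
pose f (i : nat + nat) := if i is inl _ then fA else fS.
pose Hi (i : nat + nat) := if i is inl _ then HA else HS.
pose X (i : nat + nat) := match i with inl i => arr i | inr j => srv j end.
have mf i k : measurable (f i @^-1` [set k]) by case: i.
have fH i x : (f i x < Hi i)%N by case: i.
pose s := [seq inl i | i <- iota 0 J] ++ [seq inr i | i <- iota 0 K] : seq (nat + nat).
have us : uniq s.
  rewrite cat_uniq !map_inj_uniq ?iota_uniq ?andbT /=; try by move=> ? ? [].
  by apply/hasPn => x /mapP[i _ ->]; apply/negP => /mapP[].
have DE : D = [set w | (fun l => Phi (take J l) (drop J l)) [seq f i (X i w) | i <- s]].
  apply/seteqP; split => w; rewrite /D /= /s map_cat -!map_comp;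
  by rewrite take_size_cat ?drop_size_cat ?size_map ?size_iota.
split; first by rewrite DE; exact: (@measurable_disc_seq _ _ _ P _ X f mf s (fun l => Phi (take J l) (drop J l))).
rewrite DE (@probability_disc_seq _ _ _ P _ X f Hi ind_ mf fH s
  (fun l => Phi (take J l) (drop J l)) us); congr (_%:E).
rewrite -(fexp_iid_cat _ _ J K (fun al sg => ind R (Phi al sg))).
congr (fexp (fprod _) _); rewrite /s map_cat -!map_comp; congr (_ ++ _).
  rewrite (@map_cstE _ _ _ _ (dlaw A fA HA)) ?size_iota // => i /=.
  rewrite /dlaw; apply: eq_map => k; congr (_, fine _).
  exact: lA.
rewrite (@map_cstE _ _ _ _ (dlaw S fS HS)) ?size_iota // => i /=.
rewrite /dlaw; apply: eq_map => k; congr (_, fine _).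
exact: lS.
Qed.

End Primitives.

(** * Measurability of the queue length *)

Section QueueMeasurability.
Variables (R : realType) (d : measure_display) (T : measurableType d).
Variables (n : nat) (n0 : (0 < n)%N).

Lemma measurable_fun_nat_bool (b : T -> bool) : measurable_fun setT b ->
  measurable_fun setT (fun w => (b w)%:R : R).
Proof.
move=> mb; rewrite (_ : (fun w => _) = fun w => if b w then 1 else 0 : R).
  exact: measurable_fun_ifT.
by apply/funext => w; case: (b w).
Qed.

Lemma measurable_set_of_bool (b : T -> bool) :
  measurable_fun setT b -> measurable [set w | b w].
Proof.
move=> mb; rewrite (_ : [set w | b w] = setT `&` b @^-1` [set true]); first exact: mb.
by rewrite setTI.
Qed.

Section FreeTimes.
Variables at_ pt : T -> nat -> R.
Hypotheses (mat : forall j, measurable_fun setT (fun w => at_ w j))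
  (mpt : forall j, measurable_fun setT (fun w => pt w j)).

Let f w j := server_free_times n (at_ w) (pt w) j.

(** Sorted lists are reached through their counting functions: the head exceeds z when no entry is
    at most z, and in the recursion for the counts only the contribution of the head is replaced. *)
Lemma measurable_free_times j :
  (forall z, measurable_fun setT (fun w => (count (fun x => x <= z) (f w j))%:R : R)) /\
  measurable_fun setT (fun w => head 0 (f w j)).
Proof.
have hd i : (forall z, measurable_fun setT (fun w => (count (fun x => x <= z) (f w i))%:R : R)) ->
    measurable_fun setT (fun w => head 0 (f w i)).
  move=> h mD; apply: (measurability _ (RGenOInfty.measurableE R)) => //.
  move=> /= _ [_ [z ->] <-]; rewrite setTI.
  rewrite (_ : _ @^-1` _ = [set w | (count (fun x => x <= z) (f w i))%:R <= (0 : R)]).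
    by apply: measurable_set_of_bool; apply: measurable_fun_ler => //; exact: h.
  apply/seteqP; split => w /=; rewrite in_itv /= andbT.
    move=> hz; rewrite (_ : count _ _ = 0%N) //; apply/eqP.
    rewrite -leqn0 leqNgt -has_count; apply/hasPn => x.
    move: (sorted_server_free_times n (at_ w) (pt w) i) hz; rewrite -/(f w i).
    case: (f w i) => //= y l; rewrite path_sortedE; last exact: le_trans.
    case/andP => /allP yl _ zy; rewrite inE => /orP[/eqP ->|/yl xy]; rewrite -ltNge //.
    exact: lt_le_trans xy.
  rewrite (ler_nat _ _ 0) leqn0 => /eqP; rewrite -[RHS]/(0%N).
  move: (size_server_free_times n0 (at_ w) (pt w) i); rewrite -/(f w i).
  case: (f w i) => [s0|y l _ /=]; first by move: n0; rewrite -s0.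
  by rewrite ltNge; case: (y <= z).
elim: j => [|j [IH1 IH2]].
  have m0 z : measurable_fun setT (fun w => (count (fun x => x <= z) (f w 0))%:R : R).
    exact: measurable_cst.
  by split => //; apply: hd.
have mS z : measurable_fun setT (fun w => (count (fun x => x <= z) (f w j.+1))%:R : R).
  rewrite (_ : (fun w => _) = fun w => (departure_time n (at_ w) (pt w) j <= z)%R%:R +
     ((count (fun x => x <= z) (f w j))%:R - (head 0 (f w j) <= z)%R%:R)).
    apply: measurable_funD.
      apply: measurable_fun_nat_bool; apply: measurable_fun_ler => //.
      rewrite /departure_time /start_time; apply: measurable_funD => //.
      exact: measurable_maxr.
    by apply: measurable_funB => //; apply: measurable_fun_nat_bool; exact: measurable_fun_ler.
  apply/funext => w; rewrite /f count_server_free_times natrD; congr (_ + _).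
  by rewrite (count_behead n0) natrD addrC addKr.
by split => //; apply: hd.
Qed.

Lemma measurable_departure_time j :
  measurable_fun setT (fun w => departure_time n (at_ w) (pt w) j).
Proof.
rewrite /departure_time /start_time; apply: measurable_funD => //.
by apply: measurable_maxr => //; case: (measurable_free_times j).
Qed.

End FreeTimes.

(** Exceeding x is witnessed by finitely many jobs, even when infinitely many are present; the event
    becomes a countable intersection of finite conditions. *)
Lemma counting_le_count (b : pred nat) (x : R) :
  (counting [set j | b j] <= x%:E)%E <->
  (forall N, (count b (iota 0 N))%:R <= x).
Proof.
split.
  rewrite /counting; case: ifPn => [/asboolP fin|_]; last by rewrite leye_eq.
  rewrite lee_fin => h N; apply: le_trans h; rewrite ler_nat -size_filter.
  apply: uniq_leq_size; first by rewrite filter_uniq // iota_uniq.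
  by move=> j; rewrite mem_filter => /andP[bj _]; rewrite in_fset_set // inE.
move=> h; rewrite leNgt; apply/negP => hx.
have [B BA Bx] : exists2 B : {fset nat}, [set` B] `<=` [set j | b j] & x < (#|` B|%fset)%:R.
  move: hx; rewrite /counting; case: ifPn => [/asboolP fin|/asboolPn inf _].
    by rewrite lte_fin => hx; exists (fset_set [set j | b j]) => //; rewrite fset_setK.
  have [B BA hB] := infinite_set_fset (Num.truncn x).+1 inf.
  exists B => //; apply: lt_le_trans (_ : (Num.truncn x).+1%:R <= _).
    exact: truncnS_gt.
  by rewrite ler_nat.
pose N := (\max_(i <- enum_fset B) i).+1.
have := h N; apply/negP; rewrite -ltNge; apply: lt_le_trans Bx _.
rewrite ler_nat -size_filter; apply: uniq_leq_size; first exact: fset_uniq.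
move=> j jB; rewrite mem_filter; apply/andP; split; first exact: (BA j).
by rewrite mem_iota ltnS; apply: (@leq_bigmax_seq _ _ predT id j).
Qed.

Variables (P : probability T R) (arr srv : nat -> {RV P >-> R}).

Lemma measurable_queue_le (B alpha : R) (c : initial_condition R n) (t x : R) :
  measurable [set w | (queue_process arr srv B alpha c t w <= x%:E)%E].
Proof.
pose at_ w := arrival_time c (fun i => arr i w / arrival_rate n B alpha).
pose pt w := processing_time c (fun i => srv i w).
have mat j : measurable_fun setT (fun w => at_ w j).
  rewrite /at_ /arrival_time /=; case: (j < _)%N; first exact: measurable_cst.
  apply: measurable_funD => //; apply: measurable_sum => i.
  exact: measurable_funM.
have mpt j : measurable_fun setT (fun w => pt w j).
  by rewrite /pt /processing_time /=; case: (j < _)%N.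
have mdep j := measurable_departure_time mat mpt j.
pose b w j := at_ w j <= t < departure_time n (at_ w) (pt w) j.
rewrite (_ : [set w | _] = \bigcap_N [set w | (count (b w) (iota 0 N))%:R <= x]).
  apply: bigcap_measurableType => N _; apply: measurable_set_of_bool.
  apply: measurable_fun_ler => //.
  rewrite (_ : (fun w => _) = fun w => \sum_(j <- iota 0 N) (b w j)%:R); last first.
    apply/funext => w; rewrite -sum1_count natr_sum big_mkcond.
    by apply: eq_bigr => j _; case: (b w j).
  apply: measurable_sum => j; apply: measurable_fun_nat_bool; apply: measurable_and.
    exact: measurable_fun_ler.
  exact: measurable_fun_ltr.
apply/seteqP; split => w /=; rewrite /queue_process /number_in_system.
  by move=> /(counting_le_count (b w)) h N _; exact: h.
by move=> h; apply/(counting_le_count (b w)) => N; exact: h.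
Qed.

End QueueMeasurability.

(** * Moments of the discretized processing and inter-arrival times *)

Section Grid.
Variable R : realType.

Definition grid (s : R) (H : nat) (x : R) : nat := minn (Num.truncn (x * s)) H.-1.

(** Level sets of a monotone function are intervals. *)
Lemma measurable_grid s H k : 0 <= s -> measurable (grid s H @^-1` [set k]).
Proof.
move=> s0; have mono x y : x <= y -> (grid s H x <= grid s H y)%N.
  move=> xy; have h := le_truncn (ler_wpM2r s0 xy).
  by rewrite leq_min !geq_min leqnn h orbT.
apply: is_interval_measurable => x y /= hx hy z /andP[xz zy].
by apply/eqP; rewrite eqn_leq -{1}hy mono //= -hx mono.
Qed.

Lemma grid_lt s H x : (0 < H)%N -> (grid s H x < H)%N.
Proof. by move=> H0; rewrite /grid gtn_min ltn_predL H0 orbT. Qed.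

Lemma grid_le s H x : 0 <= x * s -> (grid s H x)%:R <= x * s.
Proof.
move=> h; apply: le_trans (_ : (Num.truncn (x * s))%:R <= _).
  by rewrite ler_nat geq_minl.
by rewrite truncn_le.
Qed.

Lemma grid_gt s H x : x * s < (grid s H x).+1%:R \/ (H.-1 <= grid s H x)%N.
Proof.
rewrite /grid; case: (leqP (Num.truncn (x * s)) H.-1) => h; last by right.
by left; exact: truncnS_gt.
Qed.

End Grid.

Section RealIntegral.
Variables (R : realType) (d : measure_display) (T : measurableType d)
  (P : probability T R).

Lemma ge0_integral_realD (f g : T -> R) :
  measurable_fun setT f -> measurable_fun setT g ->
  (forall w, 0 <= f w) -> (forall w, 0 <= g w) ->
  (\int[P]_w (f w + g w)%:E = \int[P]_w (f w)%:E + \int[P]_w (g w)%:E)%E.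
Proof.
move=> mf mg f0 g0; under eq_integral => w _ do rewrite EFinD.
by apply: ge0_integralD => //; first [exact/measurable_EFinP|move=> w _; rewrite lee_fin].
Qed.

Lemma ge0_integral_realZ (a : R) (f : T -> R) : 0 <= a ->
  measurable_fun setT f -> (forall w, 0 <= f w) ->
  (\int[P]_w (a * f w)%:E = a%:E * \int[P]_w (f w)%:E)%E.
Proof.
move=> a0 mf f0; under eq_integral => w _ do rewrite EFinM.
by apply: ge0_integralZl_EFin => //; first [exact/measurable_EFinP|move=> w _; rewrite lee_fin].
Qed.

Lemma integral_real_cst (a : R) : (\int[P]_(w in setT) a%:E = a%:E)%E.
Proof. by have := expectation_cst P a; rewrite unlock. Qed.

End RealIntegral.

(** * Processing times with a moment of order 1 + eps *)

Section Service.
Variables (R : realType) (d : measure_display) (T : measurableType d)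
  (P : probability T R) (S : {RV P >-> R}) (eps : R).
Hypotheses (S_ge0 : forall w, 0 <= S w) (ES : ('E_P[S] = 1)%E)
  (eps_gt0 : 0 < eps) (eps_le1 : eps <= 1)
  (ES1eps : ('E_P[(fun w => (S w `^ (1 + eps))%R)] < +oo)%E).

Let s1 (w : T) : R := S w `^ (1 + eps).
Let Cs : R := fine (\int[P]_w (s1 w)%:E)%E.
Let g0 : R := 2 `^ (- eps).
Let beta : R := Num.max g0 (4 / 5).

Let ms1 : measurable_fun setT s1.
Proof. exact: (measurableT_comp (measurable_powR _)). Qed.

Let s1_ge0 w : 0 <= s1 w. Proof. exact: powR_ge0. Qed.

Let CsE : (\int[P]_w (s1 w)%:E)%E = Cs%:E.
Proof.
rewrite /Cs fineK // ge0_fin_numE; last first.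
  by apply: integral_ge0 => w _; rewrite lee_fin.
by move: ES1eps; rewrite unlock.
Qed.

Let Cs_ge0 : 0 <= Cs.
Proof. by apply: fine_ge0; apply: integral_ge0 => w _; rewrite lee_fin. Qed.

Let intS : (\int[P]_w (S w)%:E)%E = 1%:E.
Proof. by move: ES; rewrite unlock. Qed.

Let g0_gt0 : 0 < g0. Proof. exact: powR_gt0. Qed.

Let g0_lt1 : g0 < 1.
Proof.
rewrite /g0 powRN invf_lt1 ?powR_gt0 //.
have h : (1 : R) `^ eps < 2 `^ eps.
  by apply: gt0_ltr_powR; rewrite ?nnegrE ?ler01 ?ler0n ?ltr1n.
by move: h; rewrite powR1.
Qed.

Let powk k : (2 ^+ k) `^ (- eps) = g0 ^+ k :> R.
Proof.
have e1 : 2 ^+ k = 2 `^ k%:R :> R by rewrite powR_mulrn // ler0n.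
have e2 : g0 ^+ k = g0 `^ k%:R by rewrite powR_mulrn // ltW.
by rewrite e1 e2 /g0 -!powRrM mulrC.
Qed.

(** Where S >= 2^k, a factor S^(-eps) <= 2^(-k eps) can be split off. *)
Let s1_lower k w : 2 ^+ k <= S w -> S w <= s1 w * g0 ^+ k.
Proof.
move=> h; have u0 : 0 < 2 ^+ k :> R by rewrite exprn_gt0.
have s0 : 0 < S w by exact: lt_le_trans h.
rewrite /s1 powRD; last by rewrite (gt_eqF s0) implybT.
rewrite powRr1 // -mulrA ler_peMr // -powk.
apply: le_trans (_ : S w `^ eps * S w `^ (- eps) <= _).
  by rewrite powRN mulfV // gt_eqF // powR_gt0.
rewrite ler_pM2l ?powR_gt0 // !powRN lef_pV2 ?posrE ?powR_gt0 //.
by rewrite ge0_ler_powR ?nnegrE // ?ltW.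
Qed.

(** Split the exponent 2 as (1 + eps) + (1 - eps) and use one bound on the minimum for each part. *)
Let s1_sqr k w : Num.min (S w) (2 ^+ k) ^+ 2 <= s1 w * (2 * g0) ^+ k.
Proof.
have u0 : 0 < 2 ^+ k :> R by rewrite exprn_gt0.
have e1 : 0 <= 1 - eps by rewrite subr_ge0.
have -> : (2 * g0) ^+ k = (2 ^+ k) `^ (1 - eps).
  rewrite powRD; last by rewrite (gt_eqF u0) implybT.
  by rewrite powRr1 ?powk ?exprMn // ltW.
set m := Num.min _ _.
have m0 : 0 <= m by rewrite le_min S_ge0 ltW.
have mS : m <= S w by rewrite /m ge_min lexx.
have mu : m <= 2 ^+ k by rewrite /m ge_min lexx orbT.
have e2 : 0 <= 1 + eps by rewrite addr_ge0 // ltW.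
have -> : m ^+ 2 = m `^ (1 + eps) * m `^ (1 - eps).
  rewrite -powRD; last by rewrite (_ : 1 + eps + (1 - eps) = 2) ?pnatr_eq0 //; ring.
  by rewrite (_ : 1 + eps + (1 - eps) = 2%:R) ?powR_mulrn //; ring.
apply: ler_pM; rewrite ?powR_ge0 //.
  by apply: ge0_ler_powR; rewrite ?nnegrE.
by apply: ge0_ler_powR; rewrite ?nnegrE // ltW.
Qed.

(** At level 2^k the excess and the truncated square are controlled by E[S^(1+eps)] times 2^(-k eps)
    and 2^(k (1 - eps)); enlarging 2^(-eps) to 4 / 5 if necessary gives the [beta] of the chaining.
    The constants depend neither on the slot length 1 / M nor on the truncation level H. *)
Lemma service_moments : exists C beta (L : nat),
  [/\ 0 < C, 4 / 5 <= beta, beta < 1 &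
  forall (M H : nat), (0 < M)%N -> (L * M < H)%N ->
   let p := dlaw S (grid M%:R H) H in
   [/\ forall k, excess_mean p (L * 2 ^ k * M) <= C * beta ^+ k * M%:R,
       forall k, trunc_sqr p (L * 2 ^ k * M) <= C * (2 * beta) ^+ k * M%:R ^+ 2,
       forall k, M%:R / 2 <= trunc_mean p (L * 2 ^ k * M) &
       mean_service p <= M%:R + 1]].
Proof.
have g0b : g0 <= beta by rewrite le_max lexx.
have b45 : 4 / 5 <= beta by rewrite le_max lexx orbT.
have b1 : beta < 1 by rewrite gt_max g0_lt1 /=; lra.
have b0 : 0 < beta by lra.
(* Cutting S at L = 2^k0 loses at most half of its mean, so the truncated mean is at least 1 / 2. *)
have [k0 hk0] : exists k0, Cs * g0 ^+ k0 <= 1 / 2.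
  have := @cvg_expr R g0; rewrite ger0_norm ?(ltW g0_gt0) // => /(_ g0_lt1).
  have e0 : 0 < 1 / 2 / (Cs + 1) by rewrite divr_gt0 // ltr_wpDl.
  move=> /cvgr0_norm_lt /(_ _ e0) [k0 _ /(_ k0 (leqnn k0))] /=.
  rewrite ger0_norm ?exprn_ge0 ?(ltW g0_gt0) // ltr_pdivlMr ?ltr_wpDl // => h.
  exists k0; apply: le_trans (ltW h); rewrite mulrC ler_wpM2l ?exprn_ge0 ?(ltW g0_gt0) //.
  by rewrite lerDl.
pose L := (2 ^ k0)%N; have Lr : L%:R = 2 ^+ k0 :> R by rewrite natrX.
have L0 : 0 < L%:R :> R by rewrite Lr exprn_gt0.
have L1 : 1 <= L%:R :> R by rewrite ler1n expn_gt0.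
(* From (v + 1)^2 <= 2 v^2 + 2, v being the rounded and truncated time. *)
pose C := 2 * (L%:R * Cs + 1).
have LCs : 0 <= L%:R * Cs by rewrite mulr_ge0.
exists C, beta, L; split => //; first by rewrite /C; lra.
move=> M H M0 LMH p.
have H0 : (0 < H)%N by exact: leq_trans LMH.
have Mr0 : 0 < M%:R :> R by rewrite ltr0n.
have M1 : 1 <= M%:R :> R by rewrite ler1n.
have mf k : measurable (@grid R M%:R H @^-1` [set k]) by apply: measurable_grid.
have fH (x : R) : (grid M%:R H x < H)%N by exact: grid_lt.
have gle w : (grid M%:R H (S w))%:R <= S w * M%:R by apply: grid_le; rewrite mulr_ge0 // ltW.
have uk k : (L * 2 ^ k * M)%:R = 2 ^+ (k0 + k) * M%:R :> R.
  by rewrite !natrM Lr natrX exprD.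
have powle k : g0 ^+ (k0 + k) <= beta ^+ k.
  rewrite exprD; apply: le_trans (_ : 1 * beta ^+ k <= _); last by rewrite mul1r.
  apply: ler_pM; rewrite ?exprn_ge0 ?(ltW g0_gt0) //.
    by rewrite exprn_ile1 // ltW.
  by apply: lerXn2r; rewrite ?nnegrE // ltW.
have scaled (a : R) : 0 <= a -> (\int[P]_w (a * s1 w)%:E)%E = (a * Cs)%:E.
  by move=> a0; rewrite ge0_integral_realZ // CsE.
split.
- move=> k; apply: (fexp_dlaw_le mf fH (g := fun y => (y - L * 2 ^ k * M)%N%:R)
    (h := fun w => M%:R * beta ^+ k * s1 w)) => //.
  + by apply: measurable_funM.
  + move=> w; set y := grid _ _ _.
    have [yc|yc] := leqP y (L * 2 ^ k * M).
      rewrite (_ : (y - _)%N = 0%N); last by apply/eqP; rewrite subn_eq0.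
      by rewrite !mulr_ge0 ?exprn_ge0 // ltW.
    have uS : 2 ^+ (k0 + k) <= S w.
      rewrite -(ler_pM2r Mr0) -uk; apply: le_trans (gle w).
      by rewrite ler_nat ltnW.
    apply: le_trans (_ : S w * M%:R <= _).
      by apply: le_trans (gle w); rewrite ler_nat leq_subr.
    rewrite mulrC -mulrA ler_pM2l //; apply: le_trans (s1_lower uS) _.
    by rewrite mulrC ler_wpM2r.
  rewrite scaled ?mulr_ge0 ?exprn_ge0 ?(ltW b0) // lee_fin.
  rewrite mulrC -[leRHS]mulrA [beta ^+ k * _]mulrC; apply: ler_wpM2r.
    by rewrite mulr_ge0 ?exprn_ge0 // ltW.
  have : 1 * Cs <= L%:R * Cs by rewrite ler_wpM2r.
  by rewrite mul1r /C; lra.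
- move=> k; pose u : R := 2 ^+ (k0 + k).
  pose K : R := 2 * (2 * beta) ^+ k * M%:R ^+ 2.
  have K0 : 0 <= K by rewrite !mulr_ge0 ?exprn_ge0 ?mulr_ge0 // ltW.
  apply: (fexp_dlaw_le mf fH (g := fun y => (minn y (L * 2 ^ k * M)%N).+1%:R ^+ 2)
    (h := fun w => K + K * L%:R * s1 w)) => //.
  + by apply: measurable_funD => //; apply: measurable_funM.
  + move=> w; set y := grid _ _ _.
    have mle : (minn y (L * 2 ^ k * M))%:R <= Num.min (S w) u * M%:R :> R.
      have [h|h] := leP (S w) u.
        by apply: le_trans (gle w); rewrite ler_nat geq_minl.
      by rewrite /u -uk ler_nat geq_minr.
    have msq : (minn y (L * 2 ^ k * M))%:R ^+ 2 <= s1 w * (2 * g0) ^+ (k0 + k) * M%:R ^+ 2.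
      apply: le_trans (_ : (Num.min (S w) u * M%:R) ^+ 2 <= _).
        by apply: lerXn2r; rewrite ?nnegrE // mulr_ge0 // le_min S_ge0 exprn_ge0.
      by rewrite exprMn ler_pM2r ?exprn_gt0 //; exact: s1_sqr.
    have e2 : (2 * g0) ^+ (k0 + k) <= L%:R * (2 * beta) ^+ k.
      have -> : (2 * g0) ^+ (k0 + k) = L%:R * 2 ^+ k * g0 ^+ (k0 + k).
        by rewrite exprMn {1}exprD Lr.
      have -> : L%:R * (2 * beta) ^+ k = L%:R * 2 ^+ k * beta ^+ k.
        by rewrite exprMn mulrA.
      by rewrite ler_pM2l ?powle // mulr_gt0 ?exprn_gt0.
    have e3 : 1 <= (2 * beta) ^+ k * M%:R ^+ 2.
      by rewrite mulr_ege1 // exprn_ege1 //; lra.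
    have e4 : s1 w * (2 * g0) ^+ (k0 + k) * M%:R ^+ 2 <=
       L%:R * s1 w * ((2 * beta) ^+ k * M%:R ^+ 2).
      rewrite mulrA ler_pM2r ?exprn_gt0 // [L%:R * _]mulrC -mulrA.
      by apply: ler_wpM2l.
    have -> : K + K * L%:R * s1 w = 2 * ((2 * beta) ^+ k * M%:R ^+ 2) +
        2 * (L%:R * s1 w * ((2 * beta) ^+ k * M%:R ^+ 2)) by rewrite /K; ring.
    move: (le_trans msq e4) e3; rewrite -[(minn y _).+1%:R]natr1.
    move: ((minn y (L * 2 ^ k * M)%N)%:R) (L%:R * s1 w * _) => v W hv hQ.
    have := sqr_ge0 (v - 1); rewrite sqrrB sqrrD.
    by move: ((2 * beta) ^+ k * M%:R ^+ 2) hQ => Q hQ; lra.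
  rewrite ge0_integral_realD //; last 2 first.
  + exact: measurable_funM.
  + by move=> w; apply: mulr_ge0 => //; exact: mulr_ge0.
  rewrite scaled; last exact: mulr_ge0.
  rewrite integral_real_cst.
  rewrite -EFinD lee_fin /C /K le_eqVlt; apply/orP; left; apply/eqP; ring.
- move=> k; apply: (fexp_dlaw_ge mf fH (g := fun y => (minn y (L * 2 ^ k * M)%N).+1%:R)
    (h := fun w => M%:R * Num.min (S w) L%:R)) => //.
  + by apply: measurable_funM => //; exact: measurable_minr.
  + by move=> w; rewrite mulr_ge0 // le_min S_ge0 ltW.
  + move=> w; set y := grid _ _ _.
    have h1 : M%:R * Num.min (S w) L%:R <= M%:R * S w by rewrite ler_pM2l // ge_min lexx.
    have h2 : M%:R * Num.min (S w) L%:R <= (L * M)%:R.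
      by rewrite natrM mulrC ler_pM2r // ge_min lexx orbT.
    have h3 : (L * M <= L * 2 ^ k * M)%N.
      by rewrite leq_mul2r leq_pmulr ?orbT // expn_gt0.
    rewrite /minn; case: ifP => _.
      have [h|h] := grid_gt M%:R H (S w).
        by apply: le_trans h1 _; rewrite mulrC ltW.
      by apply: le_trans h2 _; rewrite ler_nat; apply: leqW; apply: leq_trans h; rewrite -ltnS prednK.
    by apply: le_trans h2 _; rewrite ler_nat leqW.
  have mmin : measurable_fun setT (fun w => Num.min (S w) L%:R) by exact: measurable_minr.
  have hmin : (1%:E <= \int[P]_w (Num.min (S w) L%:R)%:E + (1 / 2)%:E)%E.
    rewrite -intS; apply: le_trans (_ : \int[P]_w (Num.min (S w) L%:R + g0 ^+ k0 * s1 w)%:E <= _)%E.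
      apply: ge0_le_integral => //.
      * by move=> w _; rewrite lee_fin.
      * by apply/measurable_EFinP.
      * by apply/measurable_EFinP; apply: measurable_funD => //; apply: measurable_funM.
      move=> w _; rewrite lee_fin; case: (leP (S w) L%:R) => h.
        by rewrite lerDl mulr_ge0 // exprn_ge0 // ltW.
      have := @s1_lower k0 w; rewrite -Lr => /(_ (ltW h)) h2.
      by rewrite mulrC; apply: le_trans h2 _; rewrite lerDr ltW.
    rewrite ge0_integral_realD //; last 3 first.
    * exact: measurable_funM.
    * by move=> w; rewrite le_min S_ge0 ltW.
    * by move=> w; rewrite mulr_ge0 // exprn_ge0 // ltW.
    rewrite scaled ?exprn_ge0 ?(ltW g0_gt0) // leeD2l // lee_fin mulrC.
    exact: hk0.
  rewrite ge0_integral_realZ //; last by move=> w; rewrite le_min S_ge0 ltW.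
  move: hmin; case: (integral _ _ _) => [r| |].
  + by rewrite -EFinD -EFinM !lee_fin => h; rewrite ler_pM2l //; lra.
  + by move=> _; rewrite gt0_muley ?lte_fin // leey.
  + by rewrite addNye leeNy_eq.
- apply: (fexp_dlaw_le mf fH (g := fun y => y.+1%:R)
    (h := fun w => M%:R * S w + 1)) => //.
  + by apply: measurable_funD => //; apply: measurable_funM.
  + by move=> w; rewrite -natr1 lerD2r mulrC.
  rewrite ge0_integral_realD //; last 2 first.
  + exact: measurable_funM.
  + by move=> w; rewrite mulr_ge0.
  by rewrite ge0_integral_realZ // intS mule1 integral_real_cst.
Qed.

End Service.

(** * Comparison of residual laws at different truncation levels *)

Section ResidualDomination.
Variables (R : realType) (d : measure_display) (T : measurableType d)
  (P : probability T R) (S : {RV P >-> R}) (s : R).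
Hypothesis s0 : 0 <= s.

Let p H := dlaw S (grid s H) H.

Let tail_eq r H H' : (r < H)%N -> (H <= H')%N ->
  fexp (p H) (fun y => ind R (r <= y)%N) = fexp (p H') (fun y => ind R (r <= y)%N).
Proof.
move=> rH HH; have H0 : (0 < H)%N by exact: leq_ltn_trans rH.
have H0' : (0 < H')%N by exact: leq_trans HH.
have mf K k : measurable (@grid R s K @^-1` [set k]) by exact: measurable_grid.
apply: EFin_inj; rewrite !fexp_dlaw //; try by [move=> k; exact: ind_ge0|move=> x; exact: grid_lt].
apply: eq_integral => w _; rewrite /grid !leq_min.
have -> : (r <= H.-1)%N by rewrite -ltnS prednK.
by have -> : (r <= H'.-1)%N by rewrite -ltnS prednK // (leq_trans rH).
Qed.

(* The residual law of the truncated processing times is almost maximal once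
   their mean is almost its supremum. *)
Lemma residual_law_dominated (mmax : R) (Hmin n : nat) : (0 < n)%N ->
  (forall H, (Hmin < H)%N -> mean_service (p H) <= mmax) ->
  exists2 H0, (Hmin < H0)%N & forall H, (H0 <= H)%N ->
    forall f, (forall x, 0 <= f x) ->
    fexp (residual_law (p H0) H0) f <= (1 + n%:R^-1) * fexp (residual_law (p H) H) f.
Proof.
move=> n0 hm; pose E := [set mean_service (p H) | H in [set H | (Hmin < H)%N]].
have E_sup : has_sup E.
  split; first by exists (mean_service (p Hmin.+1)), Hmin.+1 => //=.
  by exists mmax => _ [H /= hH <-]; exact: hm.
have mf K k : measurable (@grid R s K @^-1` [set k]) by exact: measurable_grid.
have pp H : (0 < H)%N -> fprob (p H).
  by move=> H0; apply: fprob_dlaw => // x; exact: grid_lt.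
have m1 H : (0 < H)%N -> 1 <= mean_service (p H).
  by move=> H0; apply: mean_service_ge1; exact: pp.
have sup1 : 1 <= sup E.
  apply: le_trans (m1 Hmin.+1 isT) _; apply: ub_le_sup; first by case: E_sup.
  by exists Hmin.+1 => //=.
have nr0 : 0 < n%:R :> R by rewrite ltr0n.
set k := 1 + n%:R^-1; have k1 : 1 < k by rewrite ltrDl invr_gt0.
have k0 : 0 < k by lra.
have e0 : 0 < sup E - sup E / k.
  by rewrite subr_gt0 ltr_pdivrMr // ltr_pMr //; lra.
(* At r < H0 the residual weights of two levels differ only by the normalizing mean, so it suffices
   that the mean at H0 is within the factor [k] of the supremum. *)
have [_ [H0 /= hH0 <-] hsup] := sup_adherent e0 E_sup.
exists H0 => // H HH f f0.
have H00 : (0 < H0)%N by exact: leq_ltn_trans hH0.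
have H0' : (0 < H)%N by exact: leq_trans HH.
have mH : mean_service (p H) <= k * mean_service (p H0).
  apply: le_trans (_ : sup E <= _).
    by apply: ub_le_sup; [case: E_sup|exists H => //=; exact: leq_trans HH].
  by move: hsup; rewrite opprB addrCA subrr addr0 ltr_pdivrMr // mulrC => /ltW.
rewrite /fexp /residual_law !big_map /=.
rewrite -(subnKC HH) iotaD big_cat /= mulrDr subnKC //.
rewrite -[leLHS]addr0; apply: lerD; last first.
  rewrite mulr_ge0 ?(ltW k0) //; apply: sumr_ge0 => r _.
  rewrite mulr_ge0 // divr_ge0 //; last by apply: le_trans (m1 H H0').
  by apply: fexp_ge0 => [|y]; [case: (pp H H0')|exact: ind_ge0].
rewrite mulr_sumr big_seq [leRHS]big_seq; apply: ler_sum => r.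
rewrite mem_iota add0n => /andP[_ rH].
rewrite mulrA; apply: ler_wpM2r => //.
rewrite (tail_eq rH HH) mulrCA; apply: ler_wpM2l.
  by apply: fexp_ge0 => [|y]; [case: (pp H H0')|exact: ind_ge0].
rewrite ler_pdivlMr; last by apply: lt_le_trans (m1 H H0').
rewrite mulrC ler_pdivrMr //; apply: lt_le_trans (m1 H0 H00).
exact: ltr01.
Qed.

End ResidualDomination.

(** * Inter-arrival times with a second moment *)

Section ArrivalMoments.
Variables (R : realType) (d : measure_display) (T : measurableType d)
  (P : probability T R) (A : {RV P >-> R}).
Hypotheses (A_ge0 : forall w, 0 <= A w) (EA : ('E_P[A] = 1)%E)
  (EA2 : ('E_P[(fun w => (A w ^+ 2)%R)] < +oo)%E).

(** For the lower bound on the mean, the part of rho A above [cap] is at most (rho A)^2 / cap, and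
    rounding down loses at most 1. *)
Lemma arrival_moments : exists2 CA : R, 1 <= CA &
  forall (rho : R) (cap : nat), 0 < rho -> (0 < cap)%N ->
  let p := dlaw A (grid rho cap.+1) cap.+1 in
  [/\ fexp p (fun x => x%:R) <= rho,
      fexp p (fun x => x%:R ^+ 2) <= rho ^+ 2 * CA &
      rho - rho ^+ 2 * CA / cap%:R - 1 <= fexp p (fun x => x%:R)].
Proof.
have mA2 : measurable_fun setT (fun w => A w ^+ 2) by exact: measurable_funX.
have A20 w : 0 <= A w ^+ 2 by exact: sqr_ge0.
have i1 : (\int[P]_w (A w)%:E)%E = 1%:E by move: EA; rewrite unlock.
pose c2 := fine (\int[P]_w (A w ^+ 2)%:E)%E.
have i20 : (0 <= \int[P]_w (A w ^+ 2)%:E)%E by apply: integral_ge0 => w _; rewrite lee_fin.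
have i2 : (\int[P]_w (A w ^+ 2)%:E)%E = c2%:E.
  by rewrite /c2 fineK // ge0_fin_numE //; move: EA2; rewrite unlock.
have c20 : 0 <= c2 by exact: fine_ge0.
exists (1 + c2); first by rewrite lerDl.
move=> rho cap rho0 cap0 p.
have mf k : measurable (@grid R rho cap.+1 @^-1` [set k]) by apply: measurable_grid; exact: ltW.
have fH (x : R) : (grid rho cap.+1 x < cap.+1)%N by exact: grid_lt.
have pp : fprob p by exact: fprob_dlaw.
have capr : 0 < cap%:R :> R by rewrite ltr0n.
have gle w : (grid rho cap.+1 (A w))%:R <= rho * A w.
  by rewrite mulrC; apply: grid_le; rewrite mulr_ge0 // ltW.
have rho2 : 0 <= rho ^+ 2 by exact: sqr_ge0.
split.
- apply: (fexp_dlaw_le mf fH (g := fun x => x%:R) (h := fun w => rho * A w)) => //.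
  + exact: measurable_funM.
  by rewrite ge0_integral_realZ ?i1 ?mule1 // ltW.
- apply: (fexp_dlaw_le mf fH (g := fun x => x%:R ^+ 2) (h := fun w => rho ^+ 2 * A w ^+ 2)) => //.
  + exact: measurable_funM.
  + move=> w; rewrite -exprMn; apply: lerXn2r; rewrite ?nnegrE //.
    by rewrite mulr_ge0 // ltW.
  rewrite ge0_integral_realZ // i2 -EFinM lee_fin ler_wpM2l //.
  by rewrite lerDr.
have mmin : measurable_fun setT (fun w => Num.min (rho * A w) cap%:R).
  by apply: measurable_minr => //; exact: measurable_funM.
have min0 w : 0 <= Num.min (rho * A w) cap%:R by rewrite le_min mulr_ge0 ?(ltW rho0) // ltW.
rewrite lerBlDr -[X in _ <= _ + X](fexp_cst _ pp) -fexpD.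
apply: (fexp_dlaw_ge mf fH (g := fun x => x%:R + 1) (h := fun w => Num.min (rho * A w) cap%:R)) => //.
- move=> w; have h1 : Num.min (rho * A w) cap%:R <= rho * A w by rewrite ge_min lexx.
  have h2 : Num.min (rho * A w) cap%:R <= cap%:R by rewrite ge_min lexx orbT.
  rewrite natr1; have [h|h] := grid_gt rho cap.+1 (A w).
    by apply: le_trans h1 _; rewrite mulrC ltW.
  by apply: le_trans h2 _; rewrite ler_nat leqW.
have hmin : (rho%:E <= \int[P]_w (Num.min (rho * A w) cap%:R)%:E + (rho ^+ 2 / cap%:R * c2)%:E)%E.
  apply: le_trans (_ : \int[P]_w (Num.min (rho * A w) cap%:R + rho ^+ 2 / cap%:R * A w ^+ 2)%:E <= _)%E.
    rewrite -[rho%:E]mule1 -i1 -ge0_integral_realZ ?(ltW rho0) //.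
    apply: ge0_le_integral => //.
    * by move=> w _; rewrite lee_fin mulr_ge0 // ltW.
    * by apply/measurable_EFinP; exact: measurable_funM.
    * by apply/measurable_EFinP; apply: measurable_funD => //; exact: measurable_funM.
    move=> w _; rewrite lee_fin; case: (leP (rho * A w) cap%:R) => h.
      by rewrite lerDl mulr_ge0 // divr_ge0 // ltW.
    have -> : rho ^+ 2 / cap%:R * A w ^+ 2 = rho * A w * (rho * A w) / cap%:R by ring.
    have : rho * A w <= rho * A w * (rho * A w) / cap%:R.
      by rewrite ler_pdivlMr // ler_wpM2l ?mulr_ge0 // ltW.
    by move: capr; lra.
  rewrite ge0_integral_realD //; last 2 first.
  + exact: measurable_funM.
  + by move=> w; rewrite mulr_ge0 // divr_ge0 // ltW.
  by rewrite ge0_integral_realZ // ?i2 -?EFinM // divr_ge0 // ltW.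
apply: le_trans (_ : (rho - rho ^+ 2 / cap%:R * c2)%:E <= _)%E.
  have -> : rho ^+ 2 * (1 + c2) / cap%:R = rho ^+ 2 / cap%:R * (1 + c2) by ring.
  rewrite lee_fin lerD2l lerN2 ler_wpM2l ?lerDr ?ler01 //.
  by rewrite divr_ge0 // ltW.
move: hmin; case: (integral _ _ _) => [r| |].
- by rewrite -EFinD !lee_fin; lra.
- by move=> _; rewrite leey.
- by rewrite addNye leeNy_eq.
Qed.

End ArrivalMoments.

(** * From the slotted queue to the steady state *)

Section ContinuityPoints.
Variable R : realType.

(** A monotone function has countably many discontinuities, whereas ]a, b[ has positive Lebesgue
    measure. *)
Lemma nondecreasing_continuity_point (F : R -> R) (a b : R) :
  nondecreasing_fun F -> a < b ->
  exists2 x, a < x < b & {for x, continuous F}.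
Proof.
move=> ndF ab.
have nd : {in `[a, b] &, nondecreasing_fun F} by move=> x y _ _; exact: ndF.
have [x [xab xD]] : exists x, (x \in `]a, b[) /\ ~ discontinuity F x.
  apply: contrapT => h.
  have sub : `]a, b[%classic `<=` [set x | (x \in `]a, b[) /\ discontinuity F x].
    move=> x /= xab; split => //; apply: contrapT => xD; apply: h; exists x.
    by split.
  have c := sub_countable (subset_card_le sub) (discontinuity_countable nd).
  have := countable_lebesgue_measure0 c.
  rewrite lebesgue_measure_itv /= lte_fin ab => /eqP.
  by rewrite -EFinB eqe subr_eq0 gt_eqF.
exists x; first by move: xab; rewrite in_itv.
move: (xab); rewrite in_itv /= => /andP[ax xb].
have cl : cvg (F y @[y --> x^'-]).
  apply: nondecreasing_at_left_is_cvgr; near=> y; first by move=> ? ? _ _; exact: ndF.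
  by exists (F x) => _ [z /= + <-]; rewrite in_itv /= => /andP[_ /ltW]; exact: ndF.
have cr : cvg (F y @[y --> x^'+]).
  apply: nondecreasing_at_right_is_cvgr; near=> y; first by move=> ? ? _ _; exact: ndF.
  by exists (F x) => _ [z /= + <-]; rewrite in_itv /= => /andP[/ltW + _]; exact: ndF.
have e : lim (F y @[y --> x^'-]) = lim (F y @[y --> x^'+]).
  by apply/eqP; apply: contrapT => /negP ne; apply: xD; split.
have lF : lim (F y @[y --> x^'-]) <= F x.
  by apply: limr_le => //; near=> y; apply: ndF; near: y; exact: nbhs_left_le.
have Fr : F x <= lim (F y @[y --> x^'+]).
  by apply: limr_ge => //; near=> y; apply: ndF; near: y; exact: nbhs_right_ge.
have eF : lim (F y @[y --> x^'-]) = F x by apply/eqP; rewrite eq_le lF e Fr.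
apply/left_right_continuousP; split; first by rewrite -eF.
by rewrite -eF e.
Unshelve. all: by end_near. Qed.

Lemma cdf_continuity_point (mu : probability R R) (a b : R) : a < b ->
  exists2 x, a < x < b &
    {for x, continuous (fun y : R => mu `]-oo, y]%classic)}.
Proof.
move=> ab; pose F y := fine (mu `]-oo, y]%classic).
have fin y : mu `]-oo, y]%classic \is a fin_num by apply: fin_num_measure.
have ndF : nondecreasing_fun F.
  move=> x y xy; rewrite /F fine_le // le_measure ?inE //.
  exact: subitvPr.
have [x xab Fx] := nondecreasing_continuity_point ndF ab.
exists x => //.
have -> : (fun y => mu `]-oo, y]%classic) = EFin \o F.
  by apply/funext => y; rewrite /F /= fineK.
by apply: cvg_EFin; [exact: nearW|exact: Fx].
Qed.

End ContinuityPoints.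

(** * The queue started from a given busy state *)

Section QueueBound.
Variables (R : realType)
    (dA dS d : measure_display) (TA : measurableType dA)
    (TS : measurableType dS) (T : measurableType d)
    (PA : probability TA R) (PS : probability TS R) (P : probability T R)
    (A : {RV PA >-> R}) (S : {RV PS >-> R})
    (arr srv : nat -> {RV P >-> R}).
Hypotheses (prim : iid_primitives A S arr srv) (A_ge0 : forall w, 0 <= A w).

Let neg : set T := \bigcup_i (arr i @^-1` `]-oo, 0[%classic).

(** [arr i] only shares the law of [A], so its nonnegativity holds almost surely and need not hold
    everywhere. *)
Lemma arrivals_nonneg : measurable neg /\ P neg = 0%E.
Proof.
have mi i : measurable (arr i @^-1` `]-oo, 0[%classic).
  by rewrite -[X in measurable X]setTI; exact: measurable_funPT.
have mneg : measurable neg by exact: bigcupT_measurable.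
split=> //; apply/negligibleP => //; apply: negligible_bigcup => i.
apply/negligibleP => //; case: prim => /(_ i `]-oo, 0[%classic) + _ _.
rewrite /distribution /pushforward /= => -> //.
rewrite (_ : A @^-1` _ = set0) ?measure0 //.
by apply/seteqP; split => // w /=; rewrite in_itv /= ltNge A_ge0.
Qed.

Variables (B alpha : R) (n M E cap H t J m0 : nat) (rs : seq nat).
Hypotheses (n0 : (0 < n)%N) (M0 : (0 < M)%N) (E0 : (0 < E)%N)
  (lam_gt0 : 0 < arrival_rate n B alpha) (capE : (E * t.+1 <= cap)%N)
  (tH : (t < H)%N) (szrs : size rs = n).

Let lam := arrival_rate n B alpha.
Let rho := M%:R * E%:R / lam.

Fact slot_gt0 : 0 < M%:R^-1 :> R.
Proof. by rewrite invr_gt0 ltr0n. Qed.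

(** The conditions on [cap] and [H] put every truncated value beyond the horizon t; off the overload
    event and a null set the pathwise bound applies. *)
Lemma queue_bound :
  1 - fexp (iid (dlaw A (grid rho cap.+1) cap.+1) J) (fun al =>
        fexp (iid (dlaw S (grid M%:R H) H) J) (fun sg => ind R (overload E t m0 rs al sg)))
  <= fine (P [set w | (queue_process arr srv B alpha (busy_start n slot_gt0 rs)
        (M%:R^-1 * t%:R) w <= (n + m0)%:R%:E)%E]).
Proof.
have Mr0 : 0 < M%:R :> R by rewrite ltr0n.
have Er0 : 0 < E%:R :> R by rewrite ltr0n.
have rho0 : 0 < rho by rewrite divr_gt0 ?mulr_gt0.
have H0 : (0 < H)%N by exact: leq_ltn_trans tH.
have mfA k : measurable (@grid R rho cap.+1 @^-1` [set k]) by apply: measurable_grid; exact: ltW.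
have mfS k : measurable (@grid R M%:R H @^-1` [set k]) by exact: measurable_grid.
have fHA (x : R) : (grid rho cap.+1 x < cap.+1)%N by exact: grid_lt.
have fHS (x : R) : (grid M%:R H x < H)%N by exact: grid_lt.
have := probability_primitives prim mfA mfS fHA fHS J J (overload E t m0 rs).
set D := [set w | _] => -[mD PD].
set Q := [set w | _].
have mQ : measurable Q by exact: measurable_queue_le.
have [mneg Pneg] := arrivals_nonneg.
have cover : setT `<=` (Q `|` D) `|` neg.
  move=> w _; case: (pselect (neg w)) => [|nneg]; first by right.
  left; case: (boolP (overload E t m0 rs (mkseq (fun i => grid rho cap.+1 (arr i w)) J)
    (mkseq (fun i => grid M%:R H (srv i w)) J))) => hD; first by right.
  left; rewrite /Q /= /queue_process.
  have arr0 i : 0 <= arr i w.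
    by rewrite leNgt; apply/negP => h; apply: nneg; exists i => //=; rewrite in_itv.
  apply: (number_in_system_le n0 _ szrs E0 _ _ _ _ hD).
  - by move=> i; rewrite divr_ge0 // ltW.
  - by rewrite !size_mkseq.
  - move=> i; rewrite size_mkseq => iJ; rewrite nth_mkseq //.
    (* [arr i w * rho] is the real inter-arrival time [arr i w / lam] in units of 1 / (M E). *)
    have e : M%:R^-1 / E%:R * rho = lam^-1.
      by rewrite /rho; field; rewrite !gt_eqF.
    have k0 : 0 < M%:R^-1 / E%:R :> R by rewrite divr_gt0 ?invr_gt0.
    have ae : arr i w / lam = M%:R^-1 / E%:R * (arr i w * rho).
      by rewrite [arr i w * rho]mulrC mulrA e mulrC.
    rewrite -/lam ae; split.
      by rewrite ler_pM2l //; apply: grid_le; rewrite mulr_ge0 // ltW.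
    have [h|h] := grid_gt rho cap.+1 (arr i w); [left|right].
      by rewrite ler_pM2l // ltW.
    exact: leq_trans h.
  - move=> i; rewrite size_mkseq => iJ; rewrite nth_mkseq //.
    have [h|h] := grid_gt M%:R H (srv i w); [left|right].
      by rewrite mulrC ler_pdivlMr // ltW.
    by apply: leq_trans h; rewrite -ltnS prednK.
have : (1 <= P Q + P D)%E.
  rewrite -(probability_setT P).
  apply: le_trans (_ : P ((Q `|` D) `|` neg) <= _)%E.
    apply: le_measure => //; rewrite inE //.
    by apply: measurableU => //; exact: measurableU.
  apply: le_trans (_ : P (Q `|` D) + P neg <= _)%E.
    by apply: measureU2 => //; exact: measurableU.
  by rewrite Pneg adde0; apply: measureU2.
rewrite PD -[P Q]fineK ?fin_num_measure // -EFinD lee_fin => h.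
by rewrite lerBlDr.
Qed.

End QueueBound.

(** * Choice of the parameters *)

Section SteadyState.
Variable R : realType.

(** Taking the least admissible q gives the upper bound; slots of length 2^-q are thus of order 1 /
    sqrt n. *)
Lemma slot_exponent (B s : R) : 0 < B -> 1 <= s ->
  exists q, 8 * s <= B * 2 ^+ q /\ 2 ^+ q <= (1 + 16 / B) * s.
Proof.
move=> B0 s1.
have ex : exists q, 8 * s <= B * 2 ^+ q.
  exists (Num.truncn (8 * s / B)).+1; rewrite [B * _]mulrC -ler_pdivrMr //.
  apply: le_trans (ltW (truncnS_gt _)) _.
  by rewrite -natrX ler_nat; apply: ltnW; exact: ltn_expl.
pose q := ex_minn ex; exists q; rewrite /q; case: ex_minnP => {q} -[|q] hq qmin.
  split=> //; rewrite expr0; have : 0 <= 16 / B * s by rewrite mulr_ge0 ?divr_ge0 //; lra.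
  by lra.
split=> //; have : B * 2 ^+ q < 8 * s.
  by rewrite ltNge; apply/negP => /qmin; rewrite ltnn.
rewrite [B * _]mulrC -ltr_pdivlMr // => h; rewrite exprS.
have -> : (1 + 16 / B) * s = s + 2 * (8 * s / B) by field; rewrite gt_eqF.
by lra.
Qed.

Section AverageQueue.
Variables (dA dS d : measure_display) (TA : measurableType dA)
  (TS : measurableType dS) (T : measurableType d)
  (PA : probability TA R) (PS : probability TS R) (P : probability T R)
  (A : {RV PA >-> R}) (S : {RV PS >-> R})
  (arr srv : nat -> {RV P >-> R}) (B eps : R).
Hypotheses (A_ge0 : forall w, 0 <= A w) (S_ge0 : forall w, 0 <= S w)
  (EA : ('E_PA[A] = 1)%E) (ES : ('E_PS[S] = 1)%E)
  (EA2 : ('E_PA[(fun w => (A w ^+ 2)%R)] < +oo)%E)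
  (eps_gt0 : 0 < eps) (eps_le1 : eps <= 1)
  (ES1eps : ('E_PS[(fun w => (S w `^ (1 + eps))%R)] < +oo)%E)
  (prim : iid_primitives A S arr srv) (B_gt0 : 0 < B).

(** [M] and [pi0] are chosen before t, as the limit in time requires, while the resolution [E] and
    the truncation levels may depend on t. *)
Lemma average_queue (tol : R) : 0 < tol -> exists2 K : R, 0 < K &
  forall n : nat, 4 * B ^+ 2 < n%:R ->
  exists (M : nat) (M0 : (0 < M)%N) (pi0 : fdist R nat), fprob pi0 /\
  forall t, 1 - tol <= fexp (iid pi0 n) (fun rs =>
    fine (P [set w | (queue_process arr srv B 2 (busy_start n (slot_gt0 R M0) rs)
      (M%:R^-1 * t%:R) w <= (n + (Num.truncn (Num.sqrt n%:R * K)).+1)%:R%:E)%E])).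
Proof.
move=> tol0; have b := B_gt0.
have [C [beta [L [C0 beta45 beta1 hS]]]] := service_moments S_ge0 ES eps_gt0 eps_le1 ES1eps.
have [CA CA1 hA] := arrival_moments A_ge0 EA EA2.
pose CM := 1 + 16 / B.
have CM1 : 1 <= CM by rewrite lerDl divr_ge0 // ltW.
(* [c] fits m2 = rho^2 CA and m1 >= rho / 2. The mean number of arrivals per slot is at least lam /
   M, where lam >= s / 2 and M <= CM s, hence [b0]. *)
pose c := (4 * CA)^-1; pose b0 := (2 * CM)^-1.
have c0 : 0 < c by rewrite invr_gt0; lra.
have c1 : c <= 1 by rewrite invf_le1; lra.
have b00 : 0 < b0 by rewrite invr_gt0; lra.
have b01 : b0 <= 1 by rewrite invf_le1; lra.
have [K [K0 hK]] := @overload_unlikely R C beta B c b0 L C0 beta45 beta1 b c0 c1 b00 b01 tol tol0.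
exists K => // n nB.
pose s := Num.sqrt n%:R : R.
have s2 : s ^+ 2 = n%:R by rewrite sqr_sqrtr.
have nr0 : 0 < n%:R :> R by apply: lt_trans nB; rewrite mulr_gt0 // exprn_gt0.
have n0 : (0 < n)%N by move: nr0; rewrite ltr0n.
have s1 : 1 <= s.
  by rewrite -[1]sqrtr1 ler_wsqrtr // ler1n.
have sB : 2 * B < s.
  rewrite ltNge; apply/negP => h; have : s ^+ 2 <= 4 * B ^+ 2 by nra.
  by rewrite s2 leNgt nB.
have Bs : B * s < n%:R / 2 by rewrite -s2; nra.
have Bs0 : 0 < B * s by rewrite mulr_gt0 //; lra.
have lamE : arrival_rate n B 2 = n%:R - B * s.
  by rewrite /arrival_rate powR12_sqrt.
set lam := arrival_rate n B 2 in lamE.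
have lam0 : 0 < lam by lra.
have lamn : n%:R / 2 <= lam by lra.
have [q [q8 qC]] := slot_exponent b s1.
pose M := (2 ^ q)%N.
have M0 : (0 < M)%N by rewrite expn_gt0.
have MrE : M%:R = 2 ^+ q :> R by rewrite natrX.
have Mr0 : 0 < M%:R :> R by rewrite ltr0n.
have mS H : (L * M < H)%N -> mean_service (dlaw S (grid M%:R H) H) <= M%:R + 1.
  by move=> LH; have [] := hS M H M0 LH.
have [H0 LH0 dom] := residual_law_dominated (ltW Mr0) n0 mS.
have fpS H : (0 < H)%N -> fprob (dlaw S (grid M%:R H) H).
  move=> Hp; apply: fprob_dlaw; first by move=> k; apply: measurable_grid; exact: ltW.
  by move=> x; exact: grid_lt.
have H00 : (0 < H0)%N by exact: leq_ltn_trans LH0.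
pose pi0 := residual_law (dlaw S (grid M%:R H0) H0) H0.
have fpi0 : fprob pi0 by apply: fprob_residual_law; [exact: fpS|exact: dlaw_lt].
exists M, M0, pi0; split=> // t.
pose nu := n%:R - B / 2 * s.
have nu0 : 0 < nu by rewrite /nu; lra.
(* The relative amount by which discretization may shorten inter-arrival times, raising the rate
   from lam to nu = lam + B s / 2. One half of rho kap pays for the truncation at [cap], the other
   for rounding down by at most 1. *)
pose kap := 1 - lam / nu.
have kap1 : kap <= 1 / 2.
  rewrite /kap; suff : 1 / 2 <= lam / nu by lra.
  by rewrite ler_pdivlMr // /nu; lra.
have kap0 : 0 < kap.
  by rewrite subr_gt0 ltr_pdivrMr // mul1r /nu lamE; lra.
(* More jobs than arrive up to slot t, except with small probability. [E] is taken at least [J] so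
   that the index compensation in [taus] stays within one slot. *)
pose J := (Num.truncn (t.+1%:R * (n%:R / M%:R) + s * (K + B / 8 * (t.+1%:R / M%:R)))).+1.
pose E := (J + Num.truncn (2 / kap * lam / M%:R)).+1.
have E0 : (0 < E)%N by [].
have Er0 : 0 < E%:R :> R by rewrite ltr0n.
have JE : (J <= E)%N by rewrite /E leqW // leq_addr.
pose rho := M%:R * E%:R / lam.
have rho0 : 0 < rho by rewrite /rho divr_gt0 // mulr_gt0.
have rhok : 2 <= rho * kap.
  rewrite -ler_pdivrMr // /rho ler_pdivlMr // [X in _ <= X]mulrC -ler_pdivrMr //.
  apply: le_trans (ltW (truncnS_gt _)) _.
  by rewrite ler_nat ltnS leq_addl.
pose cap := maxn (E * t.+1) (Num.truncn (2 * CA * rho / kap)).+1.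
have cap0 : (0 < cap)%N by rewrite leq_max orbT.
have capr : 2 * CA * rho / kap <= cap%:R.
  apply: le_trans (ltW (truncnS_gt _)) _.
  by rewrite ler_nat leq_maxr.
have capE : (E * t.+1 <= cap)%N by rewrite leq_maxl.
(* H > t serves the horizon, H >= H0 the comparison of residual laws. *)
pose H := maxn H0 t.+1.
have H0H : (H0 <= H)%N by rewrite leq_maxl.
have tH : (t < H)%N by rewrite leq_maxr.
have LH : (L * M < H)%N by exact: leq_trans H0H.
have Hp : (0 < H)%N by exact: leq_ltn_trans tH.
have [hS1 hS2 hS3 hS4] := hS M H M0 LH.
have [hA1 hA2 hA3] := hA rho cap rho0 cap0.
set pA := dlaw A (grid rho cap.+1) cap.+1 in hA1 hA2 hA3.
set pS := dlaw S (grid M%:R H) H in hS1 hS2 hS3 hS4.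
set m1 := fexp pA (fun x => x%:R) in hA1 hA3.
have fpA : fprob pA.
  apply: fprob_dlaw; first by move=> k; apply: measurable_grid; exact: ltW.
  by move=> x; exact: grid_lt.
have capi : rho ^+ 2 * CA / cap%:R <= rho * kap / 2.
  have cr0 : 0 < cap%:R :> R by rewrite ltr0n.
  rewrite ler_pdivrMr //.
  have -> : rho ^+ 2 * CA = rho * kap / 2 * (2 * CA * rho / kap).
    by field; rewrite gt_eqF.
  by rewrite ler_pM2l // divr_gt0 //; exact: mulr_gt0.
have m1l : M%:R * E%:R / nu <= m1.
  have -> : M%:R * E%:R / nu = rho - rho * kap.
    by rewrite /kap /rho; field; rewrite !gt_eqF.
  by apply: le_trans hA3; lra.
have m1r : rho / 2 <= m1 by apply: le_trans hA3; nra.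
have m10 : 0 < m1 by apply: lt_le_trans m1r; lra.
have Em1 : E%:R / m1 <= nu / M%:R.
  rewrite ler_pdivrMr // mulrAC ler_pdivlMr // [E%:R * _]mulrC -ler_pdivrMl //.
  by rewrite [nu^-1 * _]mulrC.
have Em1b : b0 <= E%:R / m1.
  apply: le_trans (_ : lam / M%:R <= _).
    rewrite ler_pdivlMr // MrE.
    apply: le_trans (_ : b0 * (CM * s) <= _); first by rewrite ler_pM2l.
    have -> : b0 * (CM * s) = s / 2 by rewrite /b0; field; rewrite gt_eqF //; lra.
    by nra.
  rewrite ler_pdivlMr // mulrAC ler_pdivrMr // [lam * _]mulrC -ler_pdivlMr //.
  by rewrite [E%:R * _]mulrC.
have szE rs : size rs = size (nseq n pi0) -> 1 - fexp (iid pA J) (fun al =>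
      fexp (iid pS J) (fun sg => ind R (overload E t (Num.truncn (s * K)).+1 rs al sg))) <=
    fine (P [set w | (queue_process arr srv B 2 (busy_start n (slot_gt0 R M0) rs)
      (M%:R^-1 * t%:R) w <= (n + (Num.truncn (s * K)).+1)%:R%:E)%E]).
  by rewrite size_nseq => szrs; exact: queue_bound.
have fpall : all (@fpos R nat) (nseq n pi0) by rewrite all_nseq; case: fpi0 => ->; rewrite orbT.
refine (le_trans _ (fexp_prod_size szE fpall)).
have -> : fexp (fprod (nseq n pi0)) (fun rs => 1 - fexp (iid pA J) (fun al =>
      fexp (iid pS J) (fun sg => ind R (overload E t (Num.truncn (s * K)).+1 rs al sg)))) =
    1 - fexp (iid pi0 n) (fun rs => fexp (iid pA J) (fun al =>
      fexp (iid pS J) (fun sg => ind R (overload E t (Num.truncn (s * K)).+1 rs al sg)))).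
  rewrite -[X in X - _](fexp_cst 1 (fprob_iid n fpi0)) -mulN1r -fexpZ -fexpD.
  by apply: eq_bigr => x _; rewrite mulN1r.
rewrite lerB //.
apply: (hK pS pA pi0 H n q E t J J _ m1 (rho ^+ 2 * CA)) => //.
- exact: fpS.
- exact: dlaw_lt.
- by rewrite -MrE.
- by move=> f f0; apply: dom.
- by rewrite mulr_gt0 ?exprn_gt0 //; lra.
- have -> : c * (rho ^+ 2 * CA) = (rho / 2) ^+ 2 by rewrite /c; field; rewrite gt_eqF //; lra.
  by rewrite ler_pXn2r ?nnegrE //; [lra|exact: ltW].
- by rewrite -MrE.
- apply: le_lt_trans (truncnS_gt _); rewrite -/s -MrE lerD2r ler_pM2l ?ltr0n //.
  apply: le_trans Em1 _; rewrite ler_pM2r ?invr_gt0 // /nu; lra.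
- exact: ltW (truncnS_gt _).
Qed.

End AverageQueue.
End SteadyState.

(** * Passage to the limit in time *)

Section SteadyTail.
Variable R : realType.

Lemma fexp_cvg (T : Type) (L : fdist R T) (u : T -> nat -> R) (l : T -> R) :
  (forall x, u x t @[t --> \oo] --> l x) ->
  fexp L (fun x => u x t) @[t --> \oo] --> fexp L l.
Proof.
move=> ul; rewrite /fexp; elim: L => [|x L IH].
  by rewrite big_nil; under eq_fun do rewrite big_nil; exact: cvg_cst.
rewrite big_cons; under eq_fun do rewrite big_cons.
by apply: cvgD => //; apply: cvgM => //; exact: cvg_cst.
Qed.

(** The initial states form a finite list, so the limit in time passes through the average, and the
    average disappears because all states have the same limit law. A continuity point of the limit
    is taken in ]a, a + 1[. *)
Lemma steady_tail (d : measure_display) (T : measurableType d) (P : probability T R)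
    (arr srv : nat -> {RV P >-> R}) (B alpha tol : R) (n M a : nat) (n0 : (0 < n)%N) (M0 : (0 < M)%N)
    (pi0 : fdist R nat) (mu : probability R R) :
  fprob pi0 -> is_steady_state arr srv B alpha n mu ->
  (forall t, 1 - tol <= fexp (iid pi0 n) (fun rs =>
    fine (P [set w | (queue_process arr srv B alpha (busy_start n (slot_gt0 R M0) rs)
      (M%:R^-1 * t%:R) w <= a%:R%:E)%E]))) ->
  ((1 - tol)%:E <= mu `]-oo, a.+1%:R]%classic)%E.
Proof.
move=> fpi steady avg.
have [x /andP[ax xa] xc] : exists2 x, a%:R < x < a.+1%:R &
    {for x, continuous (fun y : R => mu `]-oo, y]%classic)}.
  by apply: cdf_continuity_point; rewrite ltr_nat.
apply: le_trans (_ : mu `]-oo, x]%classic <= _)%E; last first.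
  by apply: le_measure; rewrite ?inE //; apply: subitvPr; rewrite bnd_simp ltW.
rewrite -[mu _]fineK ?fin_num_measure // lee_fin.
have Minv : 0 < M%:R^-1 :> R by rewrite invr_gt0 ltr0n.
have lim_rs rs : fine (P [set w | (queue_process arr srv B alpha
    (busy_start n (slot_gt0 R M0) rs) (M%:R^-1 * t%:R) w <= x%:E)%E])
    @[t --> \oo] --> fine (mu `]-oo, x]%classic).
  apply: fine_cvg; rewrite fineK ?fin_num_measure //.
  have h : (M%:R^-1 * t%:R : R) @[t --> \oo] --> +oo.
    apply/cvgryPge => y; apply: filterS (nbhs_infty_ger (y * M%:R)) => t.
    by rewrite [M%:R^-1 * _]mulrC ler_pdivlMr ?ltr0n.
  exact: cvg_comp h (steady (busy_start n (slot_gt0 R M0) rs) x xc).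
have lim_avg := @fexp_cvg _ (iid pi0 n) _ _ lim_rs.
rewrite (fexp_cst _ (fprob_iid n fpi)) in lim_avg.
rewrite -(cvg_lim (@Rhausdorff R) lim_avg).
apply: limr_ge; first by apply/cvg_ex; eexists; exact: lim_avg.
apply: nearW => t; apply: le_trans (avg t) _.
apply: fexp_le => [|rs]; first by case: (fprob_iid n fpi).
have mle z : measurable [set w | (queue_process arr srv B alpha
    (busy_start n (slot_gt0 R M0) rs) (M%:R^-1 * t%:R) w <= z%:E)%E].
  exact: measurable_queue_le.
rewrite fine_le ?fin_num_measure // le_measure ?inE //.
move=> w /= h; apply: le_trans h _.
by rewrite lee_fin ltW.
Qed.

End SteadyTail.


Theorem corollary1 (R : realType)
  (dA dS d : measure_display) (TA : measurableType dA)
  (TS : measurableType dS) (T : measurableType d)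
  (PA : probability TA R) (PS : probability TS R) (P : probability T R)
  (A : {RV PA >-> R}) (S : {RV PS >-> R})
  (arr srv : nat -> {RV P >-> R})
  (B eps : R)
  (A_ge0 : forall w, 0 <= A w) (S_ge0 : forall w, 0 <= S w)
  (EA : ('E_PA[A] = 1)%E) (ES : ('E_PS[S] = 1)%E)
  (EA2 : ('E_PA[(fun w => (A w ^+ 2)%R)] < +oo)%E)
  (eps_gt0 : 0 < eps) (eps_le1 : eps <= 1)
  (ES1eps : ('E_PS[(fun w => (S w `^ (1 + eps))%R)] < +oo)%E)
  (iid : iid_primitives A S arr srv)
  (B_gt0 : 0 < B)
  (large_n : \forall n \near \oo, steady_state_exists arr srv B 2 n)
  (dQ : nat -> measure_display) (TQ : forall n, measurableType (dQ n))
  (PQ : forall n, probability (TQ n) R) (Q : forall n, {RV (PQ n) >-> R})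
  (steady_Q : forall n : nat, 4 * B ^+ 2 < n%:R ->
     steady_state_exists arr srv B 2 n ->
     is_steady_state arr srv B 2 n (distribution (PQ n) (Q n))) :
  tight [set n : nat | 4 * B ^+ 2 < n%:R /\ steady_state_exists arr srv B 2 n]
        PQ
        (fun n w => n%:R `^ (- 2^-1) * Num.max (Q n w - n%:R) 0).
Proof.
move=> tol tol0.
have [K K0 hK] := average_queue A_ge0 S_ge0 EA ES EA2 eps_gt0 eps_le1 ES1eps iid B_gt0 tol0.
(* K bounds the truncation of sqrt n * K, and 2 the two successors in [a.+1 - n], each at most sqrt
   n. *)
exists `[0, K + 2]%classic; split; first exact: segment_compact.
move=> n /= [nB ss].
have [M [M0 [pi0 [fpi avg]]]] := hK n nB.
have n0 : (0 < n)%N by rewrite -(ltr0n R); apply: lt_trans nB; rewrite mulr_gt0 // exprn_gt0.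
have := steady_tail n0 fpi (steady_Q n nB ss) avg.
set a := (n + _)%N; rewrite /distribution /pushforward => tail.
have s1 : 1 <= Num.sqrt n%:R :> R.
  by rewrite -{1}[1]sqrtr1 ler_wsqrtr // ler1n.
set s := Num.sqrt n%:R in s1 a tail.
have s0 : 0 < s by lra.
pose Z := Q n @^-1` `]-oo, a.+1%:R]%classic.
have {}tail : ((1 - tol)%:E <= PQ n Z)%E by [].
have mZ : measurable Z by rewrite -[Z]setTI; exact: measurable_funPT.
have as_ : a.+1%:R - n%:R <= (K + 2) * s.
  have := @truncn_le R (s * K); rewrite mulr_ge0 ?(ltW s0) ?(ltW K0) // => h.
  by rewrite /a -addnS natrD addrAC subrr add0r -!natr1; lra.
have sub : (fun w => n%:R `^ (- 2^-1) * Num.max (Q n w - n%:R) 0) @^-1` (~` `[0, K + 2]%classic)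
    `<=` ~` Z.
  move=> w /= hw Zw; apply: hw; rewrite powRN powR12_sqrt // -/s in_itv /=.
  rewrite mulr_ge0 ?invr_ge0 ?(ltW s0) ?le_max ?lexx ?orbT //=.
  rewrite mulrC ler_pdivrMr // ge_max.
  have K2 : 0 <= K + 2 by apply: addr_ge0 => //; exact: ltW.
  rewrite (mulr_ge0 K2 (ltW s0)) andbT.
  by move: Zw; rewrite /Z /= in_itv /=; lra.
have mX : measurable_fun setT (fun w => n%:R `^ (- 2^-1) * Num.max (Q n w - n%:R) 0).
  apply: measurable_funM; first exact: measurable_cst.
  apply: measurable_maxr; last exact: measurable_cst.
  by apply: measurable_funB => //; exact: measurable_cst.
apply: le_trans (_ : PQ n (~` Z) <= _)%E.
  apply: le_measure => //; rewrite inE; last exact: measurableC.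
  rewrite -[X in measurable X]setTI; apply: mX => //.
  by apply: measurableC; exact: measurable_itv.
rewrite probability_setC // leeBlDr ?fin_num_measure //.
rewrite -[PQ n Z]fineK ?fin_num_measure // -EFinD lee_fin.
by move: tail; rewrite -[PQ n Z]fineK ?fin_num_measure // lee_fin; lra.
Qed.
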